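(* Let $R$ be an arithmetic local order and let $M$ be an $R$-lattice in $K^d$. Let $\underline{M}$ be any $\widetilde{R}$-lattice contained in $M$. The normalized lattice zeta function is given by the finite sum $$\nu^R_M(s):=\frac{\zeta^R_M(s)}{\zeta^{\widetilde{R}}_{\widetilde{R}^d}(s)}=\sum_{\boldsymbol{r}}\left(\prod_{i=1}^{b(R)}(|\kappa_i|^{-s};|\kappa_i|)_{r_i}\right)\left(\sum_{L\in B_R(M;\underline{M};\boldsymbol{r})}(M:L)^{-s}\right),$$ where $\boldsymbol{r}=(r_1,\dots,r_{b(R)})$ ranges over $\{0,\dots,d\}^{b(R)}$. This is a Dirichlet polynomial in $s$.
   Context: An arithmetic local order is a complete reduced Noetherian local ring $R$ of Krull dimension $1$ with finite residue field, whose normalization $\widetilde{R}=\prod_{i=1}^{b(R)}\widetilde{R}_i$ is a finitely generated $R$-module; here $\mathfrak{p}_1,\dots,\mathfrak{p}_{b(R)}$ are the minimal primes of $R$ and $\widetilde{R}_i$ is the integral closure of $R/\mathfrak{p}_i$ in its fraction field $K_i$ (a complete DVR with finite residue field $\kappa_i$). $K=\prod_iK_i$. An $R$-lattice (resp. $\widetilde{R}$-lattice) in $K^d$ is a finitely generated $R$- (resp. $\widetilde{R}$-) submodule whose $K$-span is $K^d$. $\zeta^R_M(s)=\sum_{N}|M/N|^{-s}$ over finite-index $R$-submodules $N\subseteq M$; $\zeta^{\widetilde{R}}_{\widetilde{R}^d}(s)=\sum_N|\widetilde{R}^d/N|^{-s}$ over finite-index $\widetilde{R}$-submodules $N\subseteq\widetilde{R}^d$.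 For lattices $L\subseteq M$, $(M:L)=|M/L|$. $(a;q)_n=\prod_{j=0}^{n-1}(1-aq^j)$. For a finitely generated $\widetilde{R}$-module $Q$, its rank vector is $\boldsymbol{\mathrm{rk}}(Q)=(\dim_{\kappa_i}(Q\otimes_{\widetilde{R}}\kappa_i))_{i=1}^{b(R)}$. The boundary locus stratum is $$B_R(M;\underline{M};\boldsymbol{r})=\{L\subseteq_RM \text{ an } R\text{-lattice}:\ \widetilde{R}L\supseteq\underline{M},\ \boldsymbol{\mathrm{rk}}(\widetilde{R}L/\underline{M})=\boldsymbol{r}\},$$ where $\widetilde{R}L$ is the $\widetilde{R}$-submodule of $K^d$ generated by $L$. A Dirichlet polynomial is a finite sum $\sum a_nn^{-s}$. *)

(* Defs.v *)
From HB Require Import structures.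
From mathcomp Require Import all_boot all_order all_algebra finmap.
From mathcomp Require Import all_classical all_reals all_analysis.
From mathcomp.analysis.showcase Require Import summability.
From mathcomp.real_closed Require Import complex.

Set Implicit Arguments.
Unset Strict Implicit.
Unset Printing Implicit Defensive.

Import Order.TTheory GRing.Theory Num.Theory.
Import numFieldNormedType.Exports.

Local Open Scope classical_set_scope.
Local Open Scope ring_scope.

Section Modules.
Variables (A : pzRingType) (V : lmodType A).

(* [S] is meant to be a subring of [A] or, in [lspan], an ideal of a subring;
   [lspan S X] is the set of finite sums of terms [a *: x] with [a] in [S] and
   [x] in [X]. *)
Definition lspan (S : set A) (X : set V) : set V :=
  [set x | exists (n : nat) (a : 'I_n -> A) (v : 'I_n -> V),
     [/\ forall j, S (a j), forall j, X (v j) & x = \sum_j a j *: v j]].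

Definition submodule (S : set A) (N : set V) : Prop :=
  [/\ N 0, forall x y, N x -> N y -> N (x + y)
         & forall a x, S a -> N x -> N (a *: x)].

Definition fin_gen (S : set A) (N : set V) : Prop :=
  exists (n : nat) (v : 'I_n -> V), N = lspan S (range v).

Definition lattice (S : set A) (N : set V) : Prop :=
  [/\ submodule S N, fin_gen S N & lspan setT N = setT].

End Modules.

Section Index.
Variable V : zmodType.

Definition cosets (M N : set V) : set (set V) :=
  [set [set x + y | y in N] | x in M].

Definition finite_index (M N : set V) : Prop := finite_set (cosets M N).

(* [|M / N|], meaningful when [finite_index M N]; equal to 0 otherwise. *)
Definition index (M N : set V) : nat := #|` fset_set (cosets M N)|.

End Index.

Section CommutativeAlgebra.
Variable R : comNzRingType.

(* [idealr_closed] includes properness. *)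
Definition prime_ideal (p : {pred R}) : Prop :=
  idealr_closed p /\ prime_idealr_closed p.

Definition minimal_prime (p : {pred R}) : Prop :=
  prime_ideal p /\
  forall q, prime_ideal q -> {subset q <= p} -> {subset p <= q}.

Definition maximal_ideal (m : {pred R}) : Prop :=
  idealr_closed m /\
  forall I, idealr_closed I -> {subset m <= I} -> {subset I <= m}.

Definition local_ring (m : {pred R}) : Prop :=
  maximal_ideal m /\ forall m', maximal_ideal m' -> m' =i m.

Definition noetherian : Prop :=
  forall I : {pred R}, idealr_closed I ->
    @fin_gen R R^o setT [set x | x \in I].

Definition reduced : Prop := forall (x : R) (n : nat), x ^+ n = 0 -> x = 0.

Definition prime_chain (n : nat) (p : nat -> {pred R}) : Prop :=
  (forall k, (k <= n)%N -> prime_ideal (p k)) /\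
  (forall k, (k < n)%N ->
     {subset p k <= p k.+1} /\ exists2 x, x \in p k.+1 & x \notin p k).

Definition krull_dim (n : nat) : Prop :=
  (exists p, prime_chain n p) /\ ~ (exists p, prime_chain n.+1 p).

Definition ideal_pow (I : {pred R}) (n : nat) : set R :=
  @lspan R R^o setT
    [set x | exists2 y : 'I_n -> R, forall j, y j \in I & x = \prod_j y j].

(* [R -> lim_n R / m ^ n] is bijective. *)
Definition adically_complete (m : {pred R}) : Prop :=
  forall a : nat -> R,
    (forall n, ideal_pow m n (a n.+1 - a n)) ->
    exists! x, forall n, ideal_pow m n (x - a n).

End CommutativeAlgebra.

Section ProductRing.
Variables (b : nat) (K : 'I_b -> fieldType).

Definition total_ring : Type := forall i, K i.

HB.instance Definition _ := Choice.on total_ring.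

Let add (x y : total_ring) : total_ring := fun i => x i + y i.
Let opp (x : total_ring) : total_ring := fun i => - x i.
Let zero : total_ring := fun=> 0.
Let one : total_ring := fun=> 1.
Let mul (x y : total_ring) : total_ring := fun i => x i * y i.

Let addA : associative add.
Proof. by move=> x y z; apply: functional_extensionality_dep => i; exact: addrA. Qed.
Let addC : commutative add.
Proof. by move=> x y; apply: functional_extensionality_dep => i; exact: addrC. Qed.
Let add0 : left_id zero add.
Proof. by move=> x; apply: functional_extensionality_dep => i; exact: add0r. Qed.
Let addN : left_inverse zero opp add.
Proof. by move=> x; apply: functional_extensionality_dep => i; exact: addNr. Qed.
HB.instance Definition _ := GRing.isZmodule.Build total_ring addA addC add0 addN.

Let mulA : associative mul.
Proof. by move=> x y z; apply: functional_extensionality_dep => i; exact: mulrA. Qed.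
Let mulC : commutative mul.
Proof. by move=> x y; apply: functional_extensionality_dep => i; exact: mulrC. Qed.
Let mul1 : left_id one mul.
Proof. by move=> x; apply: functional_extensionality_dep => i; exact: mul1r. Qed.
Let mulD : left_distributive mul +%R.
Proof. by move=> x y z; apply: functional_extensionality_dep => i; exact: mulrDl. Qed.
HB.instance Definition _ :=
  GRing.Zmodule_isComPzRing.Build total_ring mulA mulC mul1 mulD.

End ProductRing.

Section ArithmeticLocalOrder.
Variables (R : comNzRingType) (b : nat) (K : 'I_b -> fieldType).
Variable iota : forall i, {rmorphism R -> K i}.

Definition base_ring : set (total_ring K) :=
  range (fun x : R => (fun i => iota i x) : total_ring K).

(* A monic polynomial over the image of [R] lifts to a monic one over [R], so
   [integralOver (iota i)] is integrality over [R / ker (iota i)]. *)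
Definition branch (i : 'I_b) : set (K i) := [set x | integralOver (iota i) x].
Arguments branch i _ : clear implicits.

Definition branch_max (i : 'I_b) : set (K i) :=
  [set x | branch i x /\ ~ (x != 0 /\ branch i x^-1)].
Arguments branch_max i _ : clear implicits.

Definition normalization : set (total_ring K) :=
  [set x | forall i, branch i (x i)].

Definition residue_card (i : 'I_b) : nat := index (branch i) (branch_max i).

(* [alo_minimal], [alo_minimal_inj] and [alo_minimal_surj] say that
   [i |-> ker (iota i)] enumerates the minimal primes without repetition;
   together with [alo_fraction] they say that [K i] is the fraction field of
   the quotient of [R] by the [i]-th one. *)
Record arithmetic_local_order : Prop := ArithmeticLocalOrder {
  alo_noetherian : noetherian R;
  alo_reduced : reduced R;
  alo_krull_dim : krull_dim R 1;
  alo_local : exists m : {pred R},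
    [/\ local_ring m, adically_complete m
      & finite_index [set: R] [set x | x \in m]];
  alo_minimal : forall i, minimal_prime [pred x : R | iota i x == 0];
  alo_minimal_inj : forall i j,
    (forall x, (iota i x == 0) = (iota j x == 0)) -> i = j;
  alo_minimal_surj : forall p : {pred R}, minimal_prime p ->
    exists i, forall x, (x \in p) = (iota i x == 0);
  alo_fraction : forall i (z : K i), exists x y : R,
    iota i y != 0 /\ z = iota i x / iota i y;
  alo_normalization :
    @fin_gen (total_ring K) (total_ring K)^o base_ring normalization
}.

Section Lattices.
Variable d : nat.
Local Notation V := 'rV[total_ring K]_d.

Definition free_lattice : set V :=
  [set v | forall j, normalization (v ord0 j)].

(* The maximal ideal of the normalization lying over the [i]-th factor; the
   quotient by it is the [i]-th residue field. *)
Definition norm_max (i : 'I_b) : set (total_ring K) :=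
  [set x | normalization x /\ branch_max i (x i)].

(* The tensor product of [Q := N / N0] with the [i]-th residue field is
   [Q / norm_max i Q = N / (N0 + norm_max i N)]; [r] is its dimension: the
   classes of [v 0, ..., v (r - 1)] form a basis. *)
Definition rank_at (N N0 : set V) (i : 'I_b) (r : nat) : Prop :=
  let N1 := [set x + y | x in N0 & y in lspan (norm_max i) N] in
  exists v : 'I_r -> V,
    [/\ forall j, N (v j),
        forall x, N x -> exists a : 'I_r -> total_ring K,
          (forall j, normalization (a j)) /\ N1 (x - \sum_j a j *: v j)
      & forall a : 'I_r -> total_ring K, (forall j, normalization (a j)) ->
          N1 (\sum_j a j *: v j) -> forall j, norm_max i (a j)].

Definition boundary_stratum (M Mu : set V) (r : 'I_b -> nat) : set (set V) :=
  [set L | [/\ lattice base_ring L, L `<=` M, Mu `<=` lspan normalization L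
             & forall i, rank_at (lspan normalization L) Mu i (r i)]].

Definition fin_index_submodules (S : set (total_ring K)) (M : set V) :
    set (set V) :=
  [set N | [/\ submodule S N, N `<=` M & finite_index M N]].

End Lattices.
End ArithmeticLocalOrder.

Arguments branch {R b K} iota i _.
Arguments branch_max {R b K} iota i _.
Arguments free_lattice {R b K} iota d _.

Section Analysis.
Variable F : realType.
Local Notation C := F[i].

(* [n ^ s] for a positive integer [n], with the real logarithm of [n]. *)
Definition cpow (n : nat) (s : C) : C :=
  let x := ln (n%:R : F) in
  let t := complex.Im s * x in
  Complex (expR (complex.Re s * x) * cos t) (expR (complex.Re s * x) * sin t).

Definition qpoch (a q : C) (n : nat) : C := \prod_(j < n) (1 - a * q ^+ j).

(* Unordered sums: limits along the finite subsets of the index type, which for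
   complex terms amounts to absolute convergence. *)
Definition partial_sums (I : choiceType) (D : set I) (f : I -> C)
    (B : {fset I}) : C^o := \sum_(i <- B | i \in D) f i.

Definition csummable (I : choiceType) (D : set I) (f : I -> C) : Prop :=
  cvg (partial_sums D f @ totally).

Definition csum (I : choiceType) (D : set I) (f : I -> C) : C :=
  lim (partial_sums D f @ totally).

Section Zeta.
Variables (b : nat) (K : 'I_b -> fieldType) (d : nat).
Local Notation V := 'rV[total_ring K]_d.

Definition zeta_converges (S : set (total_ring K)) (M : set V) (s : C) : Prop :=
  csummable (fin_index_submodules S M) (fun N => cpow (index M N) (- s)).

Definition zeta (S : set (total_ring K)) (M : set V) (s : C) : C :=
  csum (fin_index_submodules S M) (fun N => cpow (index M N) (- s)).

End Zeta.

Section NormalizedZeta.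
Variables (R : comNzRingType) (b : nat) (K : 'I_b -> fieldType).
Variable iota : forall i, {rmorphism R -> K i}.
Variable d : nat.
Local Notation V := 'rV[total_ring K]_d.

Definition normalized_zeta (M : set V) (s : C) : C :=
  zeta (base_ring iota) M s / zeta (normalization iota) (free_lattice iota d) s.

Definition boundary_sum (M Mu : set V) (s : C) : C :=
  \sum_(r : {ffun 'I_b -> 'I_d.+1})
    (\prod_(i < b) qpoch (cpow (residue_card iota i) (- s))
                         (residue_card iota i)%:R (r i)) *
    (\sum_(L \in boundary_stratum iota M Mu (fun i => r i))
       cpow (index M L) (- s)).

End NormalizedZeta.

Definition dirichlet_polynomial (f : C -> C) : Prop :=
  exists (N : nat) (a : nat -> C),
    forall s, f s = \sum_(1 <= n < N) a n * cpow n (- s).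

End Analysis.

(* Main.v *)
Require Import Defs.
From HB Require Import structures.
From mathcomp Require Import all_boot all_order all_algebra finmap.
From mathcomp Require Import all_classical all_reals all_analysis.
From mathcomp.analysis.showcase Require Import summability.
From mathcomp.real_closed Require Import complex.
From mathcomp Require Import ring lra zify.

(** Let [Rt], the normalization, be the product of the integral closures of [R]
    in the fields [K i], with residue cardinalities [q i].

    Finiteness. In dimension one an ideal of [R] contained in no minimal prime
    has finite index ([finite_index_ideal]); hence nested lattices have finite
    index in each other, the finite-index submodules of a lattice are the
    lattices inside it, and only finitely many members of the boundary strata
    exist. Completeness of [R] lifts idempotents, so each branch is local, and
    being integrally closed with finite quotients it is a discrete valuation
    ring ([discrete_valuation]).

    Supplements. For a free [Rt]-module [N] and a submodule [P], let [Z N P] be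
    the sum of [alpha (N : T)], with [alpha n] standing for [n ^ (- s)], over the
    submodules [T] with [T + P = N]. When [P] grows by a vector [x] spanning a
    simple module at the [i]-th factor, the new supplements [T] are those for
    which [T + P] is a complement of the line of [x]; there are [q i ^ r]
    complements, where [r] is the [i]-th rank of [N / (P + Rt x)], and each of
    them looks like [N] itself ([complement_automorphism]). Hence
    [Z N P = (1 - q i ^ r * alpha (q i)) * Z N (P + Rt x)], and descending from
    [N] in this way multiplies [Z N N], the zeta function of [Rt], by the
    q-Pochhammer symbols of the ranks of [N / P]. For [P] the Jacobson radical of
    [N] the only supplement is [N], so all the factors together invert the zeta
    function: this is its Euler product, which shows that it does not vanish and,
    applied to truncated sums, that it converges for [Re s > d - 1].

    Comparison. A finite-index submodule [L'] of [M] determines [T = Rt L'] and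
    [N = T + Mu], and [T] supplements [Mu] in [N]. An automorphism of the ambient
    space that maps [N] onto [T] and is congruent to the identity modulo [Mu]
    ([automorphism_mod]) preserves containment in [M], because [Mu] lies in [M];
    it therefore matches the [L'] over [T] with the [L] in [M] over [N], and
    multiplies indices by [(N : T)]. So the zeta function of [M] is the sum over
    the [L] with [Rt L] containing [Mu] of [(M : L) ^ (- s) * Z (Rt L) Mu], and
    grouping the [L] by the ranks of [Rt L / Mu] gives the formula
    ([has_csum_boundary]). *)

Set Implicit Arguments.
Unset Strict Implicit.
Unset Printing Implicit Defensive.

Import Order.TTheory GRing.Theory Num.Theory.
Import numFieldNormedType.Exports.

Local Open Scope classical_set_scope.
Local Open Scope ring_scope.

Local Notation index := Defs.index.

(** * Indices of subgroups through transversals *)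

Section Transversals.
Variable V : zmodType.
Implicit Types (M N P : set V).

Definition subgroup N := N 0 /\ forall x y, N x -> N y -> N (x - y).

Lemma subgroup0 N : subgroup N -> N 0. Proof. by case. Qed.

Lemma subgroupB N x y : subgroup N -> N x -> N y -> N (x - y).
Proof. by case=> _; apply. Qed.

Lemma subgroupN N x : subgroup N -> N x -> N (- x).
Proof. by move=> gN Nx; rewrite -sub0r; apply: subgroupB => //; case: gN. Qed.

Lemma subgroupD N x y : subgroup N -> N x -> N y -> N (x + y).
Proof.
by move=> gN Nx Ny; rewrite -(opprK y); apply: subgroupB => //; exact: subgroupN.
Qed.

Lemma subgroup_sum N (I : Type) (r : seq I) (Q : pred I) (F : I -> V) :
  subgroup N -> (forall i, Q i -> N (F i)) -> N (\sum_(i <- r | Q i) F i).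
Proof.
move=> gN NF; elim/big_ind: _ => //; first exact: subgroup0.
by move=> *; exact: subgroupD.
Qed.

Lemma subgroup_sym N x y : subgroup N -> N (x - y) -> N (y - x).
Proof. by move=> gN Nxy; rewrite -opprB; exact: subgroupN. Qed.

Lemma subgroup_trans N y x z :
  subgroup N -> N (x - y) -> N (y - z) -> N (x - z).
Proof.
by move=> gN ? ?; rewrite -(subrK y x) -addrA; exact: subgroupD.
Qed.

Lemma subgroup_subl N x y : subgroup N -> N (x - y) -> N y -> N x.
Proof. by move=> gN Nxy Ny; rewrite -(subrK y x); exact: subgroupD. Qed.

Lemma subgroup_subr N x y : subgroup N -> N (x - y) -> N x -> N y.
Proof. by move=> gN Nxy Nx; exact: subgroup_subl (subgroup_sym gN Nxy) Nx. Qed.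

Definition coset N x : set V := [set x + y | y in N].

Lemma cosetP N x y : subgroup N -> coset N x = coset N y <-> N (x - y).
Proof.
move=> gN; split=> [e|Nxy].
  have : coset N x x by exists 0; [exact: subgroup0|rewrite addr0].
  by rewrite e => -[z Nz <-]; rewrite addrC addrA addNr add0r.
have h u v : N (u - v) -> coset N u `<=` coset N v.
  move=> Nuv _ [z Nz <-]; exists (u - v + z); first exact: subgroupD.
  by rewrite addrA [v + (_ - _)]addrC subrK.
by apply/seteqP; split; apply: h => //; exact: subgroup_sym.
Qed.

(** The index type is an arbitrary finite type, so that products and function
    spaces of representatives can be used without renumbering them. *)
Definition transversal M N (I : finType) (r : I -> V) :=
  [/\ forall i, M (r i), forall x, M x -> exists i, N (x - r i)
    & forall i j, N (r i - r j) -> i = j].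

Lemma transversal_index M N (I : finType) (r : I -> V) :
  subgroup N -> transversal M N r -> finite_index M N /\ index M N = #|I|.
Proof.
move=> gN [rM rP rI]; rewrite /finite_index /Defs.index.
have -> : cosets M N = [set` [fset coset N (r i) | i in I]%fset].
  apply/seteqP; split=> [_ [x Mx <-]|C /=].
    have [i Ni] := rP _ Mx; apply/imfsetP; exists i => //=.
    by apply/cosetP.
  by move=> /imfsetP[i _ ->]; exists (r i).
split; first exact: finite_fset.
rewrite set_fsetK card_imfset /=.
  by rewrite cardE; apply/perm_size/uniq_perm; rewrite ?enum_finmem_uniq ?enum_uniq//
    => i; rewrite enum_finmemE mem_enum.
by move=> i j /cosetP => /(_ gN)/rI.
Qed.

Lemma finite_index_transversal M N : subgroup N -> finite_index M N ->
  exists r : 'I_(index M N) -> V, transversal M N r.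
Proof.
move=> gN fMN.
have cP (i : 'I_(index M N)) :
    exists x, M x /\ coset N x = nth set0 (fset_set (cosets M N)) i.
  have : nth set0 (fset_set (cosets M N)) i \in fset_set (cosets M N).
    by apply: mem_nth; rewrite -[X in (_ < X)%N]/(index M N).
  by rewrite in_fset_set// => /set_mem[x Mx xE]; exists x.
pose r i := sval (cid (cP i)).
have rM i : M (r i) by rewrite /r; case: cid => x /= [].
have rE i : coset N (r i) = nth set0 (fset_set (cosets M N)) i.
  by rewrite /r; case: cid => x /= [].
exists r; split=> // [x Mx|i j /(cosetP _ _ gN)].
  have : coset N x \in fset_set (cosets M N).
    by rewrite in_fset_set//; apply/mem_set; exists x.
  move=> xC.
  have lt : (seq.index (coset N x) (fset_set (cosets M N)) < index M N)%N.
    by rewrite index_mem.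
  by exists (Ordinal lt); apply/cosetP => //; rewrite rE /= nth_index.
rewrite !rE => /eqP; rewrite nth_uniq ?fset_uniq// => /eqP.
exact: val_inj.
Qed.

Lemma index_gt0 M N : subgroup N -> M 0 -> finite_index M N ->
  (0 < index M N)%N.
Proof.
move=> gN M0 /(finite_index_transversal gN)[r [_ /(_ _ M0)[i _] _]].
exact: leq_ltn_trans (leq0n i) (ltn_ord i).
Qed.

Lemma indexid N : subgroup N -> finite_index N N /\ index N N = 1%N.
Proof.
move=> gN; rewrite -card_unit.
apply: (@transversal_index _ _ unit (fun=> 0)) => //; split=> [_|x Nx|[] []//].
  exact: subgroup0.
by exists tt; rewrite subr0.
Qed.

Lemma index_mul M N P : subgroup N -> subgroup P -> N `<=` M -> P `<=` N ->
  subgroup M -> finite_index M N -> finite_index N P ->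
  finite_index M P /\ index M P = (index M N * index N P)%N.
Proof.
move=> gN gP NM PN gM.
move=> /(finite_index_transversal gN)[r [rM rP rI]].
move=> /(finite_index_transversal gP)[s [sN sP sI]].
rewrite -(card_ord (index M N)) -(card_ord (index N P)) -card_prod.
apply: (@transversal_index _ _ _ (fun k => r k.1 + s k.2)) => //; split.
- by move=> k; apply: subgroupD => //; exact: NM.
- move=> x /rP[i /sP[j Pj]]; exists (i, j) => /=.
  by rewrite opprD addrA.
move=> [i j] [i' j'] /= h; have ii' : i = i'.
  apply: rI; have -> : r i - r i' = (r i + s j - (r i' + s j')) - (s j - s j').
    by rewrite opprD addrACA addrK.
  by apply: subgroupB => //; [exact: PN|exact: subgroupB].
congr (_, _) => //; apply: sI; move: h; rewrite ii' opprD addrACA addrN add0r//.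
Qed.

Lemma finite_index_subl M N P : N `<=` M -> finite_index M P -> finite_index N P.
Proof. by move=> NM; apply: sub_finite_set => _ [x Nx <-]; exists x => //; exact: NM. Qed.

Lemma finite_index_subr M N P : subgroup P -> subgroup N -> P `<=` N ->
  finite_index M P -> finite_index M N.
Proof.
move=> gP gN PN /(finite_index_transversal gP)[r [rM rP _]].
apply: (@sub_finite_set _ _ ((fun i => coset N (r i)) @` setT)).
  move=> _ [x /rP[i Pi] <-]; exists i => //.
  by apply/cosetP => //; apply: subgroup_sym => //; exact: PN.
exact: finite_image.
Qed.

Lemma index_mulr M N P : subgroup M -> subgroup N -> subgroup P ->
  N `<=` M -> P `<=` N -> finite_index M P ->
  index M P = (index M N * index N P)%N.
Proof.
move=> gM gN gP NM PN fMP.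
have [] // := index_mul gN gP NM PN gM (finite_index_subr gP gN PN fMP).
exact: finite_index_subl fMP.
Qed.

Lemma index_eq1 M N : subgroup M -> subgroup N -> finite_index M N ->
  index M N = 1%N -> M `<=` N.
Proof.
move=> gM gN fMN eMN x Mx.
have [r [_ rP _]] := finite_index_transversal gN fMN.
have [i xi] := rP _ Mx; have [j] := rP _ (subgroup0 gM).
have -> : j = i by apply: val_inj; move: (ltn_ord i) (ltn_ord j) eMN => /=; lia.
move=> oj.
by have := subgroupB gN xi oj; rewrite sub0r opprK subrK.
Qed.

(** Indices see strict inclusions: this makes every induction on an index
    terminate. *)
Lemma index_ltr M N P : subgroup M -> subgroup N -> subgroup P ->
  N `<=` M -> P `<=` N -> finite_index M P -> ~ N `<=` P ->
  (index M N < index M P)%N.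
Proof.
move=> gM gN gP NM PN fMP nNP.
have fNP : finite_index N P by exact: finite_index_subl fMP.
have fMN : finite_index M N by exact: finite_index_subr fMP.
rewrite (index_mulr gM gN gP NM PN fMP).
have := index_gt0 gP (subgroup0 gN) fNP.
have := index_gt0 gN (subgroup0 gM) fMN.
have : index N P != 1%N.
  by apply/eqP => e; apply: nNP; exact: index_eq1.
by nia.
Qed.

(** The source of all nilpotency statements below: the powers of a scalar,
    applied to a vector, repeat modulo a subgroup of finite index. *)
Lemma finite_index_pigeonhole M N (u : nat -> V) : subgroup N ->
  finite_index M N -> (forall n, M (u n)) ->
  exists i j, [/\ (i < j)%N, (j <= index M N)%N & N (u i - u j)].
Proof.
move=> gN fMN Mu.
have [r [_ rP _]] := finite_index_transversal gN fMN.
pose f (n : 'I_(index M N).+1) := sval (cid (rP _ (Mu n))).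
have fP (n : 'I_(index M N).+1) : N (u n - r (f n)) by rewrite /f; case: cid.
have /injectivePn[i [j ij fij]] : ~~ injectiveb f.
  apply/negP => /injectiveP/leq_card; rewrite !card_ord ltnn//.
wlog lt : i j ij fij / (i < j)%N.
  have /orP[] : ((i < j) || (j < i))%N by rewrite -neq_ltn.
    by move=> lt /(_ i j ij fij lt).
  by move=> lt /(_ j i _ _ lt); apply => //; rewrite eq_sym.
exists i, j; split => //; first by rewrite -ltnS.
apply: (subgroup_trans gN (fP i)); rewrite fij.
exact: subgroup_sym.
Qed.

Lemma finite_index_surj (I : finType) M N (r : I -> V) : subgroup N ->
  (forall x, M x -> exists i, N (x - r i)) -> finite_index M N.
Proof.
move=> gN rP; apply: (@sub_finite_set _ _ ((fun i => coset N (r i)) @` setT)).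
  move=> _ [x /rP[i Pi] <-]; exists i => //.
  by apply/cosetP => //; exact: subgroup_sym.
exact: finite_image.
Qed.

(** A subgroup between [X] and [M] is a union of cosets of [X]. *)
Lemma finite_set_between M X : subgroup X -> finite_index M X ->
  finite_set [set T | [/\ subgroup T, X `<=` T & T `<=` M]].
Proof.
move=> gX fMX; have [r [rM rP _]] := finite_index_transversal gX fMX.
pose f (J : {set 'I_(index M X)}) : set V := [set x | exists2 i, i \in J & X (x - r i)].
apply: (@sub_finite_set _ _ (f @` setT)); last exact: finite_image.
move=> T [gT XT TM]; exists [set i | `[< T (r i) >]]%SET => //.
apply/seteqP; split=> x.
  by move=> [k]; rewrite inE => /asboolP Ti /XT /subgroup_subl; apply.
move=> Tx; have [i xi] := rP _ (TM _ Tx); exists i => //.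
rewrite inE; apply/asboolP; apply: subgroup_subr Tx => //; exact: XT.
Qed.

End Transversals.

Section IndexTransport.
Variables (V W : zmodType) (g : V -> W).
Hypothesis gB : forall x y, g (x - y) = g x - g y.
Hypothesis g_inj : injective g.

Lemma subgroup_image (N : set V) : subgroup N -> subgroup (g @` N).
Proof.
move=> gN; split.
  by exists 0; [exact: subgroup0|rewrite -[X in g X](subrr 0) gB subrr].
move=> _ _ [x Nx <-] [y Ny <-]; exists (x - y); first exact: subgroupB.
exact: gB.
Qed.

Lemma index_image (M N : set V) : subgroup N -> finite_index M N ->
  finite_index (g @` M) (g @` N) /\ index (g @` M) (g @` N) = index M N.
Proof.
move=> gN /(finite_index_transversal gN)[r [rM rP rI]].
rewrite -[RHS]card_ord.
apply: (@transversal_index _ _ _ _ (g \o r)); first exact: subgroup_image.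
split=> [i|_ [x Mx <-]|i j /=]; first by exists (r i).
  by have [i xi] := rP _ Mx; exists i; exists (x - r i).
by rewrite -gB => -[x Nx /g_inj xE]; apply: rI; rewrite -xE.
Qed.

End IndexTransport.

(** * Spans, submodules and ideals *)

Section Spans.
Variables (A : pzRingType) (V : lmodType A).
Implicit Types (S : set A) (X N : set V).

Definition subring S :=
  [/\ S 1, subgroup S & forall a a', S a -> S a' -> S (a * a')].

Lemma submodule_add S N P : submodule S N -> submodule S P ->
  submodule S [set x + y | x in N & y in P].
Proof.
move=> [N0 ND NZ] [P0 PD PZ]; split.
- by exists 0 => //; exists 0 => //; rewrite addr0.
- move=> _ _ [x Nx [y Py <-]] [x' Nx' [y' Py' <-]].
  by exists (x + x'); [exact: ND|exists (y + y'); [exact: PD|rewrite addrACA]].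
- move=> a _ Sa [x Nx [y Py <-]].
  by exists (a *: x); [exact: NZ|exists (a *: y); [exact: PZ|rewrite scalerDr]].
Qed.

Lemma submodule_subgroup S N : subring S -> submodule S N -> subgroup N.
Proof.
move=> [S1 gS _] [N0 ND NZ]; split=> // x y Nx Ny.
by apply: ND => //; rewrite -scaleN1r; apply: NZ => //; exact: subgroupN.
Qed.

Lemma lspan_sub S X N : submodule S N -> X `<=` N -> lspan S X `<=` N.
Proof.
move=> [N0 ND NZ] XN x [n [a [v [Sa Xv ->]]]].
by elim/big_ind: _ => // j _; apply: NZ => //; exact: XN.
Qed.

Lemma sub_lspan S X : S 1 -> X `<=` lspan S X.
Proof.
move=> S1 x Xx; exists 1%N, (fun=> 1), (fun=> x); split=> //.
by rewrite big_ord1 scale1r.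
Qed.

Lemma lspanD S X x y : lspan S X x -> lspan S X y -> lspan S X (x + y).
Proof.
move=> [n [a [v [Sa Xv ->]]]] [n' [a' [v' [Sa' Xv' ->]]]].
exists (n + n')%N, (fun k => match fintype.split k with inl j => a j | inr j => a' j end),
  (fun k => match fintype.split k with inl j => v j | inr j => v' j end); split.
- by move=> k; case: fintype.split.
- by move=> k; case: fintype.split.
rewrite big_split_ord /=; congr (_ + _); apply: eq_bigr => j _.
  by rewrite -[lshift _ _]/(unsplit (inl j)) unsplitK.
by rewrite -[rshift _ _]/(unsplit (inr j)) unsplitK.
Qed.

Lemma lspan_submodule S X : (forall a a', S a -> S a' -> S (a * a')) ->
  submodule S (lspan S X).
Proof.
move=> SM; split; last 1 first.
- move=> c _ Sc [n [a [v [Sa Xv ->]]]].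
  exists n, (fun j => c * a j), v; split=> // [j|]; first exact: SM.
  by rewrite scaler_sumr; apply: eq_bigr => j _; rewrite scalerA.
- exists 0%N, (fun=> 0), (fun=> 0); split; try by case.
  by rewrite big_ord0.
- exact: lspanD.
Qed.

Lemma lspan_rangeP S n (v : 'I_n -> V) x : subgroup S ->
  lspan S (range v) x <->
  exists2 a : 'I_n -> A, (forall j, S (a j)) & x = \sum_j a j *: v j.
Proof.
move=> gS; split=> [[p [a [w [Sa vw ->]]]]|[a Sa ->]]; last first.
  by exists n, a, v; split=> // j; exists j.
have /choice[f fE] j : exists k, v k = w j by have [k _] := vw j; exists k.
exists (fun k => \sum_(j | f j == k) a j).
  by move=> k; apply: subgroup_sum.
under [RHS]eq_bigr do rewrite scaler_suml.
rewrite (exchange_big_dep xpredT)//=; apply: eq_bigr => j _.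
by rewrite (big_pred1 (f j)) ?fE// => k; rewrite eq_sym.
Qed.

(** A finitely generated module becomes finite modulo any ideal of finite
    index. *)
Lemma finite_index_span S (J : set A) n (v : 'I_n -> V) (N : set V) :
  subgroup S -> subgroup J -> finite_index S J -> subgroup N ->
  (forall a j, J a -> N (a *: v j)) ->
  finite_index (lspan S (range v)) N.
Proof.
move=> gS gJ /(finite_index_transversal gJ)[r [rS rP _]] gN JN.
apply: (finite_index_surj
  (r := fun f : {ffun 'I_n -> 'I_(index S J)} => \sum_j r (f j) *: v j)) => //.
move=> x /lspan_rangeP -/(_ gS) [a Sa ->].
have /choice[f fE] j : exists k, J (a j - r k) by apply: rP.
exists [ffun j => f j]; rewrite -sumrB; apply: subgroup_sum => // j _.
by rewrite ffunE -scalerBl; exact: JN.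
Qed.

End Spans.

Lemma principal_subgroup (A : pzRingType) (S : set A) c : subgroup S ->
  subgroup [set c * t | t in S].
Proof.
move=> gS; split=> [|_ _ [s Ss <-] [t St <-]].
  by exists 0; [exact: subgroup0|rewrite mulr0].
by exists (s - t); [exact: subgroupB|rewrite mulrBr].
Qed.

Section Ideals.
Variable R : comNzRingType.
Implicit Types (I J : set R) (m : {pred R}).

Definition ideal I := I 0 /\ forall a u v, I u -> I v -> I (a * u + v).

Lemma ideal_subgroup I : ideal I -> subgroup I.
Proof.
by case=> I0 IP; split=> // x y Ix Iy; rewrite addrC -mulN1r; exact: IP.
Qed.

Lemma idealM I a u : ideal I -> I u -> I (a * u).
Proof. by move=> [I0 IP] Iu; rewrite -[_ * _]addr0; exact: IP. Qed.

Lemma in_asboolP I x : reflect (I x) (x \in [pred x | `[< I x >]]).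
Proof. exact: asboolP. Qed.

Lemma proper_idealr_closed I : ideal I -> ~ I 1 ->
  idealr_closed [pred x | `[< I x >]].
Proof.
move=> [I0 IP] I1; split.
- exact/in_asboolP.
- by apply/negP => /in_asboolP.
- by move=> a u v /in_asboolP ? /in_asboolP ?; apply/in_asboolP/IP.
Qed.

Lemma idealr_closed_ideal (p : {pred R}) : idealr_closed p ->
  ideal [set x | x \in p].
Proof. by case=> p0 p1 pP; split=> // a u v; exact: pP. Qed.

(** Zorn's lemma applies because the finitely many generators of the union of a
    chain already lie in one of its members. *)
Lemma noetherian_max (Q : set (set R)) : noetherian R ->
  (forall I, Q I -> ideal I /\ ~ I 1) -> (exists I, Q I) ->
  exists2 J, Q J & forall I, Q I -> J `<=` I -> I `<=` J.
Proof.
move=> noeth QP [I0 QI0].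
have [|J [[QJ|J0] Jmax]] := @Zorn_bigcup R (fun X => Q X \/ X = set0); last 2 first.
- exists J => // I QI JI; apply: contrapT => IJ.
  by apply: (Jmax I); [rewrite properEneq; split => //; apply/eqP => e; apply: IJ; rewrite e|left].
- exfalso; apply: (Jmax I0); last by left.
  have [[i0 _] _] := QP _ QI0.
  by rewrite J0; split=> // /(_ _ i0).
move=> F FP tot; have [[X0 [FX0 QX0]]|no] := pselect (exists X, F X /\ Q X); last first.
  right; rewrite -subset0 => x [X FX Xx].
  by have [QX|X0] := FP _ FX; [apply: no; exists X|rewrite X0 in Xx].
left; set U := \bigcup_(X in F) X.
have FQ X x : F X -> X x -> Q X.
  by move=> /FP[//|->].
have idU : ideal U.
  split=> [|a u v [X FX Xu] [Y FY Yv]].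
    by exists X0 => //; have [[]] := QP _ QX0.
  have [[_ XP] _] := QP _ (FQ _ _ FX Xu); have [[_ YP] _] := QP _ (FQ _ _ FY Yv).
  have [XY|YX] := tot _ _ FX FY; first by exists Y => //; apply: YP => //; exact: XY.
  by exists X => //; apply: XP => //; exact: YX.
have U1 : ~ U 1.
  by move=> [X FX X1]; have [_] := QP _ (FQ _ _ FX X1); apply.
have [n [v vE]] := noeth _ (proper_idealr_closed idU U1).
have UE x : U x <-> lspan setT (range v) x.
  by rewrite -vE /=; split=> [?|/in_asboolP]//; exact/in_asboolP.
have Uv j : U (v j) by apply/UE; apply: sub_lspan => //; exists j.
have [X [FX QX Xv]] : exists X, [/\ F X, Q X & forall j, X (v j)].
  suff /(_ n)[X [FX QX Xv]] k : exists X, [/\ F X, Q X & forall j : 'I_n, (j < k)%N -> X (v j)].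
    by exists X; split=> // j; exact: Xv.
  elim: k => [|k [X [FX QX Xv]]]; first by exists X0; split.
  have [kn|nk] := ltnP k n; last first.
    by exists X; split=> // j _; apply: Xv; exact: leq_trans (ltn_ord j) nk.
  have [Y FY Yv] := Uv (Ordinal kn).
  have [XY|YX] := tot _ _ FX FY.
    exists Y; split => //; first exact: FQ Yv.
    move=> j; rewrite ltnS leq_eqVlt => /orP[/eqP jk|/Xv/XY//].
    by rewrite (_ : j = Ordinal kn)//; exact: val_inj.
  exists X; split => // j; rewrite ltnS leq_eqVlt => /orP[/eqP jk|/Xv//].
  by rewrite (_ : j = Ordinal kn)//; [exact: YX|exact: val_inj].
suff -> : U = X by [].
apply/seteqP; split=> [x /UE|x Xx]; last by exists X.
have [idX _] := QP _ QX.
apply: (@lspan_sub R R^o) => [|_ [j _ <-]//].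
split; [by case: idX| |by move=> a x' _; exact: idealM].
by move=> x' y' Xx' Xy'; rewrite -[x']mul1r; apply: idX.2.
Qed.

Section LocalNoetherian.
Variable m : {pred R}.
Hypotheses (noeth : noetherian R) (loc : local_ring m).

Lemma sub_max_ideal I : ideal I -> ~ I 1 -> forall x, I x -> x \in m.
Proof.
move=> idI I1.
have [||J [idJ J1 IJ] Jmax] := @noetherian_max
    (fun J => [/\ ideal J, ~ J 1 & I `<=` J]) noeth.
- by move=> J [].
- by exists I; split=> // ?.
have Jm : maximal_ideal [pred x | `[< J x >]].
  split; first exact: proper_idealr_closed.
  move=> p idp Jp x xp; apply/in_asboolP.
  apply: (Jmax [set x | x \in p] _ _ x) => //=.
    split; first exact: idealr_closed_ideal.
      by case: idp => _ /negP.
    by move=> y /IJ Jy; apply: Jp; exact/in_asboolP.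
  by move=> y Jy; apply: Jp; exact/in_asboolP.
move=> x Ix; rewrite -(loc.2 _ Jm); apply/in_asboolP; exact: IJ.
Qed.

Lemma max_ideal_ideal : ideal [set x | x \in m].
Proof. by apply: idealr_closed_ideal; case: loc => -[]. Qed.

Lemma one_notin_max : 1 \notin m.
Proof. by case: loc => -[[]]. Qed.

Lemma notin_max_unit x : x \notin m -> exists y, x * y = 1.
Proof.
move=> xm; apply: contrapT => nox.
suff : x \in m by rewrite (negPf xm).
apply: (@sub_max_ideal [set z | exists y, x * y = z]) => //.
  split; first by exists 0; rewrite mulr0.
  by move=> a _ _ [u <-] [v <-]; exists (a * u + v); rewrite mulrDr mulrCA.
by exists 1; rewrite mulr1.
Qed.

Lemma max_ideal_unit1 x : x \in m -> exists y, (1 - x) * y = 1.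
Proof.
move=> xm; apply: notin_max_unit; apply/negP => x1.
case/negP: one_notin_max; rewrite -(subrK x 1) -[1 - x]mul1r.
by case: max_ideal_ideal => _; apply.
Qed.

Lemma max_ideal_prime : prime_ideal m.
Proof.
split; first by case: loc => -[].
move=> u v uvm; apply/negPn/negP; rewrite negb_or => /andP[/notin_max_unit[y uy]].
move=> /notin_max_unit[z vz]; case/negP: one_notin_max.
rewrite -[1](mulr1 1) -{1}uy -vz mulrACA mulrC.
exact: idealM max_ideal_ideal _.
Qed.

(** An ideal [J] maximal among those of infinite index is prime: if [u * v] is
    in [J] then [J] has finite index as soon as [J + (u)] and [(J : u)] do. It
    differs from [m], whose residue field is finite, so in dimension one it is
    a minimal prime. *)
Lemma finite_index_ideal I : krull_dim R 1 ->
  finite_index [set: R] [set x | x \in m] -> ideal I ->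
  (forall p, minimal_prime p -> ~ I `<=` [set x | x \in p]) ->
  finite_index [set: R] I.
Proof.
move=> [_ dim1] fm idI Imin; apply: contrapT => infI.
have fT J : ideal J -> J 1 -> finite_index [set: R] J.
  move=> idJ J1; rewrite (_ : J = setT); first by apply: (indexid _).1.
  by apply/seteqP; split=> // x _; rewrite -[x]mulr1; exact: idealM.
have [||J [idJ IJ infJ] Jmax] := @noetherian_max
    (fun J => [/\ ideal J, I `<=` J & ~ finite_index [set: R] J]) noeth.
- by move=> J [idJ _ infJ]; split=> // J1; apply: infJ; exact: fT.
- by exists I; split=> // ?.
have J1 : ~ J 1 by move=> J1; apply: infJ; exact: fT.
have gJ := ideal_subgroup idJ.
have Jprime u v : J (u * v) -> J u \/ J v.
  move=> Juv; apply: contrapT => /not_orP[Ju Jv]; apply: infJ.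
  pose J1' := [set x | exists a, J (x - a * u)]; pose J2 := [set x | J (x * u)].
  have idJ1 : ideal J1'.
    split=> [|a x y [s Js] [t Jt]]; first by exists 0; rewrite mul0r subr0; case: idJ.
    exists (a * s + t); rewrite mulrDl opprD addrACA -mulrA -mulrBr.
    by apply: idJ.2.
  have idJ2 : ideal J2.
    split=> [|a x y Jx Jy]; first by rewrite /J2 /= mul0r; case: idJ.
    by rewrite /J2 /= mulrDl -mulrA; apply: idJ.2.
  have f1 : finite_index setT J1'.
    apply: contrapT => inf1; apply: Ju; apply: (Jmax J1').
    - split=> // x Ix; exists 0; rewrite mul0r subr0; exact: IJ.
    - by move=> x Jx; exists 0; rewrite mul0r subr0.
    - by exists 1; rewrite mul1r subrr; case: idJ.
  have f2 : finite_index setT J2.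
    apply: contrapT => inf2; apply: Jv; apply: (Jmax J2).
    - by split=> // x Ix; rewrite /J2 /= mulrC; apply: idealM => //; exact: IJ.
    - by move=> x Jx; rewrite /J2 /= mulrC; apply: idealM.
    - by rewrite /J2 /= mulrC.
  have [r [_ rP _]] := finite_index_transversal (ideal_subgroup idJ1) f1.
  have [s [_ sP _]] := finite_index_transversal (ideal_subgroup idJ2) f2.
  apply: (finite_index_surj (r := fun k => r k.1 + s k.2 * u)) => // x _.
  have [i [a Ja]] := rP x Logic.I; have [j Js] := sP a Logic.I; exists (i, j) => /=.
  have -> : x - (r i + s j * u) = (x - r i - a * u) + (a - s j) * u by ring.
  exact: subgroupD.
pose p : {pred R} := [pred x | `[< J x >]].
have pP : prime_ideal p.
  split; first exact: proper_idealr_closed.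
  by move=> u v /in_asboolP/Jprime[?|?]; apply/orP; [left|right]; exact/in_asboolP.
have [pmin|npmin] := pselect (minimal_prime p).
  by apply: (Imin _ pmin) => x /IJ Jx; exact/in_asboolP.
have [q [qprime qp npq]] : exists q, [/\ prime_ideal q, {subset q <= p} & ~ {subset p <= q}].
  apply: contrapT => no; apply: npmin; split=> // q qprime qp; apply: contrapT => npq.
  by apply: no; exists q.
apply: dim1; exists (fun k => if k is k'.+1 then if k' is _.+1 then m else p else q).
split=> [[|[|k]]//|[|[|//]]] _; first exact: max_ideal_prime.
  split=> //; apply: contrapT => no; apply: npq => x xp.
  by apply: contrapT => xq; apply: no; exists x => //; exact/negP.
split=> [x /in_asboolP|]; first exact: sub_max_ideal.
apply: contrapT => no; apply: infJ.
suff -> : J = [set x | x \in m] by [].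
apply/seteqP; split=> x; first exact: sub_max_ideal.
move=> /= xm; apply: contrapT => Jx; apply: no; exists x => //.
exact/in_asboolP.
Qed.

End LocalNoetherian.
End Ideals.

(** * Complete one-dimensional domains are discrete valuation rings *)

Section DiscreteValuation.
Variables (L : fieldType) (O : set L) (c : L).
Hypotheses (sO : subring O) (Oc : O c) (Ocv : ~ O c^-1).

Definition principal (y : L) : set L := [set y * t | t in O].

(** Every [c]-adically convergent series has a sum. *)
Hypothesis complete : forall y : nat -> L, (forall n, O (y n)) ->
  exists2 x, O x & forall n, principal (c ^+ n) (x - \sum_(j < n) c ^+ j * y j).
Hypothesis finite_principal : forall y, O y -> y != 0 ->
  finite_index O (principal y).
Hypothesis closed_power : forall (w t : L) i j, (i < j)%N -> O t ->
  w ^+ j = w ^+ i - t -> O w.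

Definition nonunits : set L := [set x | O x /\ ~ (x != 0 /\ O x^-1)].

Let O1 : O 1. Proof. by case: sO. Qed.
Let gO : subgroup O. Proof. by case: sO. Qed.
Let O0 : O 0. Proof. exact: subgroup0. Qed.
Let OM x y : O x -> O y -> O (x * y). Proof. by case: sO => _ _; apply. Qed.
Let OD x y : O x -> O y -> O (x + y). Proof. exact: subgroupD. Qed.
Let OB x y : O x -> O y -> O (x - y). Proof. exact: subgroupB. Qed.
Let ON x : O x -> O (- x). Proof. exact: subgroupN. Qed.
Let OX x n : O x -> O (x ^+ n).
Proof. by move=> Ox; elim: n => [|n IH]; rewrite ?expr0// exprS; exact: OM. Qed.

Let c0 : c != 0.
Proof. by apply/eqP => c0; apply: Ocv; rewrite c0 invr0. Qed.

Let pg y : subgroup (principal y).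
Proof. exact: principal_subgroup. Qed.

Let pM y s t : principal y s -> O t -> principal y (t * s).
Proof. by move=> [u Ou <-] Ot; exists (t * u); [exact: OM|rewrite mulrCA]. Qed.

Let pX m n x : (m <= n)%N -> principal (c ^+ n) x -> principal (c ^+ m) x.
Proof.
move=> mn [t Ot <-]; exists (c ^+ (n - m) * t); first by apply: OM => //; exact: OX.
by rewrite mulrA -exprD subnKC.
Qed.

(** If [y] were nonzero, two powers of [c] would agree modulo [y], hence modulo
    a higher power of [c], and [c] would be invertible. *)
Lemma adic_separated y : (forall n, principal (c ^+ n) y) -> y = 0.
Proof.
move=> yP; apply: contrapT => /eqP y0.
have Oy : O y by have [t Ot <-] := yP 0%N; rewrite expr0 mul1r.
have [i [j [ij _ [t Ot]]]] :=
  finite_index_pigeonhole (pg y) (finite_principal Oy y0) (fun n => OX n Oc).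
have [z Oz yE] := yP i.+1 => tE.
have ci0 : c ^+ i != 0 by rewrite expf_neq0.
apply: Ocv; suff -> : c^-1 = c ^+ (j - i).-1 + z * t.
  by apply: OD; [exact: OX|exact: OM].
apply: (mulfI c0); rewrite divff//; apply: (mulfI ci0).
have -> : c ^+ i * (c * (c ^+ (j - i).-1 + z * t)) =
   c ^+ (i + (j - i).-1.+1) + (c ^+ i.+1 * z) * t.
  by rewrite exprD !exprS; ring.
rewrite yE tE prednK ?subn_gt0// subnKC ?(ltnW ij)//; ring.
Qed.

Lemma one_plus_unit z : O z -> 1 + c * z != 0 /\ O (1 + c * z)^-1.
Proof.
move=> Oz; have [n|x Ox xP] := complete (y := fun n => (- z) ^+ n).
  by apply: OX; exact: ON.
suff e : (1 + c * z) * x = 1.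
  have n0 : 1 + c * z != 0.
    by apply/eqP => z0; move/eqP: e; rewrite z0 mul0r eq_sym oner_eq0.
  by split=> //; rewrite -(mulKf n0 x) e mulr1 in Ox.
apply/eqP; rewrite -subr_eq0; apply/eqP/adic_separated => n.
have [t Ot tE] := xP n.
exists ((1 + c * z) * t - (- z) ^+ n).
  by apply: OB; [apply: OM => //; apply: OD => //; exact: OM|apply/OX/ON].
have geo : (1 + c * z) * (\sum_(j < n) c ^+ j * (- z) ^+ j) = 1 - (c * - z) ^+ n.
  under eq_bigr do rewrite -exprMn.
  rewrite -[RHS]opprB subrX1 -mulNr; congr (_ * _); ring.
have -> : x = c ^+ n * t + \sum_(j < n) c ^+ j * (- z) ^+ j by rewrite tE subrK.
rewrite [(1 + c * z) * (_ + _)]mulrDr geo exprMn; ring.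
Qed.

(** Newton's iteration for [e ^+ 2 = e] lifts an idempotent modulo [c] to a true
    one, and a domain has no idempotents besides [0] and [1]. *)
Lemma idempotent_mod e0 : O e0 -> principal c (e0 ^+ 2 - e0) ->
  principal c e0 \/ principal c (e0 - 1).
Proof.
move=> Oe0 e0P; pose e n := iter n (fun e => 3 * e ^+ 2 - 2 * e ^+ 3) e0.
have O2 : O 2 by rewrite -[2]/(1 + 1); exact: OD.
have O3 : O 3 by rewrite (_ : 3 = 2 + 1) ; [exact: OD|ring].
have Oe n : O (e n).
  by elim: n => //= n IH; apply: OB; apply: OM => //; exact: OX.
have eP n : principal (c ^+ n.+1) (e n ^+ 2 - e n).
  elim: n => [|n IH]; first by rewrite expr1.
  have -> : e n.+1 ^+ 2 - e n.+1 =
    (4 * (e n ^+ 2 - e n) - 3) * (e n ^+ 2 - e n) * (e n ^+ 2 - e n) by rewrite /=; ring.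
  have [t Ot tE] := IH.
  apply: (@pX _ (n.+1 + n.+1)); first by lia.
  exists ((4 * (e n ^+ 2 - e n) - 3) * t * t); last by rewrite -tE exprD; ring.
  apply: OM => //; apply: OM => //; apply: OB => //; apply: OM.
    by rewrite (_ : 4 = 2 + 2); [exact: OD|ring].
  by apply: OB => //; exact: OX.
pose y n := (e n.+1 - e n) / c ^+ n.
have eS n : exists2 t, O t & e n.+1 - e n = c ^+ n.+1 * t.
  have [t Ot tE] := eP n; exists ((1 - 2 * e n) * t).
    by apply: OM => //; apply: OB => //; exact: OM.
  rewrite mulrCA tE /=; ring.
have Oy n : O (y n).
  have [t Ot tE] := eS n; rewrite /y tE exprSr -mulrA mulrC mulKf ?expf_neq0//.
  exact: OM.
have [x Ox xP] := complete Oy.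
have sumy n : \sum_(j < n) c ^+ j * y j = e n - e0.
  elim: n => [|n IH]; first by rewrite big_ord0 subrr.
  rewrite big_ord_recr /= IH /y mulrC divfK ?expf_neq0// /=; ring.
have lim n : principal (c ^+ n) (e0 + x - e n).
  by have := xP n; rewrite sumy; congr principal; ring.
have idem : (e0 + x) ^+ 2 - (e0 + x) = 0.
  apply: adic_separated => n.
  have -> : (e0 + x) ^+ 2 - (e0 + x) =
    (e n ^+ 2 - e n) + (e0 + x + e n - 1) * (e0 + x - e n) by ring.
  apply: subgroupD => //; first by apply: (@pX _ n.+1).
  by apply: pM => //; apply: OB => //; apply: OD => //; exact: OD.
have e0x : principal c (e0 + x - e0).
  rewrite -(subrK (e 1%N) (e0 + x)) -addrA; apply: subgroupD => //.
    by have := lim 1%N; rewrite expr1.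
  by have [t Ot ->] := eS 0%N; exists t; rewrite // expr1.
have /eqP : (e0 + x) * (e0 + x - 1) = 0 by rewrite -idem; ring.
rewrite mulf_eq0 => /orP[/eqP e00|/eqP e01]; [left|right].
  by move: e0x; rewrite e00 sub0r => /(subgroupN (pg c)); rewrite opprK.
have := subgroupN (pg c) e0x; congr principal.
rewrite -[LHS]addr0 -e01; ring.
Qed.

(** Some power of [x] is idempotent in the finite ring [O / c]. With the two
    lemmas that follow, this makes [O] local. *)
Lemma unit_or_topologically_nilpotent x : O x ->
  (x != 0 /\ O x^-1) \/ exists2 n, (0 < n)%N & principal c (x ^+ n).
Proof.
move=> Ox.
have [i [j [ij _ xij]]] :=
  finite_index_pigeonhole (pg c) (finite_principal Oc c0) (fun n => OX n Ox).
pose b := (j - i)%N; have b0 : (0 < b)%N by rewrite subn_gt0.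
have jE : j = (i + b)%N by rewrite subnKC// ltnW.
have per k : principal c (x ^+ i - x ^+ (i + k * b)).
  elim: k => [|k IH]; first by rewrite mul0n addn0 subrr; exact: subgroup0.
  have -> : x ^+ i - x ^+ (i + k.+1 * b) =
     x ^+ i - x ^+ j + x ^+ b * (x ^+ i - x ^+ (i + k * b)).
    by rewrite jE mulSn addnCA !exprD; ring.
  by apply: subgroupD => //; apply: pM => //; exact: OX.
pose n := (i.+1 * b)%N; have n0 : (0 < n)%N by rewrite muln_gt0.
have xn : principal c ((x ^+ n) ^+ 2 - x ^+ n).
  have -> : (x ^+ n) ^+ 2 - x ^+ n = - x ^+ (n - i) * (x ^+ i - x ^+ (i + n)).
    have -> : x ^+ n = x ^+ (n - i) * x ^+ i.
      by rewrite -exprD subnK//; rewrite /n; nia.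
    rewrite exprD; have -> : x ^+ n = x ^+ (n - i) * x ^+ i.
      by rewrite -exprD subnK//; rewrite /n; nia.
    ring.
  by apply: pM; [exact: per|apply/ON/OX].
have [?|[z Oz zE]] := idempotent_mod (OX n Ox) xn; first by right; exists n.
left; have [u0 Ou] := one_plus_unit Oz.
have uE : 1 + c * z = x ^+ n by rewrite zE; ring.
rewrite uE in u0 Ou; have x0 : x != 0.
  by apply: contra_neq u0 => ->; rewrite expr0n eqn0Ngt n0.
split=> //; rewrite (_ : x^-1 = x ^+ n.-1 * (x ^+ n)^-1).
  by apply: OM => //; exact: OX.
by rewrite -[in RHS](prednK n0) exprSr invfM mulVKf ?expf_neq0.
Qed.

Lemma nonunitsM x y : nonunits x -> O y -> nonunits (x * y).
Proof.
move=> [Ox xP] Oy; split=> [|[xy0 Oxy]]; first exact: OM.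
apply: xP; move: xy0; rewrite mulf_eq0 negb_or => /andP[x0 y0]; split=> //.
rewrite (_ : x^-1 = y * (x * y)^-1); first exact: OM.
by rewrite invfM mulrCA divff// mulr1.
Qed.

Lemma nonunit_1B x : nonunits x -> 1 - x != 0 /\ O (1 - x)^-1.
Proof.
move=> [Ox xP]; have [//|[n n0 [z Oz zE]]] := unit_or_topologically_nilpotent Ox.
have [u0 Ou] := one_plus_unit (ON Oz).
have uE : 1 + c * - z = (1 - x) * \sum_(k < n) x ^+ k.
  by rewrite mulrN zE -opprB subrX1; ring.
have x0 : 1 - x != 0 by apply: contra_neq u0; rewrite uE => ->; rewrite mul0r.
split=> //; rewrite (_ : _^-1 = (1 + c * - z)^-1 * \sum_(k < n) x ^+ k).
  by apply: OM => //; apply: subgroup_sum => // k _; exact: OX.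
move: u0; rewrite uE mulf_eq0 negb_or => /andP[_ s0].
by rewrite invfM -mulrA mulVf// mulr1.
Qed.

(** The classical argument: choose [z] outside [c O] that all nonunits carry into
    [c O], and put [w = z / c]. If [w] preserved the nonunits, two of the
    elements [w ^+ n * c] would agree modulo [c], so [w] would be integral and
    [z] a multiple of [c]. Hence [w * p] is a unit for some nonunit [p], and
    this [p] generates the nonunits. *)
Lemma discrete_valuation : exists2 p, p != 0 &
  O p /\ forall x, nonunits x <-> principal p x.
Proof.
have nc : nonunits c by split=> // -[].
pose I z : set L := [set z * t.1 + c * t.2 | t in [set t | O t.1 /\ O t.2]].
have gI z : subgroup (I z).
  split; first by exists (0, 0); rewrite //= !mulr0 addr0.
  move=> _ _ [[s s'] /= [Os Os'] <-] [[t t'] /= [Ot Ot'] <-].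
  exists (s - t, s' - t'); first by split; exact: OB.
  by rewrite /=; ring.
have cI z : principal c `<=` I z.
  by move=> _ [t Ot <-]; exists (0, t); rewrite //= mulr0 add0r.
have IO z : O z -> I z `<=` O.
  by move=> Oz _ [t [Ot Ot'] <-]; apply: OD; exact: OM.
have fc := finite_principal Oc c0.
have fI z : finite_index O (I z) by exact: finite_index_subr fc.
(* [z] spans a minimal nonzero ideal of the finite ring [O / c], so all
   nonunits kill it there. *)
have [z [Oz zc zmax]] : exists z, [/\ O z, ~ principal c z & forall z', O z' ->
    ~ principal c z' -> (index O (I z') <= index O (I z))%N].
  pose Q n := `[< exists z, [/\ O z, ~ principal c z & index O (I z) = n] >].
  have [||n /asboolP[z [Oz zc <-]] zmax] := @ex_maxnP Q (index O (principal c)).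
  - exists (index O (I 1)); apply/asboolP; exists 1; split=> // -[t Ot ct].
    by apply: Ocv; rewrite -[c^-1]mulr1 -ct mulKf.
  - move=> n /asboolP[z [Oz _ <-]].
    rewrite (index_mulr gO (gI z) (pg c) (IO _ Oz) (cI z) fc).
    rewrite leq_pmulr//; apply: index_gt0 => //; first exact: subgroup0.
    exact: finite_index_subl (IO _ Oz) fc.
  exists z; split=> // z' Oz' zc'; apply: zmax; apply/asboolP; by exists z'.
have zn a : nonunits a -> principal c (z * a).
  move=> na; have Oa := na.1; apply: contrapT => nza.
  have := zmax _ (OM Oz Oa) nza; apply/negP; rewrite -ltnNge.
  have Iza : I (z * a) `<=` I z.
    move=> _ [t [Ot Ot'] <-]; exists (a * t.1, t.2) => /=; last by ring.
    by split=> //; exact: OM.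
  apply: (index_ltr gO (gI z) (gI _)) => //; first exact: IO.
  move=> /(_ z) []; first by exists (1, 0); rewrite //= mulr1 mulr0 addr0.
  move=> [t t'] /= [Ot Ot'] zE; apply: zc.
  have [a0 Oa1] := nonunit_1B (nonunitsM na Ot).
  exists (t' * (1 - a * t)^-1); first exact: OM.
  have ct : c * t' = z * (1 - a * t) by rewrite mulrBr mulr1 -[X in X - _]zE; ring.
  by rewrite mulrA ct mulfK.
pose w := z / c.
have zE : z = c * w by rewrite mulrC divfK.
have wn a : nonunits a -> O (w * a).
  move=> /zn[t Ot tE]; rewrite (_ : w * a = t)//; apply: (mulfI c0).
  by rewrite tE mulrA -zE.
have z0 : z != 0 by apply/eqP => z0; apply: zc; rewrite z0; exact: subgroup0.
have [[a [na nwa]]|stable] := pselect (exists a, nonunits a /\ ~ nonunits (w * a)).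
  have [wa0 Owa] : w * a != 0 /\ O (w * a)^-1.
    by apply: contrapT => h; apply: nwa; split=> //; exact: wn.
  exists a; first by apply: contra_neq wa0 => ->; rewrite mulr0.
  split=> [|x]; first by case: na.
  split=> [nx|[t Ot <-]]; last exact: nonunitsM.
  exists (w * x / (w * a)); first by apply: OM => //; exact: wn.
  move: wa0; rewrite mulf_eq0 negb_or => /andP[w0 a0].
  by rewrite invfM mulrACA divff// mul1r mulrCA divff// mulr1.
have wcn n : nonunits (w ^+ n * c).
  elim: n => [|n IH]; first by rewrite mul1r.
  rewrite exprS -mulrA; apply: contrapT => nwa; apply: stable.
  by exists (w ^+ n * c).
have [i [j [ij _ [t Ot tE]]]] := finite_index_pigeonhole (pg c) fc (fun n => (wcn n).1).
exfalso; apply: zc; exists w => //.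
apply: (closed_power ij Ot); apply: (mulfI c0).
by rewrite mulrBr tE; ring.
Qed.

End DiscreteValuation.

(** * Branches of an arithmetic local order *)

Section TotalRing.
Variables (b : nat) (K : 'I_b -> fieldType).
Implicit Types x y : total_ring K.

Lemma total_eqP x y : (forall i, x i = y i) -> x = y.
Proof. by move=> e; apply: functional_extensionality_dep. Qed.

Lemma total_sumE (I : Type) (r : seq I) (Q : pred I) (F : I -> total_ring K) i :
  (\sum_(k <- r | Q k) F k) i = \sum_(k <- r | Q k) F k i.
Proof. by elim/big_rec2: _ => // k u v _ <-. Qed.

End TotalRing.

Section Branches.
Variables (R : comNzRingType) (b : nat) (K : 'I_b -> fieldType).
Variable iota : forall i, {rmorphism R -> K i}.
Local Notation A := (total_ring K).
Local Notation R0 := (base_ring iota).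
Local Notation Rt := (normalization iota).

Definition embed (x : R) : A := fun i => iota i x.

Lemma base_embed x : R0 (embed x). Proof. by exists x. Qed.

Lemma embedB x y : embed (x - y) = embed x - embed y.
Proof. by apply: total_eqP => i; exact: rmorphB. Qed.
Lemma embedM x y : embed (x * y) = embed x * embed y.
Proof. by apply: total_eqP => i; exact: rmorphM. Qed.
Lemma embed1 : embed 1 = 1.
Proof. by apply: total_eqP => i; exact: rmorph1. Qed.
Lemma embed0 : embed 0 = 0.
Proof. by apply: total_eqP => i; exact: rmorph0. Qed.
Lemma base_subring : subring R0.
Proof.
split; first by rewrite -embed1; exact: base_embed.
- split; first by rewrite -embed0; exact: base_embed.
  by move=> _ _ [x _ <-] [y _ <-]; rewrite -embedB; exact: base_embed.
- by move=> _ _ [x _ <-] [y _ <-]; rewrite -embedM; exact: base_embed.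
Qed.

Lemma branch_subring i : subring (branch iota i).
Proof.
split; [exact: integral1|split; [exact: mxpoly.integral0|exact: integral_sub]|].
exact: integral_mul.
Qed.

Lemma norm_subring : subring Rt.
Proof.
split; first by move=> i; case: (branch_subring i).
- split; first by move=> i; have [_ [g0 _] _] := branch_subring i; exact: g0.
  move=> x y Rx Ry i; have [_ gi _] := branch_subring i.
  exact: (subgroupB gi (Rx i) (Ry i)).
- by move=> x y Rx Ry i; have [_ _] := branch_subring i; apply.
Qed.

Lemma branch_base i x : branch iota i (iota i x).
Proof. exact: integral_id. Qed.

Lemma base_norm : R0 `<=` Rt.
Proof. by move=> _ [x _ <-] i; exact: branch_base. Qed.

(** Integral closedness, for the equation of [w] that the pigeonhole principle
    produces. *)
Lemma branch_closed i (w t : K i) k j : (k < j)%N -> branch iota i t ->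
  w ^+ j = w ^+ k - t -> branch iota i w.
Proof.
move=> kj Ot wE.
pose q : {poly K i} := 'X^j - 'X^k + t%:P.
have szq : (size ('X^k - t%:P : {poly K i})%R < size ('X^j : {poly K i})%R)%N.
  rewrite size_polyXn ltnS; apply: (leq_trans (size_polyD _ _)).
  rewrite geq_max size_polyXn kj size_polyN; apply: leq_trans (size_polyC_leq1 _) _.
  exact: leq_ltn_trans kj.
have qE : q = 'X^j - ('X^k - t%:P) by rewrite /q opprB addrA addrAC.
apply: (@integral_root_monic _ _ _ w q).
- rewrite monicE qE lead_coefDl ?size_polyN//.
  by rewrite lead_coefXn.
- by apply/rootP; rewrite /q !hornerE wE; ring.
apply/integral_poly => l; rewrite /q !coefD !coefN !coefXn coefC.
apply: integral_add; last by case: ifP => _ //; exact: mxpoly.integral0.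
by apply: integral_sub; exact: integral_nat.
Qed.

(** Clearing denominators in an integral equation of the inverse of [x] exhibits
    an inverse of [x] modulo the kernel. *)
Lemma branch_inv_base i x : branch iota i (iota i x)^-1 -> iota i x != 0 ->
  exists y, iota i (x * y - 1) = 0.
Proof.
move=> [p pm /rootP pr] x0.
pose n := (size p).-1.
have szp : size p = n.+1.
  by rewrite prednK// lt0n size_poly_eq0 monic_neq0.
have := congr1 ( *%R (iota i x ^+ n)) pr.
have szm : size (map_poly (iota i) p) = n.+1.
  by rewrite size_map_poly_id0 ?szp// (monicP pm) rmorph1 oner_neq0.
rewrite horner_coef szm mulr0 mulr_sumr big_ord_recr /=.
rewrite coef_map /= -[p`_n]/(p`_(size p).-1) -lead_coefE (monicP pm) rmorph1 mul1r.
rewrite -exprMn divff// expr1n => e.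
exists (- \sum_(k < n) p`_k * x ^+ (n - k).-1).
rewrite rmorphB rmorph1 rmorphM rmorphN rmorph_sum mulrN mulr_sumr.
apply/eqP; rewrite -opprD oppr_eq0 -[X in _ == X]e; apply/eqP; congr (_ + _).
apply: eq_bigr => k _; rewrite coef_map rmorphM rmorphXn /= mulrCA [RHS]mulrCA.
congr (_ * _); rewrite -exprS prednK ?subn_gt0// exprVn.
exact: expfB.
Qed.

Definition regular c := forall i, iota i c != 0.

Lemma regular_unit c : regular c -> exists2 u : A, u * embed c = 1 & embed c * u = 1.
Proof.
move=> cP; exists (fun i => (iota i c)^-1); apply: total_eqP => i.
  exact: (mulVf (cP i)).
exact: (mulfV (cP i)).
Qed.

Lemma regularM c c' : regular c -> regular c' -> regular (c * c').
Proof. by move=> cP cP' i; rewrite rmorphM mulf_neq0 ?cP ?cP'. Qed.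

Hypothesis alo : arithmetic_local_order iota.

(** Elements of [R] supported on a single branch: distinct minimal primes are
    incomparable. *)
Lemma branch_separation : exists a : 'I_b -> R,
  forall i j, (iota j (a i) == 0) = (j != i).
Proof.
suff /choice[a aP] : forall i, exists a, forall j, (iota j a == 0) = (j != i).
  by exists a.
move=> i.
have /choice[x xP] j : exists x, j != i -> iota j x = 0 /\ iota i x != 0.
  have [->|ji] := eqVneq j i; first by exists 0.
  apply: contrapT => no; move/eqP: ji; apply; apply: (alo_minimal_inj alo) => x.
  have sub : {subset [pred x | iota j x == 0] <= [pred x | iota i x == 0]}.
    move=> y; rewrite !inE => jy; apply: contrapT => /negP iy.
    by apply: no; exists y => _; split=> //; exact/eqP.
  have [_ /(_ _ (alo_minimal alo j).1 sub) sub'] := alo_minimal alo i.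
  by apply/idP/idP => [/(sub x)|/(sub' x)].
exists (\prod_(j | j != i) x j) => j; rewrite rmorph_prod.
apply/idP/idP => [|ji]; last by rewrite (bigD1 j)//= (xP _ ji).1 mul0r.
apply: contraTN => /eqP ->; apply/prodf_neq0 => k ki; exact: (xP _ ki).2.
Qed.

(** On each branch take a denominator of the corresponding component; the
    elements of [branch_separation] glue them into one regular element. *)
Lemma common_denominator n (v : 'I_n -> A) :
  exists2 c, regular c & forall k, R0 (embed c * v k).
Proof.
have [a aP] := branch_separation.
have one (x : A) : exists2 c, regular c & R0 (embed c * x).
  have /choice[z zP] i : exists z, iota i z.2 != 0 /\ x i = iota i z.1 / iota i z.2.
    by have [s [t ?]] := alo_fraction alo (x i); exists (s, t).
  have sumE (f : 'I_b -> R) i :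
      iota i (\sum_j a j * f j) = iota i (a i) * iota i (f i).
    rewrite rmorph_sum (bigD1 i)//= big1 ?addr0 ?rmorphM// => j ji.
    rewrite rmorphM; have /eqP -> : iota i (a j) == 0 by rewrite aP eq_sym.
    by rewrite mul0r.
  exists (\sum_j a j * (z j).2) => [i|].
    by rewrite sumE mulf_neq0 ?(zP i).1// aP eqxx.
  exists (\sum_j a j * (z j).1) => //; apply: total_eqP => i /=.
  rewrite -[RHS]/(iota i _ * x i) !sumE (zP i).2 -mulrA.
  by rewrite [iota i (z i).2 * _]mulrC divfK ?(zP i).1.
elim: n v => [|n IH] v; first by exists 1 => [i|[]//]; rewrite rmorph1 oner_neq0.
have [c cP cv] := IH (fun k => v (lift ord0 k)).
have [c' cP' cv'] := one (v ord0).
have [_ _ bM] := base_subring.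
exists (c * c') => [|k]; first exact: regularM.
have [k' ->|->] := unliftP ord0 k.
  by rewrite [c * c']mulrC embedM -mulrA; apply: bM => //; exact: base_embed.
by rewrite embedM -mulrA; apply: bM => //; exact: base_embed.
Qed.

(** The conductor of [Rt] in [R0] contains a regular element. *)
Lemma conductor : exists2 c, regular c & forall x, Rt x -> R0 (embed c * x).
Proof.
have [n [v vE]] := alo_normalization alo.
have [c cP cv] := common_denominator v; exists c => // x Rx.
have [_ gR RM] := base_subring.
have : lspan R0 (range (v : 'I_n -> A^o)) x by rewrite -vE.
move/lspan_rangeP => /(_ gR)[a Ra ->].
rewrite mulr_sumr; apply: subgroup_sum => // k _.
by rewrite -[a k *: v k]/(a k * v k) mulrCA; apply: RM.
Qed.

Lemma kernel_ideal i : ideal [set x | iota i x = 0].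
Proof.
split=> [|a u v /= u0 v0]; first exact: rmorph0.
by rewrite /= rmorphD rmorphM u0 v0 mulr0 addr0.
Qed.

Section MaximalIdeal.
Variable m : {pred R}.
Hypotheses (loc : local_ring m) (compl : adically_complete m)
  (fm : finite_index [set: R] [set x | x \in m]).
Let noeth := alo_noetherian alo.

Lemma kernel_sub_max i x : iota i x = 0 -> x \in m.
Proof.
apply: (sub_max_ideal noeth loc (kernel_ideal i)) => /= /eqP.
by rewrite rmorph1 oner_eq0.
Qed.

(** In dimension one the maximal ideal is not a minimal prime, so it has an
    element that is nonzero on any given branch. *)
Lemma regular_in_max : exists2 c, regular c & c \in m.
Proof.
have [a aP] := branch_separation.
have /choice[y yP] i : exists y, y \in m /\ iota i y != 0.
  apply: contrapT => no.
  have mi x : x \in m -> iota i x = 0.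
    by move=> xm; apply: contrapT => /eqP ix; apply: no; exists x.
  have [[p [pprime pS]] _] := alo_krull_dim alo.
  have pm k x : (k <= 1)%N -> x \in p k -> x \in m.
    move=> k1; have [[idp p1 pP] _] := pprime _ k1.
    apply: (@sub_max_ideal _ _ noeth loc [set x | x \in p k]).
      exact: idealr_closed_ideal.
    exact/negP.
  have [_ imin] := alo_minimal alo i.
  have sub0 : {subset p 0%N <= [pred x | iota i x == 0]}.
    by move=> x /pm-/(_ isT)/mi/eqP.
  have sub1 := imin _ (pprime 0%N isT) sub0.
  have [_ [x xp1 xp0]] := pS 0%N isT; case/negP: xp0.
  by apply: sub1; rewrite inE; apply/eqP/mi/(pm 1%N).
have gm := max_ideal_ideal loc.
exists (\sum_i a i * y i) => [i|].
  rewrite rmorph_sum (bigD1 i)//= big1 ?addr0 => [|j ji].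
    by rewrite rmorphM mulf_neq0 ?(yP i).2// aP eqxx.
  rewrite rmorphM; have /eqP -> : iota i (a j) == 0 by rewrite aP eq_sym.
  by rewrite mul0r.
apply: (subgroup_sum (N := [set x | x \in m])); first exact: ideal_subgroup.
by move=> i _; apply: (idealM _ gm); case: (yP i).
Qed.

Lemma finite_index_regular c : regular c ->
  finite_index [set: R] [set c * t | t in setT].
Proof.
move=> cP; apply: (finite_index_ideal noeth loc (alo_krull_dim alo) fm).
  split=> [|a _ _ [s _ <-] [t _ <-]]; first by exists 0; rewrite ?mulr0.
  by exists (a * s + t) => //; rewrite mulrDr mulrCA.
move=> p /(alo_minimal_surj alo)[i pi] cp; have := cP i.
by rewrite -pi => /negP; apply; apply: cp; exists 1; rewrite ?mulr1.
Qed.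

(** A power of the maximal ideal lies in [c R]: two partial products of a long
    product agree modulo [c], and their quotient is [1] minus a nonunit. *)
Lemma max_power_sub c : regular c -> exists2 k, (0 < k)%N &
  forall y : 'I_k -> R, (forall j, y j \in m) -> exists t, \prod_j y j = c * t.
Proof.
move=> cP; have fc := finite_index_regular cP.
have gc : subgroup [set c * t | t in [set: R]] by exact: principal_subgroup.
exists (index setT [set c * t | t in [set: R]]).
  exact: index_gt0.
set k := Defs.index _ _ => y ym.
pose z n := if insub n is Some j then y j else 1.
have [i [j [ij jk [t _ tE]]]] :=
  finite_index_pigeonhole (u := fun n => \prod_(0 <= l < n) z l) gc fc
    (fun=> Logic.I).
have zE (l : 'I_k) : z l = y l by rewrite /z valK.
have -> : \prod_l y l = \prod_(0 <= l < k) z l.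
  by rewrite big_mkord; apply: eq_bigr => l _; rewrite zE.
have ijm : \prod_(i <= l < j) z l \in m.
  rewrite big_ltn//; have ik : (i < k)%N by exact: leq_trans ij jk.
  rewrite mulrC; apply: (idealM _ (max_ideal_ideal loc)).
  by rewrite /= (zE (Ordinal ik)).
have [u uE] := max_ideal_unit1 noeth loc ijm.
rewrite (@big_cat_nat _ _ _ i)//=; last by apply: leq_trans jk; exact: ltnW.
exists (t * u * \prod_(i <= l < k) z l).
have -> : \prod_(0 <= l < i) z l = c * (t * u).
  rewrite mulrA tE (@big_cat_nat _ _ _ i 0%N j)//=; last exact: ltnW.
  by rewrite -{2}[\prod_(0 <= l < i) z l]mulr1 -mulrBr -mulrA uE mulr1.
by rewrite !mulrA.
Qed.

(** Completeness for the powers of the maximal ideal passes to the powers of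
    [c]: each of the latter contains one of the former. *)
Lemma adic_series_base c : regular c -> c \in m -> forall d : nat -> R,
  exists x, forall n, exists t, x - \sum_(j < n) c ^+ j * d j = c ^+ n * t.
Proof.
move=> cP cm d; pose a n := \sum_(j < n) c ^+ j * d j.
have [n|x [xP _]] := @compl a.
  exists 1%N, (fun=> d n), (fun=> c ^+ n); split=> // [_|].
    by exists (fun=> c) => //; rewrite prodr_const card_ord.
  by rewrite big_ord1 /a big_ord_recr /= addrAC subrr add0r mulrC.
exists x => n; have [k k0 kP] := max_power_sub cP.
have pow l (y : 'I_(l * k) -> R) : (forall j, y j \in m) ->
    exists t, \prod_j y j = c ^+ l * t.
  elim: l y => [|l IH] y ym; first by exists 1; rewrite mulr1 big_ord0.
  rewrite /= in y ym *; have /kP[s sE] j : y (lshift (l * k) j) \in m by [].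
  have /IH[t tE] j : y (rshift k j) \in m by [].
  by exists (s * t); rewrite big_split_ord /= sE tE exprS mulrACA.
have [s sE] : exists s, x - a (n * k)%N = c ^+ n * s.
  have [p [e [w [_ wP ->]]]] := xP (n * k)%N.
  apply: (subgroup_sum (N := [set y | exists s, y = c ^+ n * s])) => [|j _].
    split=> [|_ _ [s ->] [t ->]]; first by exists 0; rewrite mulr0.
    by exists (s - t); rewrite mulrBr.
  have [y ym ->] := wP j; have [t ->] := pow _ _ ym; exists (e j * t).
  by rewrite -[LHS]/(e j * _) mulrCA.
have [t tE] : exists t, a (n * k)%N - a n = c ^+ n * t.
  have : (n <= n * k)%N by rewrite leq_pmulr.
  move/subnKC <-; rewrite /a big_split_ord /= addrAC subrr add0r.
  exists (\sum_(j < n * k - n) c ^+ j * d (n + j)%N).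
  by rewrite mulr_sumr; apply: eq_bigr => j _; rewrite exprD mulrA.
exists (s + t); rewrite mulrDr -sE -tE -[\sum_(j < n) _]/(a n); ring.
Qed.

End MaximalIdeal.

Lemma finite_index_base_regular c : regular c ->
  finite_index R0 [set embed c * t | t in R0].
Proof.
move=> cP; have [m [loc compl fm]] := alo_local alo.
have gc : subgroup [set c * t | t in [set: R]] by exact: principal_subgroup.
have [r [_ rP _]] := finite_index_transversal gc (finite_index_regular loc fm cP).
apply: (finite_index_surj (r := embed \o r)).
  by have [_ gR _] := base_subring; exact: principal_subgroup.
move=> _ [x _ <-].
have [k [t _ tE]] := rP x Logic.I; exists k => /=.
exists (embed t); first exact: base_embed.
by rewrite -embedM tE embedB.
Qed.

Lemma finite_index_norm_regular c : regular c ->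
  finite_index Rt [set embed c * t | t in Rt].
Proof.
move=> cP; have [n [v vE]] := alo_normalization alo.
have [_ gR _] := base_subring; have [_ gt tM] := norm_subring.
rewrite [X in finite_index X]vE.
apply: (@finite_index_span A A^o R0 [set embed c * t | t in R0] n v) => //.
- exact: principal_subgroup.
- exact: finite_index_base_regular.
- exact: principal_subgroup.
move=> _ j [a Ra <-]; exists (a * v j); last by rewrite mulrA.
apply: tM; first exact: base_norm.
have : lspan R0 (range v) (v j) by apply: sub_lspan; [case: base_subring|exists j].
by rewrite -vE.
Qed.

Definition on_branch i (y : K i) : A :=
  fun j => if eqVneq i j is EqNotNeq e then ecast k (K k) e y else 0.

Lemma on_branchE i (y : K i) : on_branch y i = y.
Proof.
rewrite /on_branch; case: eqVneq => [e|/eqP//].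
by rewrite eq_axiomK.
Qed.

Lemma on_branch_neq i j (y : K i) : j != i -> on_branch y j = 0.
Proof.
move=> ji; rewrite /on_branch; case: eqVneq => // e.
by case/eqP: ji.
Qed.

Lemma norm_on_branch i (y : K i) : branch iota i y -> Rt (on_branch y).
Proof.
move=> Oy j; have [<-|ij] := eqVneq i j; first by rewrite on_branchE.
rewrite on_branch_neq 1?eq_sym//; have [_ [g0 _] _] := branch_subring j.
exact: g0.
Qed.

(** Every nonzero element of a branch divides the image there of a regular
    element of [R]. *)
Lemma finite_index_branch i y : branch iota i y -> y != 0 ->
  finite_index (branch iota i) (principal (branch iota i) y).
Proof.
move=> Oy y0; have [a aP] := branch_separation.
have [x [z [z0 yE]]] := alo_fraction alo y.
have xE : iota i x = y * iota i z by rewrite yE divfK.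
pose c := \sum_j a j * (if j == i then x else 1).
have cE j : iota j c = iota j (a j) * iota j (if j == i then x else 1).
  rewrite rmorph_sum (bigD1 j)//= big1 ?addr0 ?rmorphM// => k kj.
  rewrite rmorphM; have /eqP -> : iota j (a k) == 0 by rewrite aP eq_sym.
  by rewrite mul0r.
have cP : regular c.
  move=> j; rewrite cE mulf_neq0 ?aP ?eqxx//.
  by case: (eqVneq j i) => [->|_]; rewrite ?rmorph1 ?oner_neq0// xE mulf_neq0.
have gt : subgroup [set embed c * t | t in Rt].
  by have [_ gt _] := norm_subring; exact: principal_subgroup.
have [r [_ rP _]] := finite_index_transversal gt (finite_index_norm_regular cP).
apply: (finite_index_surj (r := fun k => r k i)).
  by have [_ gO _] := branch_subring i; exact: principal_subgroup.
move=> s Os.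
have [k [t Rt' tE]] := rP _ (norm_on_branch Os); exists k.
have := congr1 (fun u : A => u i) tE.
rewrite -[RHS]/(on_branch s i - r k i) on_branchE => <-.
exists (iota i (a i * z) * t i).
  have [_ _ OM] := branch_subring i; apply: OM => //; exact: branch_base.
rewrite -[RHS]/(iota i c * t i) cE eqxx xE rmorphM; ring.
Qed.

(** A branch is a finitely generated module over the complete ring [R], so its
    series are summed coefficientwise. *)
Lemma branch_complete i c : regular c -> (exists2 m : {pred R}, c \in m &
    [/\ local_ring m, adically_complete m & finite_index [set: R] [set x | x \in m]]) ->
  forall y : nat -> K i, (forall n, branch iota i (y n)) ->
  exists2 x, branch iota i x &
  forall n, principal (branch iota i) (iota i c ^+ n)
    (x - \sum_(j < n) iota i c ^+ j * y j).
Proof.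
move=> cP [m cm [loc compl fm]] y Oy.
have [p [v vE]] := alo_normalization alo.
have [_ gR _] := base_subring; have [_ gO OM] := branch_subring i.
have /choice[d dE] n : exists d : 'I_p -> R, y n = \sum_k iota i (d k) * v k i.
  have : lspan R0 (range (v : 'I_p -> A^o)) (on_branch (y n)).
    by rewrite -vE; exact: norm_on_branch.
  move/lspan_rangeP => /(_ gR)[e Re yE].
  have /choice[d dE] k : exists d, embed d = e k by have [d _ <-] := Re k; exists d.
  exists d; have := congr1 (fun u : A => u i) yE.
  rewrite on_branchE total_sumE => ->; apply: eq_bigr => k _.
  by rewrite -dE.
have Ov k : branch iota i (v k i).
  have : lspan R0 (range v) (v k) by apply: sub_lspan; [case: base_subring|exists k].
  by rewrite -vE => /(_ i).
have /choice[x xP] k : exists x, forall n, exists t,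
    x - \sum_(j < n) c ^+ j * d j k = c ^+ n * t.
  exact: (adic_series_base loc compl fm cP cm (fun j => d j k)).
exists (\sum_k iota i (x k) * v k i) => [|n].
  by apply: subgroup_sum => // k _; apply: OM => //; exact: branch_base.
have /choice[t tE] k := xP k n.
exists (\sum_k iota i (t k) * v k i).
  by apply: subgroup_sum => // k _; apply: OM => //; exact: branch_base.
have -> : \sum_(j < n) iota i c ^+ j * y j =
    \sum_k \sum_(j < n) iota i c ^+ j * (iota i (d j k) * v k i).
  by rewrite exchange_big /=; apply: eq_bigr => j _; rewrite dE mulr_sumr.
rewrite -sumrB mulr_sumr; apply: eq_bigr => k _.
rewrite mulrA -rmorphXn -rmorphM -tE rmorphB rmorph_sum mulrBl; congr (_ - _).
rewrite mulr_suml; apply: eq_bigr => j _.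
by rewrite rmorphM rmorphXn mulrA.
Qed.

(** What the later sections retain of completeness: a regular element [c] of the
    maximal ideal, and uniformizers of the branches. *)
Lemma regular_topologically_nilpotent : exists2 c, regular c &
  (forall n, (0 < n)%N -> exists y, (1 - c ^+ n) * y = 1) /\
  forall i, exists2 p, p != 0 & branch iota i p /\
    forall x, branch_max iota i x <-> principal (branch iota i) p x.
Proof.
have [m [loc compl fm]] := alo_local alo.
have [c cP cm] := regular_in_max loc; exists c => //; split=> [n n0|i].
  apply: (max_ideal_unit1 (alo_noetherian alo) loc).
  by rewrite -(prednK n0) exprSr; exact: (idealM _ (max_ideal_ideal loc)).
apply: (@discrete_valuation _ (branch iota i) (iota i c)).
- exact: branch_subring.
- exact: branch_base.
- move=> /branch_inv_base/(_ (cP i))[y yE].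
  case/negP: (one_notin_max loc).
  rewrite -(subKr (c * y) 1).
  apply: (subgroupB (ideal_subgroup (max_ideal_ideal loc))).
    by rewrite mulrC; exact: (idealM _ (max_ideal_ideal loc)).
  exact: (kernel_sub_max loc yE).
- by apply: branch_complete => //; exists m.
- exact: finite_index_branch.
- exact: branch_closed.
Qed.

End Branches.

(** * Lattices over a product of discrete valuation rings *)

Section LinearAutomorphisms.
Variables (A : comPzRingType) (V : lmodType A).
Implicit Types (g h : V -> V) (N : set V).

Definition automorphism g g' :=
  [/\ forall a x y, g (a *: x + y) = a *: g x + g y, cancel g g' & cancel g' g].

Lemma autD g g' x y : automorphism g g' -> g (x + y) = g x + g y.
Proof. by move=> [gl _ _]; rewrite -[x in LHS]scale1r gl scale1r. Qed.

Lemma aut0 g g' : automorphism g g' -> g 0 = 0.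
Proof. by move=> /autD gD; apply: (addIr (g 0)); rewrite -gD !add0r. Qed.

Lemma autZ g g' a x : automorphism g g' -> g (a *: x) = a *: g x.
Proof.
by move=> ga; have [gl _ _] := ga; rewrite -[a *: x]addr0 gl (aut0 ga) addr0.
Qed.

Lemma autB g g' x y : automorphism g g' -> g (x - y) = g x - g y.
Proof.
by move=> ga; rewrite -!scaleN1r (autD _ _ ga) (autZ _ _ ga).
Qed.

Lemma aut_sum g g' (I : Type) (r : seq I) (Q : pred I) (F : I -> V) :
  automorphism g g' -> g (\sum_(i <- r | Q i) F i) = \sum_(i <- r | Q i) g (F i).
Proof.
by move=> ga; apply: (big_morph g (fun x y => autD x y ga) (aut0 ga)).
Qed.

Lemma aut_sym g g' : automorphism g g' -> automorphism g' g.
Proof.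
move=> ga; have [gl gK gK'] := ga; split=> // a x y.
by apply: (can_inj gK); rewrite gl !gK'.
Qed.

Lemma aut_id : automorphism id id. Proof. by split. Qed.

Lemma aut_comp g g' h h' : automorphism g g' -> automorphism h h' ->
  automorphism (g \o h) (h' \o g').
Proof.
move=> [gl gK gK'] [hl hK hK']; split=> [a x y /=|x /=|x /=].
- by rewrite hl gl.
- by rewrite gK hK.
- by rewrite hK' gK'.
Qed.

Lemma aut_scale (u u' : A) : u' * u = 1 -> automorphism ( *:%R u) ( *:%R u').
Proof.
move=> u'u; split=> [a x y|x|x].
- by rewrite scalerDr !scalerA mulrC.
- by rewrite scalerA u'u scale1r.
- by rewrite scalerA mulrC u'u scale1r.
Qed.

Lemma aut_inj g g' : automorphism g g' -> injective g.
Proof. by move=> [_ gK _]; exact: can_inj gK. Qed.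

Lemma aut_imageK g g' N : automorphism g g' -> g' @` (g @` N) = N.
Proof.
move=> [_ gK _]; rewrite image_comp.
apply/seteqP; split=> [_ [x Nx <-] /=|x Nx]; first by rewrite gK.
by exists x => //=; rewrite gK.
Qed.

Lemma aut_submodule g g' (S : set A) N : automorphism g g' ->
  submodule S N -> submodule S (g @` N).
Proof.
move=> ga [N0 ND NZ]; split.
- by exists 0 => //; exact: aut0 ga.
- move=> _ _ [x Nx <-] [y Ny <-]; exists (x + y); first exact: ND.
  exact: autD ga.
- move=> a _ Sa [x Nx <-]; exists (a *: x); first exact: NZ.
  exact: autZ ga.
Qed.

Lemma aut_index g g' M N : automorphism g g' -> subgroup N -> finite_index M N ->
  finite_index (g @` M) (g @` N) /\ index (g @` M) (g @` N) = index M N.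
Proof.
move=> ga; apply: index_image; last exact: aut_inj ga.
by move=> x y; exact: autB ga.
Qed.

Lemma aut_lspan g g' S N : automorphism g g' ->
  lspan S (g @` N) = g @` lspan S N.
Proof.
move=> ga; apply/seteqP; split.
  move=> x [n [a [v [Sa Nv ->]]]].
  exists (\sum_j a j *: g' (v j)).
    exists n, a, (g' \o v); split=> // j.
    by have [_ gK _] := ga; have [y Ny yE] := Nv j; rewrite /= -yE gK.
  rewrite (aut_sum _ _ _ ga); apply: eq_bigr => j _; rewrite (autZ _ _ ga).
  by have [_ _ gK'] := ga; rewrite gK'.
move=> _ [_ [n [a [v [Sa Nv ->]]]] <-]; exists n, a, (g \o v); split=> // [j|].
  by exists (v j).
by rewrite (aut_sum _ _ _ ga); apply: eq_bigr => j _; rewrite (autZ _ _ ga).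
Qed.

End LinearAutomorphisms.

(** The ring [Rt] below is a finite product of discrete valuation rings inside
    the product [A] of their fraction fields: [e i] is the [i]-th idempotent and
    [w i] the uniformizer of the [i]-th factor completed by [1] in the others,
    so that [w i] generates the [i]-th maximal ideal and [jacobson_gen] the
    Jacobson radical. *)
Record semilocal (A : comPzRingType) (b : nat) (Rt : set A) (e w wi : 'I_b -> A) :
  Prop := Semilocal {
  sl_subring : subring Rt;
  sl_idem : forall i, Rt (e i);
  sl_unif : forall i, Rt (w i);
  sl_unif_inv : forall i, w i * wi i = 1;
  sl_idemM : forall i, e i * e i = e i;
  sl_unif1 : forall i, w i * (1 - e i) = 1 - e i;
  sl_unif_neq : forall i j, j != i -> e i * w j = e i;
  sl_field : forall i a, Rt a -> ~ [set w i * t | t in Rt] a ->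
    exists2 v, Rt v & v * a = e i;
  sl_proper : forall i, ~ [set w i * t | t in Rt] 1;
  sl_finite : forall i, finite_index Rt [set w i * t | t in Rt];
  sl_jacobson : forall a, Rt a ->
    exists2 u, Rt u & u * (1 - (\prod_i w i) * a) = 1
}.

Section Semilocal.
Variables (A : comPzRingType) (b : nat) (Rt : set A) (e w wi : 'I_b -> A).
Hypothesis sl : semilocal Rt e w wi.
Variable d : nat.
Local Notation V := 'rV[A]_d.
Implicit Types (N P T Y : set V) (x y z : V) (i : 'I_b).

Let pi : A := \prod_i w i.
Let pr i : set A := [set w i * t | t in Rt].
Let q i := index Rt (pr i).

Let sR := sl_subring sl.
Let gR : subgroup Rt. Proof. by case: sR. Qed.
Let R1 : Rt 1. Proof. by case: sR. Qed.
Let RM a a' : Rt a -> Rt a' -> Rt (a * a'). Proof. by case: sR => _ _; apply. Qed.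
Let sub_gp N : submodule Rt N -> subgroup N. Proof. exact: submodule_subgroup. Qed.
Let smZ N a x : submodule Rt N -> Rt a -> N x -> N (a *: x).
Proof. by case=> _ _; apply. Qed.

Let Rpi : Rt pi.
Proof. by apply: (big_ind Rt) => // i _; exact: sl_unif sl i. Qed.

Let RX a n : Rt a -> Rt (a ^+ n).
Proof. by move=> Ra; elim: n => [|n IH]; rewrite ?expr0// exprS; exact: RM. Qed.

Let pr_gp i : subgroup (pr i).
Proof. exact: principal_subgroup. Qed.

Lemma residue_card_gt1 i : (1 < q i)%N.
Proof.
have := index_gt0 (pr_gp i) (subgroup0 gR) (sl_finite sl i).
rewrite leq_eqVlt => /orP[/eqP q1|//]; exfalso; apply: (sl_proper sl (i:=i)).
exact: (index_eq1 gR (pr_gp i) (sl_finite sl i) (esym q1)).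
Qed.

Lemma idem_pi i : e i * pi = e i * w i.
Proof.
rewrite /pi (bigD1 i)//= mulrCA mulrC; congr (_ * _).
elim/big_rec: _ => [|j u ji IH]; first by rewrite mulr1.
by rewrite mulrA (sl_unif_neq sl ji).
Qed.

(** [1 - e i] is a multiple of [w i], so an element killed by [w i] is supported
    on the [i]-th factor. *)
Lemma idem_notin N x i : submodule Rt N -> N (w i *: x) ->
  N (e i *: x) -> N x.
Proof.
move=> sN Nw Ne.
have R1e : Rt (1 - e i) by apply: (subgroupB gR) => //; exact: sl_idem sl i.
have -> : x = e i *: x + (1 - e i) *: ((w i) *: x).
  by rewrite !scalerA [_ * w i]mulrC (sl_unif1 sl) -scalerDl addrC subrK scale1r.
by apply: (subgroupD (sub_gp sN)) => //; exact: smZ.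
Qed.

(** A submodule of finite index absorbs a power of the Jacobson radical. *)
Lemma finite_index_absorb N T : submodule Rt N -> submodule Rt T ->
  finite_index N T -> forall x, N x -> T (pi ^+ index N T *: x).
Proof.
move=> sN sT fNT x Nx.
have [|i [j [ij jk Tij]]] := finite_index_pigeonhole
    (u := fun n => pi ^+ n *: x) (sub_gp sT) fNT.
  by move=> n; apply: smZ => //; exact: RX.
have [u Ru uE] := sl_jacobson sl (RX (j - i).-1 Rpi).
rewrite -/pi -exprS prednK ?subn_gt0// in uE.
have ik : (i <= index N T)%N by exact: ltnW (leq_trans ij jk).
rewrite -(subnK ik) exprD -scalerA; apply: smZ => //; first exact: RX.
have -> : pi ^+ i *: x = u *: (pi ^+ i *: x - pi ^+ j *: x).
  have -> : pi ^+ j = pi ^+ i * pi ^+ (j - i) by rewrite -exprD subnKC// ltnW.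
  rewrite -scalerBl scalerA.
  by rewrite -[X in X - _]mulr1 -mulrBr mulrCA uE mulr1.
exact: smZ.
Qed.

(** [pi ^+ k] is a product of the [w i]; multiplying by them one at a time, stop
    just before entering [T]. *)
Lemma pick_socle T x k : submodule Rt T -> ~ T x -> T (pi ^+ k *: x) ->
  exists i a, [/\ Rt a, ~ T (a *: x), T (w i *: (a *: x))
    & e i *: (a *: x) = a *: x].
Proof.
move=> sT Tx Tk.
have [a0 [Ra0 Ta0 Tpi]] : exists a, [/\ Rt a, ~ T (a *: x) & T (pi *: (a *: x))].
  elim: k Tk => [|k IH]; first by rewrite expr0 scale1r.
  have [/IH//|nTk] := pselect (T (pi ^+ k *: x)).
  by rewrite exprS -scalerA => ?; exists (pi ^+ k); split=> //; exact: RX.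
have [i [a [Ra Ta Twa]]] : exists i a, [/\ Rt a, ~ T (a *: x) & T (w i *: (a *: x))].
  move: Tpi; rewrite /pi; elim: (index_enum _) a0 Ra0 Ta0 => [|i s IH] a0 Ra0 Ta0.
    by rewrite big_nil scale1r.
  have [Twi _|nTwi] := pselect (T (w i *: (a0 *: x))); first by exists i, a0.
  rewrite big_cons mulrC -scalerA [w i *: (a0 *: x)]scalerA; apply: IH.
    by apply: RM => //; exact: sl_unif sl i.
  by rewrite -scalerA.
have Re := sl_idem sl i.
exists i, (e i * a); split; first exact: RM.
- by rewrite -scalerA => /(idem_notin sT Twa).
- by rewrite -scalerA scalerA mulrC -scalerA; exact: smZ.
- by rewrite scalerA mulrA (sl_idemM sl).
Qed.

(** Submodules [T + Rt x], the basic move from [T] upwards. *)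
Definition adjoin T x : set V := [set y | exists2 a, Rt a & T (y - a *: x)].

Lemma sub_adjoin T x : T `<=` adjoin T x.
Proof. by move=> y Ty; exists 0; [exact: subgroup0|rewrite scale0r subr0]. Qed.

Lemma adjoin_self T x : submodule Rt T -> adjoin T x x.
Proof. by case=> T0 _ _; exists 1 => //; rewrite scale1r subrr. Qed.

Lemma adjoin_submodule T x : submodule Rt T -> submodule Rt (adjoin T x).
Proof.
move=> sT; split.
- by apply: sub_adjoin; case: sT.
- move=> y z [a Ra Ta] [a' Ra' Ta']; exists (a + a'); first exact: subgroupD.
  by rewrite scalerDl opprD addrACA; exact: subgroupD (sub_gp sT) _ _.
- move=> c y Rc [a Ra Ta]; exists (c * a); first exact: RM.
  by rewrite -scalerA -scalerBr; exact: smZ.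
Qed.

Lemma adjoin_sub N T x : submodule Rt N -> T `<=` N -> N x -> adjoin T x `<=` N.
Proof.
move=> sN TN Nx y [a Ra /TN Na].
by apply: (subgroup_subl (sub_gp sN) Na); exact: smZ.
Qed.

Definition std_lattice : set V := [set v | forall j, Rt (v ord0 j)].

Definition free_module N :=
  exists g g', automorphism g g' /\ N = g @` std_lattice.

Lemma std_submodule : submodule Rt std_lattice.
Proof.
split=> [j|x y Rx Ry j|a x Ra Rx j]; rewrite mxE; first exact: subgroup0.
  exact: subgroupD.
exact: RM.
Qed.

Lemma free_submodule N : free_module N -> submodule Rt N.
Proof. by move=> [g [g' [ga ->]]]; apply: (aut_submodule ga std_submodule). Qed.

Lemma free_image N g g' : automorphism g g' -> free_module N ->
  free_module (g @` N).
Proof.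
move=> ga [h [h' [ha ->]]]; exists (g \o h), (h' \o g').
by split; [exact: aut_comp|rewrite image_comp].
Qed.

(** If [T] has index [q i] in the free module [N] and [x] spans [N / T], a
    functional equal to the idempotent [e i] on [x] yields an automorphism that
    contracts [x] by [w i], maps [N] onto [T], and moves vectors along [x] only. *)
Lemma automorphism_step N T x i : free_module N -> submodule Rt T -> N x ->
  ~ T x -> T (w i *: x) -> e i *: x = x ->
  T `<=` N -> N `<=` adjoin T x ->
  exists g g', [/\ automorphism g g', g @` N = T
    & forall y, N y -> exists2 a, Rt a & g y - y = a *: x].
Proof.
move=> fN sT Nx Tx Twx ex TN NT; have sN := free_submodule fN.
have gT := sub_gp sT; have [h [h' [ha NE]]] := fN.
pose dl (j : 'I_d) : V := delta_mx ord0 j.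
have Nh j : N (h (dl j)).
  rewrite NE; exists (dl j) => // k; rewrite mxE /=.
  by case: eqP => // _; rewrite ?mulr0n; exact: subgroup0.
have /choice[c cP] j : exists c, Rt c /\ T (h (dl j) - c *: x).
  by have [c Rc Tc] := NT _ (Nh j); exists c.
pose Phi y := \sum_j h' y ord0 j * c j.
have ha' := aut_sym ha.
have PhiL a y z : Phi (a *: y + z) = a * Phi y + Phi z.
  rewrite /Phi mulr_sumr -big_split; apply: eq_bigr => j _ /=.
  by have [-> _ _] := ha'; rewrite !mxE mulrDl mulrA.
have NR y j : N y -> Rt (h' y ord0 j).
  by rewrite NE => -[z Rz <-]; have [_ -> _] := ha; exact: Rz.
have RPhi y : N y -> Rt (Phi y).
  move=> Ny; apply: subgroup_sum => // j _.
  by apply: RM; [exact: NR|exact: (cP j).1].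
have TPhi y : N y -> T (y - Phi y *: x).
  move=> Ny; have [_ _ hK] := ha; rewrite -{1}(hK y) [h' y]row_sum_delta.
  rewrite (aut_sum _ _ _ ha) /Phi scaler_suml -sumrB.
  apply: subgroup_sum => // j _.
  rewrite (autZ _ _ ha) -scalerA -scalerBr; apply: smZ => //; first exact: NR.
  exact: (cP j).2.
have [v Rv vE] : exists2 v, Rt v & v * Phi x = e i.
  apply: (sl_field sl); first exact: RPhi.
  move=> [t Rt' tE]; apply: Tx; apply: (subgroup_subl gT (TPhi _ Nx)).
  by rewrite -tE mulrC -scalerA; exact: smZ.
pose Psi y := v * Phi y.
have PsiL a y z : Psi (a *: y + z) = a * Psi y + Psi z.
  by rewrite /Psi PhiL mulrDr mulrCA.
have Psix : Psi x = e i by [].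
have PsiZD a y : Psi (y + a *: x) = Psi y + a * e i by rewrite addrC PsiL Psix addrC.
have TPsi y : N y -> T (y - Psi y *: x).
  move=> Ny; apply: (subgroup_trans gT (TPhi _ Ny)).
  rewrite /Psi mulrC -scalerA -scalerBr; apply: smZ => //; first exact: RPhi.
  apply: (subgroup_sym gT); have := smZ sT Rv (TPhi _ Nx).
  by rewrite scalerBr scalerA vE ex.
have RPsi y : N y -> Rt (Psi y) by move=> Ny; apply: RM => //; exact: RPhi.
have wie : wi i * (1 - e i) = 1 - e i.
  by rewrite -{1}(sl_unif1 sl) mulrA [wi i * _]mulrC (sl_unif_inv sl) mul1r.
have ring1 (z s ei : A) : z + (s - (1 - ei) - ei) * z = s * z by ring.
have ring2 (s s' z : A) : (s - 1) * z + (s' - 1) * (s * z) = (s' * s - 1) * z by ring.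
have stretchL (s : A) : s * (1 - e i) = 1 - e i -> forall y,
    Psi (y + ((s - 1) * Psi y) *: x) = s * Psi y.
  move=> sP y; rewrite PsiZD.
  have -> : (s - 1) * Psi y * e i = (s * e i - e i) * Psi y by ring.
  have -> : s * e i = s - (1 - e i) by rewrite -sP; ring.
  exact: ring1.
pose g s y := y + ((s - 1) * Psi y) *: x.
have gL s a y z : g s (a *: y + z) = a *: g s y + g s z.
  by rewrite /g PsiL mulrDr scalerDl scalerDr scalerA addrACA mulrCA.
have gK s s' : s * (1 - e i) = 1 - e i -> s' * s = 1 -> cancel (g s) (g s').
  move=> sP s's y; rewrite {1}/g stretchL// /g -addrA -scalerDl.
  by rewrite ring2 s's subrr mul0r scale0r addr0.
have gaut : automorphism (g (w i)) (g (wi i)).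
  split; first exact: gL.
    by apply: gK; [exact: sl_unif1 sl i|rewrite mulrC (sl_unif_inv sl)].
  by apply: gK => //; exact: sl_unif_inv sl i.
have Rw := sl_unif sl i.
exists (g (w i)), (g (wi i)); split=> //; last first.
  move=> y Ny; exists ((w i - 1) * Psi y); last by rewrite /g addrC addKr.
  by apply: RM; [exact: (subgroupB gR)|exact: RPsi].
apply/seteqP; split=> [_ [y Ny <-]|y Ty].
  have -> : g (w i) y = (y - Psi y *: x) + Psi y *: (w i *: x).
    by rewrite /g scalerA mulrBl mul1r scalerBl [Psi y * _]mulrC addrCA addrC.
  by apply: (subgroupD gT); [exact: TPsi|apply: smZ => //; exact: RPsi].
have Ny := TN _ Ty.
exists (g (wi i) y); last by have [_ _ ->] := gaut.
suff [t Rt' tE] : pr i (Psi y).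
  rewrite /g mulrBl mul1r -tE mulrA [wi i * _]mulrC (sl_unif_inv sl) mul1r tE.
  apply: (subgroupD (sub_gp sN)) => //; apply: smZ => //.
  by apply: (subgroupB gR) => //; exact: RPsi.
apply: contrapT => npr; have [u Ru uE] := sl_field sl (RPsi _ Ny) npr.
apply: Tx; rewrite -ex -uE -scalerA; apply: smZ => //.
exact: (subgroup_subr gT (TPsi _ Ny) Ty).
Qed.

(** Supplements of [P] are all obtained from [N] by automorphisms congruent to
    the identity modulo [P]. *)
Lemma automorphism_mod N T P : free_module N -> submodule Rt T ->
  submodule Rt P -> T `<=` N -> P `<=` N -> finite_index N T ->
  (forall y, N y -> exists2 t, T t & P (y - t)) ->
  exists g g', [/\ automorphism g g', g @` N = T & forall y, N y -> P (g y - y)].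
Proof.
move=> fN sT sP TN PN fNT; have sN := free_submodule fN.
have [n] := ubnP (index N T); elim: n T sT TN fNT => // n IH T sT TN fNT ltn NTP.
have [NT|nNT] := pselect (N `<=` T).
  exists id, id; split; first exact: aut_id.
    by rewrite image_id; apply/seteqP; split.
  by move=> y _; rewrite subrr; case: sP.
have [y0 Py0 Ty0] : exists2 y, P y & ~ T y.
  apply: contrapT => no; apply: nNT => y /NTP[t Tt Pyt].
  apply: (subgroup_subl (sub_gp sT) _ Tt); apply: contrapT => nT.
  by apply: no; exists (y - t).
have [i [a [Ra Tx Twx ex]]] :=
  pick_socle sT Ty0 (finite_index_absorb sN sT fNT (PN _ Py0)).
have Px := smZ sP Ra Py0; set x := a *: y0 in Px Tx Twx ex.
have sT1 := adjoin_submodule x sT; have TT1 := @sub_adjoin T x.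
have T1N : adjoin T x `<=` N by apply: adjoin_sub => //; exact: PN.
have fNT1 : finite_index N (adjoin T x).
  by apply: finite_index_subr (sub_gp sT) (sub_gp sT1) TT1 fNT.
have [||g [g' [ga gN gP]]] := IH _ sT1 T1N fNT1.
- rewrite -ltnS; apply: leq_trans ltn; rewrite ltnS.
  apply: (index_ltr (sub_gp sN) (sub_gp sT1) (sub_gp sT)) => //.
  by move=> /(_ x (adjoin_self x sT)).
- by move=> y /NTP[t Tt Pt]; exists t => //; exact: TT1.
have fT1 : free_module (adjoin T x) by rewrite -gN; exact: free_image ga fN.
have [h [h' [ha hT1 hP]]] :=
  automorphism_step fT1 sT (adjoin_self x sT) Tx Twx ex TT1 (fun _ Ny => Ny).
exists (h \o g), (g' \o h'); split; first exact: aut_comp.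
  by rewrite -image_comp gN hT1.
move=> y Ny /=; rewrite -(subrK (g y) (h (g y))) -addrA.
apply: (subgroupD (sub_gp sP)); last exact: gP.
have [|c Rc ->] := hP (g y); first by rewrite -gN; exists y.
exact: smZ.
Qed.

Lemma free_finite_index N T : free_module N -> submodule Rt T -> T `<=` N ->
  finite_index N T -> free_module T.
Proof.
move=> fN sT TN fNT; have sN := free_submodule fN.
have [|g [g' [ga <- _]]] := automorphism_mod fN sT sN TN (fun _ Ny => Ny) fNT.
  move=> y Ny; exists 0; [by case: sT|by rewrite subr0].
exact: free_image ga fN.
Qed.

(** * Ranks and complements *)

Let R_sum k (F : 'I_k -> A) : (forall j, Rt (F j)) -> Rt (\sum_j F j).
Proof.
move=> RF; elim/big_ind: _ => //; first exact: subgroup0.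
by move=> x y; exact: subgroupD.
Qed.

Let sm_sum N k (F : 'I_k -> V) : submodule Rt N -> (forall j, N (F j)) ->
  N (\sum_j F j).
Proof. by move=> [N0 ND _] NF; elim/big_ind: _. Qed.

Definition scaled (u : A) N : set V := [set u *: x | x in N].

(** The quotient of [N] by this submodule is the tensor product of [N / P] with
    the [i]-th residue field. *)
Definition rank_mod i P N : set V := [set x + y | x in P & y in scaled (w i) N].

Lemma scaled_submodule u N : submodule Rt N -> submodule Rt (scaled u N).
Proof.
move=> [N0 ND NZ]; split; first by exists 0; rewrite ?scaler0.
  by move=> _ _ [x Nx <-] [y Ny <-]; exists (x + y); rewrite ?scalerDr//; exact: ND.
by move=> a _ Ra [x Nx <-]; exists (a *: x); [exact: NZ|rewrite !scalerA mulrC].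
Qed.

Lemma scaled_sub u N : Rt u -> submodule Rt N -> scaled u N `<=` N.
Proof. by move=> Ru sN _ [x Nx <-]; exact: smZ. Qed.

Lemma rank_mod_submodule i P N : submodule Rt P -> submodule Rt N ->
  submodule Rt (rank_mod i P N).
Proof. by move=> sP /(scaled_submodule (w i)); exact: submodule_add. Qed.

Lemma rank_mod_subl i P N : submodule Rt N -> P `<=` rank_mod i P N.
Proof.
move=> /(scaled_submodule (w i))[N0 _ _] x Px.
by exists x => //; exists 0 => //; rewrite addr0.
Qed.

Lemma rank_mod_subr i P N : submodule Rt P -> scaled (w i) N `<=` rank_mod i P N.
Proof. by move=> [P0 _ _] x Nx; exists 0 => //; exists x => //; rewrite add0r. Qed.

Lemma rank_mod_sub i P N : submodule Rt N -> P `<=` N -> rank_mod i P N `<=` N.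
Proof.
move=> sN PN _ [x Px [y Ny <-]].
apply: (subgroupD (sub_gp sN)); first exact: PN.
by apply: (scaled_sub _ sN Ny); exact: sl_unif sl i.
Qed.

(** The classes of [v] form a basis of [N / Y] over the [i]-th residue field. *)
Definition residue_basis N Y i k (v : 'I_k -> V) :=
  [/\ forall j, N (v j),
      forall x, N x -> exists a : 'I_k -> A,
        (forall j, Rt (a j)) /\ Y (x - \sum_j a j *: v j)
    & forall a : 'I_k -> A, (forall j, Rt (a j)) ->
        Y (\sum_j a j *: v j) -> forall j, pr i (a j)].

Lemma residue_basis_index N Y i k (v : 'I_k -> V) :
  submodule Rt N -> submodule Rt Y -> scaled (w i) N `<=` Y ->
  residue_basis N Y i v -> finite_index N Y /\ index N Y = (q i ^ k)%N.
Proof.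
move=> sN sY wY [Nv vgen vfree].
have [r [rR rP rI]] := finite_index_transversal (pr_gp i) (sl_finite sl i).
have <- : #|{: {ffun 'I_k -> 'I_(q i)}}| = (q i ^ k)%N.
  by rewrite card_ffun !card_ord.
have Ypr a j : pr i a -> Y (a *: v j).
  by move=> [t Rt' <-]; rewrite -scalerA; apply: wY; exists (t *: v j) => //; exact: smZ.
apply: (@transversal_index _ _ _ _ (fun f : {ffun _} => \sum_j r (f j) *: v j)).
  exact: sub_gp.
split=> [f|x Nx|f f'] /=.
- by apply: sm_sum => // j; exact: smZ.
- have [a [Ra Ya]] := vgen _ Nx.
  have /choice[f fP] j : exists c, pr i (a j - r c) by exact: rP.
  exists [ffun j => f j]; apply: (subgroup_trans (sub_gp sY) Ya).
  rewrite -sumrB; apply: sm_sum => // j.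
  by rewrite ffunE -scalerBl; exact: Ypr.
- rewrite -sumrB; under eq_bigr do rewrite -scalerBl.
  move=> /vfree h; apply/ffunP => j; apply: rI; apply: h => {}j.
  exact: (subgroupB gR).
Qed.

Lemma idem_colon T x i a : submodule Rt T -> ~ T x -> e i *: x = x ->
  Rt a -> T (a *: x) -> pr i a.
Proof.
move=> sT Tx ex Ra Ta; apply: contrapT => npr.
have [u Ru uE] := sl_field sl Ra npr.
by apply: Tx; rewrite -ex -uE -scalerA; exact: smZ.
Qed.

Lemma colon_pr T x i a : submodule Rt T -> T (w i *: x) -> pr i a -> T (a *: x).
Proof. by move=> sT Tw [t Rt' <-]; rewrite mulrC -scalerA; exact: smZ. Qed.

Lemma index_adjoin T x i : submodule Rt T -> ~ T x -> T (w i *: x) ->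
  e i *: x = x -> finite_index (adjoin T x) T /\ index (adjoin T x) T = q i.
Proof.
move=> sT Tx Tw ex; have gT := sub_gp sT.
have [r [rR rP rI]] := finite_index_transversal (pr_gp i) (sl_finite sl i).
rewrite -[q i]card_ord; apply: (@transversal_index _ _ _ _ (fun k => r k *: x)) => //.
split=> [k|y [a Ra Ta]|k k'].
- by exists (r k) => //; rewrite subrr; exact: subgroup0.
- have [k ak] := rP _ Ra; exists k; apply: (subgroup_trans gT Ta).
  by rewrite -scalerBl; exact: colon_pr ak.
- rewrite -scalerBl => Tk; apply: rI; apply: idem_colon Tk => //.
  exact: (subgroupB gR).
Qed.

(** Adjoining vectors to [Y] one at a time until [N] is reached. *)
Lemma residue_basis_exists N Y i : submodule Rt N -> submodule Rt Y ->
  scaled (w i) N `<=` Y -> Y `<=` N -> finite_index N Y ->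
  exists k (v : 'I_k -> V), residue_basis N Y i v.
Proof.
move=> sN; have [n] := ubnP (index N Y); elim: n Y => // n IH Y ltn sY wY YN fNY.
have [NY|nNY] := pselect (N `<=` Y).
  exists 0%N, (fun=> 0); split=> [[]//|x Nx|a _ _ []//].
  by exists (fun=> 0); split=> [[]//|]; rewrite big_ord0 subr0; exact: NY.
have [x0 Nx0 Yx0] : exists2 x, N x & ~ Y x.
  by apply: contrapT => no; apply: nNY => x Nx; apply: contrapT => Yx; apply: no; exists x.
have Re := sl_idem sl i.
have Ywx y : N y -> Y (w i *: y) by move=> Ny; apply: wY; exists y.
have Yx : ~ Y (e i *: x0) by move/(idem_notin sY (Ywx _ Nx0)).
have Nx : N (e i *: x0) by exact: smZ.
have ex : e i *: (e i *: x0) = e i *: x0 by rewrite scalerA (sl_idemM sl).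
set x := e i *: x0 in Yx Nx ex.
have sY1 := adjoin_submodule x sY; have YY1 := @sub_adjoin Y x.
have Y1N : adjoin Y x `<=` N by exact: adjoin_sub.
have [|||k [v [Nv vgen vfree]]] := IH _ _ sY1 _ Y1N.
- rewrite -ltnS; apply: leq_trans ltn; rewrite ltnS.
  apply: (index_ltr (sub_gp sN) (sub_gp sY1) (sub_gp sY)) => //.
  by move=> /(_ x (adjoin_self x sY)).
- by move=> y /wY /YY1.
- exact: finite_index_subr (sub_gp sY) (sub_gp sY1) YY1 fNY.
exists k.+1, (fun j => oapp v x (unlift ord0 j)); split.
- by move=> j; case: unliftP => [j' _|_] //=; exact: Nv.
- move=> y /vgen[a [Ra [c Rc Yc]]].
  exists (fun j => oapp a c (unlift ord0 j)); split.
    by move=> j; case: unliftP => [j' _|_] /=.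
  rewrite big_ord_recl unlift_none /=.
  by under eq_bigr do rewrite liftK /=; rewrite opprD addrA addrAC.
move=> a Ra; rewrite big_ord_recl unlift_none /=.
under eq_bigr do rewrite liftK /=.
move=> Ysum.
have pra j : pr i (a (lift ord0 j)).
  apply: (vfree (fun j => a (lift ord0 j))) => //.
  exists (- a ord0); first exact: (subgroupN gR).
  by rewrite scaleNr opprK addrC.
have Y0 : Y (a ord0 *: x).
  apply: (subgroup_subr (sub_gp sY) (x := a ord0 *: x + \sum_(j < k) a (lift ord0 j) *: v j)) => //.
  rewrite addrC addKr; apply: sm_sum => // j.
  by apply: (colon_pr sY _ (pra j)); exact: Ywx.
move=> j; have [j' ->|->] := unliftP ord0 j; first exact: pra.
exact: (idem_colon sY Yx ex (Ra ord0) Y0).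
Qed.

(** The submodules over which the zeta functions are summed. All submodules of
    finite index are supplements of [N] itself, and only [N] is one of the
    Jacobson radical of [N]. *)
Definition supplements N P : set (set V) :=
  [set T | [/\ submodule Rt T, T `<=` N, finite_index N T
    & forall y, N y -> exists2 t, T t & P (y - t)]].

Definition complements N P x : set (set V) :=
  [set T | [/\ submodule Rt T, P `<=` T, T `<=` N, ~ T x
    & forall y, N y -> adjoin T x y]].

(** [x] spans a simple submodule, isomorphic to the [i]-th residue field, of
    the semisimple module [N / P]. *)
Definition simple_step N P x i :=
  [/\ submodule Rt P, P `<=` N, scaled pi N `<=` P, N x & ~ P x] /\
  [/\ P (w i *: x) & e i *: x = x].

Section SimpleStep.
Variables (N P : set V) (x : V) (i : 'I_b).
Hypotheses (fN : free_module N) (step : simple_step N P x i).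
Let sN : submodule Rt N. Proof. exact: free_submodule. Qed.
Let sP : submodule Rt P. Proof. by case: step => -[]. Qed.
Let PN : P `<=` N. Proof. by case: step => -[]. Qed.
Let piP : scaled pi N `<=` P. Proof. by case: step => -[]. Qed.
Let Nx : N x. Proof. by case: step => -[]. Qed.
Let Px : ~ P x. Proof. by case: step => -[]. Qed.
Let Pwx : P (w i *: x). Proof. by case: step => _ []. Qed.
Let ex : e i *: x = x. Proof. by case: step => _ []. Qed.
Local Notation Px1 := (adjoin P x).

Lemma complement_adjoin T : complements N P x T -> N = adjoin T x.
Proof.
move=> [sT PT TN Tx NT]; apply/seteqP; split=> //.
exact: adjoin_sub.
Qed.

Lemma complement_index T : complements N P x T ->
  finite_index N T /\ index N T = q i.
Proof.
move=> CT; have [sT PT TN Tx NT] := CT.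
rewrite (complement_adjoin CT); apply: index_adjoin => //; exact: PT.
Qed.

(** The automorphism is congruent to the identity modulo [P + Rt x], so it maps
    [P + Rt x] into itself and into [T], that is, into [P]. *)
Lemma complement_automorphism T : complements N P x T ->
  exists g g', [/\ automorphism g g', g @` N = T & g @` Px1 = P].
Proof.
move=> CT; have [sT PT TN Tx NT] := CT; have [fNT _] := complement_index CT.
have sP1 := adjoin_submodule x sP.
have P1N : Px1 `<=` N by exact: adjoin_sub.
have [|g [g' [ga gN gP]]] := automorphism_mod fN sT sP1 TN P1N fNT.
  move=> y /NT[a Ra Ta]; exists (y - a *: x) => //.
  by rewrite opprB addrC subrK; exists a; rewrite ?subrr//; case: sP.
exists g, g'; split=> //; apply/seteqP; split.
  move=> _ [y P1y <-]; have Ny := P1N _ P1y.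
  have [a Ra Pa] := subgroup_subl (sub_gp sP1) (gP _ Ny) P1y.
  apply: (subgroup_subl (sub_gp sP) Pa).
  apply: (colon_pr sP Pwx); apply: (idem_colon sT Tx ex Ra).
  by apply: (subgroup_subr (sub_gp sT) (PT _ Pa)); rewrite -gN; exists y.
move=> p Pp; have := PT _ Pp; rewrite -gN => -[y Ny yp]; exists y => //.
apply: (subgroup_subr (sub_gp sP1) (gP _ Ny)); rewrite yp; exact: sub_adjoin.
Qed.

(** If a supplement [T] of [P + Rt x] does not supplement [P], then [T + P] is a
    complement of the line spanned by [x]. *)
Lemma supplement_step T : supplements N Px1 T ->
  supplements N P T \/ exists2 T', complements N P x T' & supplements T' P T.
Proof.
move=> [sT TN fNT NTP]; have gT := sub_gp sT.
have [h|h] := pselect (forall y, N y -> exists2 t, T t & P (y - t)); first by left.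
right; pose T' : set V := [set y | exists2 t, T t & P (y - t)].
have TT' : T `<=` T' by move=> y Ty; exists y => //; rewrite subrr; case: sP.
have PT' : P `<=` T' by move=> y Py; exists 0; [case: sT|rewrite subr0].
have sT' : submodule Rt T'.
  split; first by apply: TT'; case: sT.
    move=> y z [t Tt Pt] [t' Tt' Pt']; exists (t + t'); first exact: subgroupD.
    by rewrite opprD addrACA; exact: subgroupD (sub_gp sP) _ _.
  move=> a y Ra [t Tt Pt]; exists (a *: t); first exact: smZ.
  by rewrite -scalerBr; exact: smZ.
have T'N : T' `<=` N.
  by move=> y [t /TN Nt /PN Nyt]; exact: (subgroup_subl (sub_gp sN) Nyt).
have NT' y : N y -> adjoin T' x y.
  by move=> /NTP[t Tt [a Ra Pa]]; exists a => //; exists t => //; rewrite addrAC.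
exists T'; split=> //.
- move=> T'x; apply: h => y /NT'[a Ra T'a].
  by have := subgroup_subl (sub_gp sT') T'a (smZ sT' Ra T'x).
- exact: finite_index_subl fNT.
Qed.

Lemma supplements_sub T : supplements N P T -> supplements N Px1 T.
Proof.
move=> [sT TN fNT NTP]; split=> // y /NTP[t Tt Pt].
by exists t => //; exact: sub_adjoin.
Qed.

Lemma complement_supplements T T' : complements N P x T' ->
  supplements T' P T -> [/\ supplements N Px1 T, ~ supplements N P T
    & T' = [set y | exists2 t, T t & P (y - t)]].
Proof.
move=> CT'; have [sT' PT' T'N T'x NT'] := CT'.
have [fNT' _] := complement_index CT'.
move=> [sT TT' fT'T TP]; split.
- split=> // [y /TT'/T'N//||y /NT'[a Ra /TP[t Tt Pt]]].
    have [] // := index_mul (sub_gp sT') (sub_gp sT) T'N TT' (sub_gp sN) fNT' fT'T.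
  by exists t => //; exists a => //; rewrite addrAC.
- move=> [_ _ _ NTP]; apply: T'x; have [t Tt Pt] := NTP _ Nx.
  exact: (subgroup_subl (sub_gp sT') (PT' _ Pt) (TT' _ Tt)).
- apply/seteqP; split=> [y /TP//|y [t Tt Pt]].
  exact: (subgroup_subl (sub_gp sT') (PT' _ Pt) (TT' _ Tt)).
Qed.

(** [P] contains the radical of [N], and [x] is supported on one factor. *)
Lemma rank_mod_notin : ~ rank_mod i P N x.
Proof.
move=> [p Pp [_ [y Ny <-] xE]]; apply: Px.
rewrite -ex -xE scalerDr scalerA -idem_pi -scalerA.
apply: (subgroupD (sub_gp sP)); apply: smZ => //; try exact: sl_idem sl i.
by apply: piP; exists y.
Qed.

Lemma rank_mod_adjoin : rank_mod i Px1 N = adjoin (rank_mod i P N) x.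
Proof.
apply/seteqP; split=> [_ [y [a Ra Pa] [z wz <-]]|y [a Ra [p Pp [z wz yE]]]].
  by exists a => //; exists (y - a *: x) => //; exists z => //; rewrite addrAC.
exists (p + a *: x); first by exists a => //; rewrite addrK.
by exists z => //; rewrite addrAC yE subrK.
Qed.

Lemma rank_mod_step j : j != i -> rank_mod j Px1 N = rank_mod j P N.
Proof.
move=> ji; apply/seteqP; split=> [_ [y [a Ra Pa] [_ [z Nz <-] <-]]|].
  exists (y - a *: x) => //; exists (w j *: (z + a *: x)).
    exists (z + a *: x) => //; apply: (subgroupD (sub_gp sN)) => //; exact: smZ.
  have wx : w j *: x = x by rewrite -ex scalerA mulrC (sl_unif_neq sl ji).
  by rewrite scalerDr [w j *: (a *: x)]scalerA [w j * a]mulrC -scalerA wx addrACA addNr addr0.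
move=> _ [y Py [z wz <-]]; exists y; first exact: sub_adjoin.
by exists z.
Qed.

Lemma rank_step_index : finite_index N P ->
  index N (rank_mod i P N) = (index N (rank_mod i Px1 N) * q i)%N.
Proof.
move=> fNP; have sP' := rank_mod_submodule i sP sN.
have PP' := rank_mod_subl i (P := P) sN; have P'N := @rank_mod_sub i _ _ sN PN.
have [fa <-] := index_adjoin sP' rank_mod_notin (PP' _ Pwx) ex.
rewrite rank_mod_adjoin; apply: index_mulr; try exact: sub_gp.
- by apply: sub_gp; exact: adjoin_submodule.
- exact: adjoin_sub.
- exact: sub_adjoin.
- exact: finite_index_subr (sub_gp sP) (sub_gp sP') PP' fNP.
Qed.

(** The complements of the line spanned by [x] form a torsor under the linear
    maps from [N / (P + Rt x)] to that line; a basis of the former space names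
    them by coordinates. *)
Lemma complements_param k (v : 'I_k -> V) : residue_basis N (rank_mod i Px1 N) i v ->
  exists f : {ffun 'I_k -> 'I_(q i)} -> set V, injective f /\
    forall T, complements N P x T <-> exists c, f c = T.
Proof.
move=> [Nv vgen vfree].
have [r [rR rP rI]] := finite_index_transversal (pr_gp i) (sl_finite sl i).
have sP' := rank_mod_submodule i sP sN; set P' := rank_mod i P N in sP'.
have gP' := sub_gp sP'.
have PP' : P `<=` P' := rank_mod_subl i sN; have P'N : P' `<=` N := @rank_mod_sub i _ _ sN PN.
have P'x : ~ P' x := rank_mod_notin.
have wP' : scaled (w i) N `<=` P' := @rank_mod_subr i _ _ sP.
have RE : rank_mod i Px1 N = adjoin P' x := rank_mod_adjoin.
rewrite RE in vgen vfree.
pose u (c : {ffun 'I_k -> 'I_(q i)}) j := v j - r (c j) *: x.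
have Nu c j : N (u c j) by apply: (subgroupB (sub_gp sN)) => //; exact: smZ.
pose f c : set V := [set y | exists a : 'I_k -> A,
  (forall j, Rt (a j)) /\ P' (y - \sum_j a j *: u c j)].
have Nsum c (a : 'I_k -> A) : (forall j, Rt (a j)) -> N (\sum_j a j *: u c j).
  by move=> Ra; apply: sm_sum => // j; exact: smZ.
have usum c (a : 'I_k -> A) : \sum_j a j *: u c j =
    \sum_j a j *: v j - (\sum_j a j * r (c j)) *: x.
  by rewrite scaler_suml -sumrB; apply: eq_bigr => j _; rewrite scalerBr scalerA.
have sf c : submodule Rt (f c).
  split.
  - exists (fun=> 0); split=> [_|]; first exact: subgroup0.
    by rewrite big1 ?subr0 => [|j _]; [exact: subgroup0|rewrite scale0r].
  - move=> y z [a [Ra Pa]] [a' [Ra' Pa']]; exists (fun j => a j + a' j).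
    split=> [j|]; first exact: subgroupD.
    under eq_bigr do rewrite scalerDl.
    by rewrite big_split opprD addrACA /=; exact: subgroupD.
  - move=> b' y Rb [a [Ra Pa]]; exists (fun j => b' * a j); split=> [j|]; first exact: RM.
    under eq_bigr do rewrite -scalerA.
    by rewrite -scaler_sumr -scalerBr; exact: smZ.
have Pf c : P' `<=` f c.
  move=> y P'y; exists (fun=> 0); split=> [_|]; first exact: subgroup0.
  by rewrite big1 ?subr0 => [|j _]; [|rewrite scale0r].
have fNsub c : f c `<=` N.
  by move=> y [a [Ra /P'N Na]]; apply: (subgroup_subl (sub_gp sN) Na); exact: Nsum.
have xf c : ~ f c x.
  move=> [a [Ra Pa]]; apply: P'x.
  apply: (subgroup_subl gP' Pa); apply: sm_sum => // j.
  have [t Rt' <-] : pr i (a j).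
    apply: vfree => //.
    exists (1 + \sum_j a j * r (c j)).
      apply: (subgroupD gR) => //; apply: R_sum => l; exact: RM.
    rewrite scalerDl scale1r opprD addrA addrAC -usum.
    exact: (subgroup_sym gP').
  by rewrite -scalerA; apply: wP'; exists (t *: u c j) => //; exact: smZ.
have uf c j : f c (u c j).
  exists (fun l => (l == j)%:R); split=> [l|].
    by case: (l == j) => //; exact: subgroup0.
  rewrite (bigD1 j)//= eqxx scale1r big1 ?addr0 ?subrr => [|l /negPf ->].
    exact: subgroup0.
  by rewrite scale0r.
have fgen c y : N y -> adjoin (f c) x y.
  move=> /vgen[a [Ra [a0 Ra0 Pa]]].
  exists (a0 + \sum_j a j * r (c j)).
    apply: (subgroupD gR) => //; apply: R_sum => l; exact: RM.
  exists a; split=> //; rewrite usum scalerDl.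
  suff -> : forall s t t' z : V, z - (s + t) - (t' - t) = z - t' - s by [].
  by move=> s t t' z; rewrite !opprD opprK !addrA addrAC subrK addrAC.
have cf c : complements N P x (f c).
  by split=> //; [move=> y /PP'/Pf|exact: fgen].
exists f; split=> [c c' fcc'|T].
  apply/ffunP => j; apply: rI.
  apply: (idem_colon (sf c) (@xf c) ex); first exact: (subgroupB gR).
  have -> : (r (c j) - r (c' j)) *: x = u c' j - u c j.
    by rewrite /u scalerBl opprB [RHS]addrC addrA subrK.
  apply: (subgroupB (sub_gp (sf c))) => //; rewrite fcc'; exact: uf.
split=> [CT|[c <-]//]; have [sT PT TN Tx NT] := CT.
have P'T : P' `<=` T.
  move=> _ [p Pp [_ [y Ny <-] <-]].
  apply: (subgroupD (sub_gp sT)); first exact: PT.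
  have [a Ra Ta] := NT _ Ny; rewrite -(subrK (a *: x) y) scalerDr.
  apply: (subgroupD (sub_gp sT)); first by apply: smZ => //; exact: sl_unif sl i.
  by rewrite scalerA mulrC -scalerA; apply: smZ => //; exact: PT.
have /choice[c cP] j : exists c, T (v j - r c *: x).
  have [a Ra Ta] := NT _ (Nv j); have [c ac] := rP _ Ra; exists c.
  apply: (subgroup_trans (sub_gp sT) Ta); rewrite -scalerBl.
  exact: (colon_pr sT (PT _ Pwx) ac).
exists [ffun j => c j].
have uT j : T (u [ffun j => c j] j) by rewrite /u ffunE.
apply/seteqP; split=> y.
  move=> [a [Ra /P'T Ta]]; apply: (subgroup_subl (sub_gp sT) Ta).
  by apply: sm_sum => // j; exact: smZ.
move=> Ty; have [a Ra fa] := fgen [ffun j => c j] _ (TN _ Ty).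
apply: (subgroup_subl (sub_gp (sf _)) fa); apply: Pf; apply: PP'.
apply: (colon_pr sP Pwx); apply: (idem_colon sT Tx ex Ra).
apply: (subgroup_subr (sub_gp sT) _ Ty).
have [a' [Ra' /P'T Ta']] := fa.
apply: (subgroup_subl (sub_gp sT) Ta').
by apply: sm_sum => // j; exact: smZ.
Qed.

End SimpleStep.

Lemma simple_step_exists N P : submodule Rt N -> submodule Rt P -> P `<=` N ->
  scaled pi N `<=` P -> ~ N `<=` P -> exists x i, simple_step N P x i.
Proof.
move=> sN sP PN piP nNP.
have [x0 Nx0 Px0] : exists2 x, N x & ~ P x.
  by apply: contrapT => no; apply: nNP => x Nx; apply: contrapT => Px; apply: no; exists x.
have [|i [a [Ra Px Pwx ex]]] := pick_socle (k := 1) sP Px0.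
  by rewrite expr1; apply: piP; exists x0.
by exists (a *: x0), i; split; split=> //; exact: smZ.
Qed.

(** Every submodule between [pi N] and [N] is reached from [N] by simple steps,
    each of which raises one rank by one. *)
Lemma simple_step_ind N (Q : set V -> ('I_b -> nat) -> Prop) : free_module N ->
  Q N (fun=> 0%N) ->
  (forall P x i rho, simple_step N P x i -> finite_index N P ->
     (forall j, index N (rank_mod j (adjoin P x) N) = (q j ^ rho j)%N) ->
     Q (adjoin P x) rho -> Q P (fun j => rho j + (j == i))%N) ->
  forall P rho, submodule Rt P -> P `<=` N -> scaled pi N `<=` P ->
    finite_index N P ->
    (forall j, index N (rank_mod j P N) = (q j ^ rho j)%N) -> Q P rho.
Proof.
move=> fN Q0 QS P; have sN := free_submodule fN.
have [n] := ubnP (index N P); elim: n P => // n IH P ltn rho sP PN piP fNP rhoP.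
have [NP|nNP] := pselect (N `<=` P).
  have PE : P = N by apply/seteqP; split.
  rewrite PE (_ : rho = fun=> 0%N)//; apply/funext => j.
  have := rhoP j; rewrite (_ : rank_mod j P N = N); last first.
    apply/seteqP; split; first exact: rank_mod_sub.
    by rewrite PE; exact: rank_mod_subl.
  rewrite (indexid (sub_gp sN)).2; have := residue_card_gt1 j.
  by case: (rho j) => // k q1 /esym/eqP; rewrite expnS muln_eq1 => /andP[/eqP q1'];
    move: q1; rewrite q1'.
have [x [i st]] := simple_step_exists sN sP PN piP nNP.
have [[_ _ _ Nx Px] [Pwx ex]] := st.
have sP1 := adjoin_submodule x sP; have P1N : adjoin P x `<=` N by exact: adjoin_sub.
have PP1 := @sub_adjoin P x.
have fNP1 : finite_index N (adjoin P x).
  exact: finite_index_subr (sub_gp sP) (sub_gp sP1) PP1 fNP.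
have /choice[rho' rhoP'] j : exists k, index N (rank_mod j (adjoin P x) N) = (q j ^ k)%N.
  have sR1 := rank_mod_submodule j sP1 sN.
  have [|k [v vb]] := residue_basis_exists sN sR1 (@rank_mod_subr j _ _ sP1)
    (@rank_mod_sub j _ _ sN P1N).
    exact: finite_index_subr (sub_gp sP1) (sub_gp sR1) (rank_mod_subl j sN) fNP1.
  exists k; have [] // := residue_basis_index sN sR1 (@rank_mod_subr j _ _ sP1) vb.
have -> : rho = fun j => (rho' j + (j == i))%N.
  apply/funext => j; have q1 := residue_card_gt1 j.
  apply/eqP; rewrite -(eqn_exp2l _ _ q1) -rhoP; apply/eqP.
  have [->|ji] := eqVneq j i.
    by rewrite (rank_step_index fN st fNP) rhoP' expnD expn1.
  by rewrite -(rank_mod_step fN st ji) rhoP' addn0.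
apply: (QS _ x i) => //.
apply: (IH (adjoin P x)) => //; last by move=> y /piP /PP1.
rewrite -ltnS; apply: leq_trans ltn; rewrite ltnS.
apply: (index_ltr (sub_gp sN) (sub_gp sP1) (sub_gp sP)) => //.
by move=> /(_ x (adjoin_self x sP)).
Qed.

Lemma residue_basis_std i :
  residue_basis std_lattice (scaled (w i) std_lattice) i
    (fun j : 'I_d => delta_mx ord0 j).
Proof.
have sS := std_submodule; split.
- move=> j l; rewrite mxE /=; case: eqP => // _; exact: subgroup0.
- move=> x Rx; exists (fun j => x ord0 j); split=> //.
  by rewrite -row_sum_delta subrr; apply: subgroup0; apply: sub_gp; exact: scaled_submodule.
- move=> a Ra [y Ry yE] j; exists (y ord0 j) => //.
  have := congr1 (fun z : V => z ord0 j) yE; rewrite mxE => ->.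
  rewrite summxE (bigD1 j)//= !mxE !eqxx mulr1 big1 ?addr0// => k kj.
  by rewrite !mxE eqxx /= eq_sym (negPf kj) mulr0.
Qed.

Lemma aut_scaled g g' u N : automorphism g g' ->
  g @` scaled u N = scaled u (g @` N).
Proof.
move=> ga; apply/seteqP; split.
  by move=> _ [_ [x Nx <-] <-]; exists (g x); [exists x|rewrite (autZ _ _ ga)].
by move=> _ [_ [x Nx <-] <-]; exists (u *: x); [exists x|rewrite (autZ _ _ ga)].
Qed.

(** The coordinate vectors are a residue basis of the standard lattice. *)
Lemma free_residue_index N i : free_module N ->
  finite_index N (scaled (w i) N) /\ index N (scaled (w i) N) = (q i ^ d)%N.
Proof.
move=> [g [g' [ga ->]]]; have sS := scaled_submodule (w i) std_submodule.
rewrite -(aut_scaled _ _ ga).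
have [fi ii] := residue_basis_index std_submodule sS (fun _ h => h) (residue_basis_std i).
by have [? ->] := aut_index ga (sub_gp sS) fi.
Qed.

Lemma scaled_comp u u' N : scaled u (scaled u' N) = scaled (u * u') N.
Proof.
rewrite /scaled image_comp; apply/seteqP; split=> _ [x Nx <-]; exists x => //=;
  by rewrite scalerA.
Qed.

Lemma finite_index_scaledM N u u' v : submodule Rt N -> Rt u -> Rt u' ->
  v * u = 1 -> finite_index N (scaled u N) -> finite_index N (scaled u' N) ->
  finite_index N (scaled (u * u') N).
Proof.
move=> sN Ru Ru' vu fu fu'; have sS a := sub_gp (scaled_submodule a sN).
have ga := aut_scale V vu.
have [f _] := aut_index ga (sS u') fu'.
rewrite -/(scaled u (scaled u' N)) -/(scaled u N) scaled_comp in f.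
have [] // := index_mul (sS u) (sS (u * u')) (scaled_sub Ru sN) _ (sub_gp sN) fu f.
by rewrite -scaled_comp => _ [x /(scaled_sub Ru' sN) Nx <-]; exists x.
Qed.

Lemma pi_unit : exists2 v, v * pi = 1 & pi * v = 1.
Proof.
exists (\prod_i wi i); rewrite /pi -big_split /= big1// => i _.
  by rewrite mulrC (sl_unif_inv sl).
exact: sl_unif_inv sl i.
Qed.

Lemma finite_index_pi N k : free_module N -> finite_index N (scaled (pi ^+ k) N).
Proof.
move=> fN; have sN := free_submodule fN.
have f1 : finite_index N (scaled 1 N).
  rewrite (_ : scaled 1 N = N); first exact: (indexid (sub_gp sN)).1.
  by apply/seteqP; split=> [_ [x Nx <-]|x Nx]; [|exists x]; rewrite ?scale1r.
have fpi : finite_index N (scaled pi N).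
  suff : Rt (\prod_(i <- index_enum 'I_b) w i) /\
     finite_index N (scaled (\prod_(i <- index_enum 'I_b) w i) N) by case.
  elim: (index_enum _) => [|i s [Rs IH]]; first by rewrite big_nil.
  rewrite big_cons; have Rw := sl_unif sl i; split; first exact: RM.
  apply: (@finite_index_scaledM _ _ _ (wi i)) => //.
    by rewrite mulrC (sl_unif_inv sl).
  exact: (free_residue_index i fN).1.
have [v vpi _] := pi_unit.
elim: k => [|k IH]; rewrite ?expr0// exprS.
by apply: (@finite_index_scaledM _ _ _ v) => //; exact: RX.
Qed.

Lemma rank_le N P i k : free_module N -> submodule Rt P -> P `<=` N ->
  index N (rank_mod i P N) = (q i ^ k)%N -> (k <= d)%N.
Proof.
move=> fN sP PN; have sN := free_submodule fN.
have sRm := rank_mod_submodule i sP sN; have sS := scaled_submodule (w i) sN.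
have [fi ii] := free_residue_index i fN.
have := index_mulr (sub_gp sN) (sub_gp sRm) (sub_gp sS)
  (@rank_mod_sub i _ _ sN PN) (@rank_mod_subr i _ _ sP) fi.
rewrite ii => dE kE; rewrite kE in dE.
have q1 := residue_card_gt1 i.
rewrite -(leq_exp2l _ _ q1) dE leq_pmulr//.
apply: (index_gt0 (sub_gp sS) (subgroup0 (sub_gp sRm))).
by apply: finite_index_subl fi; exact: rank_mod_sub.
Qed.

(** The radical already lies in [w i N], so its quotient has full rank [d]. *)
Lemma rank_mod_pi i N : submodule Rt N -> rank_mod i (scaled pi N) N = scaled (w i) N.
Proof.
move=> sN; have sS := scaled_submodule (w i) sN.
apply/seteqP; split=> [_ [_ [x Nx <-] [y wy <-]]|].
  apply: (subgroupD (sub_gp sS)) => //.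
  exists ((\prod_(j | j != i) w j) *: x); last by rewrite scalerA /pi [in RHS](bigD1 i).
  apply: smZ => //; apply: (big_ind Rt) => // j _; exact: sl_unif sl j.
exact: rank_mod_subr (scaled_submodule pi sN).
Qed.

(** Nakayama's lemma: supplements only see the top of the module. *)
Lemma supplements_pi N P : submodule Rt N -> submodule Rt P -> P `<=` N ->
  supplements N P = supplements N [set x + y | x in P & y in scaled pi N].
Proof.
move=> sN sP PN; have sS := scaled_submodule pi sN.
apply/seteqP; split=> T [sT TN fNT NTP]; split=> // y Ny.
  have [t Tt Pt] := NTP _ Ny; exists t => //; exists (y - t) => //.
  by exists 0; [case: sS|rewrite addr0].
have [t Tt [p Pp [_ [z Nz <-] yE]]] := NTP _ Ny.
have [k kP] : exists k, forall z, N z -> T (pi ^+ k *: z).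
  by exists (index N T); exact: finite_index_absorb.
have absorb l z' : N z' -> exists t p z, [/\ T t, P p, N z & z' = t + p + pi ^+ l *: z].
  move=> Nz'; elim: l => [|l [t1 [p1 [z1 [Tt1 Pp1 Nz1 ->]]]]].
    exists 0, 0, z'; split=> //; try by [case: sT|case: sP].
    by rewrite !add0r expr0 scale1r.
  have [t2 Tt2 [p2 Pp2 [_ [z2 Nz2 <-] zE]]] := NTP _ Nz1.
  exists (t1 + pi ^+ l *: t2), (p1 + pi ^+ l *: p2), z2; split=> //.
  - by apply: (subgroupD (sub_gp sT)) => //; apply: smZ => //; exact: RX.
  - by apply: (subgroupD (sub_gp sP)) => //; apply: smZ => //; exact: RX.
  - have -> : z1 = p2 + pi *: z2 + t2 by rewrite zE subrK.
    rewrite !scalerDr scalerA -exprSr [in RHS]addrACA -[RHS]addrA; congr (_ + _).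
    by rewrite [LHS]addrC addrA.
have [t' [p' [z' [Tt' Pp' Nz' ->]]]] := absorb k _ Ny.
exists (t' + pi ^+ k *: z'); last by rewrite [t' + p' + _]addrAC [X in P X]addrC addKr.
by apply: (subgroupD (sub_gp sT)) => //; exact: kP.
Qed.

Lemma rank_mod_addpi i N P : submodule Rt N -> submodule Rt P ->
  rank_mod i [set x + y | x in P & y in scaled pi N] N = rank_mod i P N.
Proof.
move=> sN sP; have sS := scaled_submodule (w i) sN.
apply/seteqP; split=> [_ [_ [x Px [y py <-]] [z wz <-]]|_ [x Px [z wz <-]]].
  exists x => //; exists (y + z); last by rewrite addrA.
  apply: (subgroupD (sub_gp sS)) => //; rewrite -(rank_mod_pi i sN).
  by exists y => //; exists 0; [case: sS|rewrite addr0].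
exists x; first by exists x => //; exists 0; [exists 0; [case: sN|rewrite scaler0]|rewrite addr0].
by exists z.
Qed.

Lemma supplements_self N : submodule Rt N ->
  supplements N N = [set T | [/\ submodule Rt T, T `<=` N & finite_index N T]].
Proof.
move=> sN; apply/seteqP; split=> T [sT TN fNT]; split=> // y Ny.
by exists 0; [case: sT|rewrite subr0].
Qed.

Lemma supplements_top N : free_module N -> supplements N (scaled pi N) = [set N].
Proof.
move=> fN; have sN := free_submodule fN; have gN := sub_gp sN.
have s0 : submodule Rt [set 0 : V].
  split=> [//|_ _ -> ->|a _ _ ->]; rewrite ?addr0 ?scaler0//.
apply/seteqP; split=> [T|_ ->]; last first.
  split=> //; first exact: (indexid gN).1.
  by move=> y Ny; exists y => //; exists 0; rewrite ?scaler0 ?subrr//; case: sN.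
have -> : scaled pi N = [set x + y | x in [set 0] & y in scaled pi N].
  apply/seteqP; split=> [y py|_ [_ -> [y py <-]]]; last by rewrite add0r.
  by exists 0 => //; exists y; rewrite ?add0r.
rewrite -supplements_pi//; last by move=> _ ->; case: sN.
move=> [sT TN fNT NTP]; apply/seteqP; split=> // y /NTP[t Tt] /= /eqP.
by rewrite subr_eq0 => /eqP ->.
Qed.

Lemma supplements_image N P T g g' : automorphism g g' -> 
  supplements N P T -> supplements (g @` N) (g @` P) (g @` T).
Proof.
move=> ga [sT TN fNT NTP]; split.
- exact: aut_submodule ga sT.
- exact: image_subset.
- by have [] := aut_index ga (sub_gp sT) fNT.
- move=> _ [y /NTP[t Tt Pt] <-]; exists (g t); first by exists t.
  by exists (y - t) => //; exact: autB ga.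
Qed.

Lemma supplements_aut N P g g' : automorphism g g' ->
  supplements (g @` N) (g @` P) = (fun T => g @` T) @` supplements N P.
Proof.
move=> ga; have ga' := aut_sym ga; apply/seteqP; split=> [T sT|_ [T sT <-]].
  exists (g' @` T); last exact: aut_imageK ga'.
  rewrite -(aut_imageK N ga) -(aut_imageK P ga).
  exact: (supplements_image ga' sT).
exact: (supplements_image ga sT).
Qed.

End Semilocal.

(** * Unordered sums of complex numbers *)

Section UnorderedSums.
Variable F : realType.
Local Notation C := F[i].

Definition has_csum (I : choiceType) (D : set I) (f : I -> C) (l : C) : Prop :=
  partial_sums D f @ totally --> (l : C^o).

Local Instance totally_proper (I : choiceType) : ProperFilter (@totally I) :=
  totally_filter.

(** Restricting to finite subsets of [D] lets reindexings be carried out on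
    finite sets. *)
Lemma has_csumP (I : choiceType) (D : set I) (f : I -> C) l :
  has_csum D f l <-> forall eps : C, 0 < eps ->
    exists2 B0 : {fset I}, [set` B0] `<=` D &
      forall B : {fset I}, (B0 `<=` B)%fset -> [set` B] `<=` D ->
      `|l - \sum_(i <- B) f i| < eps.
Proof.
split=> [/cvgrPdist_lt h eps e0|h].
  have [A _ AP] := h _ e0.
  exists [fset i in A | i \in D]%fset.
    by move=> i /=; rewrite !inE => /andP[_ /set_mem].
  move=> B AB BD; have := AP (B `|` A)%fset (fsubsetUr _ _).
  rewrite /partial_sums big_fset_condE.
  rewrite (_ : [fset i in B `|` A | i \in D]%fset = B)//; apply/fsetP => i.
  rewrite !inE; apply/idP/idP => [/andP[/orP[//|iA] iD]|iB].
    by apply: (fsubsetP AB); rewrite !inE iA.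
  by rewrite iB; apply/mem_set/BD.
apply/cvgrPdist_lt => eps /h[B0 B0D B0P]; exists B0 => // B /= B0B.
rewrite /partial_sums big_fset_condE; apply: B0P.
  apply/fsubsetP => i iB0; rewrite !inE (fsubsetP B0B)//=.
  by apply/mem_set/B0D.
by move=> i /=; rewrite !inE => /andP[_ /set_mem].
Qed.

Section Sums.
Variables (I J : choiceType).
Implicit Types (D : set I) (f g : I -> C).

Lemma has_csum_lim D f l : has_csum D f l -> csum D f = l.
Proof. by move=> h; apply: (@cvg_lim C^o) => //; exact: norm_hausdorff. Qed.

Lemma has_csum_cvg D f l : has_csum D f l -> csummable D f.
Proof. by move=> h; apply: (cvgP (l : C^o)). Qed.

Lemma has_csum_uniq D f l l' : has_csum D f l -> has_csum D f l' -> l = l'.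
Proof. by move=> /has_csum_lim <- /has_csum_lim <-. Qed.

Lemma csummable_has_csum D f : csummable D f -> has_csum D f (csum D f).
Proof. by []. Qed.

Lemma eq_has_csum D f g l : (forall i, D i -> f i = g i) ->
  has_csum D f l -> has_csum D g l.
Proof.
move=> fg; rewrite /has_csum (_ : partial_sums D f = partial_sums D g)//.
by apply/funext => B; apply: eq_bigr => i /set_mem; exact: fg.
Qed.

Lemma partial_sumsU D D' f B : D `&` D' = set0 ->
  partial_sums (D `|` D') f B = partial_sums D f B + partial_sums D' f B.
Proof.
move=> DD'; rewrite /partial_sums.
elim: (enum_fset B) => [|i s IH]; first by rewrite !big_nil addr0.
rewrite !big_cons in_setU IH.
case: (boolP (i \in D)) => [iD|_] /=; last by case: ifP; rewrite // addrCA.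
case: (boolP (i \in D')) => [iD'|_]; last by rewrite addrA.
have : (D `&` D') i by split; apply/set_mem.
by rewrite DD'.
Qed.

Lemma has_csumU D D' f l l' : D `&` D' = set0 ->
  has_csum D f l -> has_csum D' f l' -> has_csum (D `|` D') f (l + l').
Proof.
move=> DD' h h'; rewrite /has_csum.
have -> : partial_sums (D `|` D') f = partial_sums D f \+ partial_sums D' f.
  by apply/funext => B; exact: partial_sumsU.
exact: (cvgD h h').
Qed.

(** A difference of sums inherits convergence: a recursion that expresses a known
    sum through an unknown one needs no separate convergence proof. *)
Lemma has_csum_diff D D' f l l' : D `&` D' = set0 ->
  has_csum (D `|` D') f l -> has_csum D' f l' -> has_csum D f (l - l').
Proof.
move=> DD' h h'; rewrite /has_csum.
have -> : partial_sums D f = partial_sums (D `|` D') f \- partial_sums D' f.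
  by apply/funext => B /=; rewrite partial_sumsU// addrK.
exact: (cvgB h h').
Qed.

Lemma has_csumM D f c l : has_csum D f l -> has_csum D (fun i => c * f i) (c * l).
Proof.
move=> h; rewrite /has_csum.
have -> : partial_sums D (fun i => c * f i) = (fun B => (c : C^o) * partial_sums D f B).
  by apply/funext => B; rewrite /partial_sums mulr_sumr.
exact: (cvgMr h).
Qed.

Lemma has_csum0 f : has_csum set0 f 0.
Proof.
apply/has_csumP => eps e0; exists fset0 => // B _ B0.
rewrite (_ : B = fset0) ?big_seq_fset0 ?subrr ?normr0//.
by apply/fsetP => i; rewrite inE; apply/negP => /B0.
Qed.

Lemma has_csum1 x f : has_csum [set x] f (f x).
Proof.
apply/has_csumP => eps e0; exists [fset x]%fset => [i /=|B xB Bx].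
  by rewrite inE => /eqP.
rewrite (_ : B = [fset x]%fset) ?big_seq_fset1 ?subrr ?normr0//.
apply/eqP; rewrite eqEfsubset xB andbT; apply/fsubsetP => i /Bx /= ->.
by rewrite inE.
Qed.

Lemma has_csum_image D f (h : I -> J) (g : J -> C) l :
  (forall x y, D x -> D y -> h x = h y -> x = y) ->
  (forall x, D x -> g (h x) = f x) ->
  has_csum D f l -> has_csum (h @` D) g l.
Proof.
move=> hI gh /has_csumP fl; apply/has_csumP => eps /fl[B0 B0D B0P].
have [B00|[x0 x0D]] : D = set0 \/ exists x, D x.
- by have [->|/set0P[x Dx]] := eqVneq D set0; [left|right; exists x].
- exists fset0; first by move=> i.
  move=> B _ BD; have -> : B = fset0.
    by apply/fsetP => i; rewrite inE; apply/negP => /BD[x]; rewrite B00.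
  rewrite big_seq_fset0; have := B0P _ (fsubset_refl _) B0D.
  by rewrite (_ : B0 = fset0) ?big_seq_fset0//; apply/fsetP => i; rewrite inE;
    apply/negP => /B0D; rewrite B00.
have /choice[k kP] y : exists x, (h @` D) y -> D x /\ h x = y.
  have [[x Dx xy]|no] := pselect ((h @` D) y); first by exists x.
  by exists x0.
exists [fset h x | x in B0]%fset.
  by move=> y /imfsetP[x /= xB0 ->]; exists x => //; exact: B0D.
move=> B B0B BD.
have kI : {in B &, injective k}.
  by move=> y y' /BD/kP[_ e1] /BD/kP[_ e2] ke; rewrite -e1 -e2 ke.
have := B0P [fset k y | y in B]%fset; rewrite big_imfset//= => le.
rewrite (_ : \sum_(i <- B) g i = \sum_(i <- B) f (k i)); last first.
  by rewrite big_seq [RHS]big_seq; apply: eq_bigr => y /BD/kP[/gh <- ->].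
apply: le => [|x /imfsetP[y /= /BD/kP[? _] ->]//].
apply/fsubsetP => x xB0; apply/imfsetP; exists (h x) => /=.
  by apply: (fsubsetP B0B); apply/imfsetP; exists x.
have Dx := B0D _ xB0; have [Dk hk] : D (k (h x)) /\ h (k (h x)) = h x.
  by apply: kP; exists x.
exact: hI.
Qed.

Lemma has_csum_bigcup (K : choiceType) (s : seq K) (D : K -> set I) f (l : K -> C) :
  uniq s ->
  (forall c c', c \in s -> c' \in s -> D c `&` D c' !=set0 -> c = c') ->
  (forall c, c \in s -> has_csum (D c) f (l c)) ->
  has_csum (\bigcup_(c in [set` s]) D c) f (\sum_(c <- s) l c).
Proof.
elim: s => [|c s IH] /=; first by rewrite big_nil set_nil bigcup_set0 => *; exact: has_csum0.
move=> /andP[cs us] disj h.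
rewrite big_cons (_ : \bigcup_(k in _) D k = D c `|` \bigcup_(k in [set` s]) D k); last first.
  apply/seteqP; split=> [x [k /=]|x [cx|[k /= ks kx]]].
  - by rewrite inE => /orP[/eqP ->|ks kx]; [left|right; exists k].
  - by exists c; rewrite //= inE eqxx.
  - by exists k; rewrite //= inE ks orbT.
apply: has_csumU.
- rewrite -subset0 => x [cx [c' /= c's c'x]].
  suff cc' : c = c' by rewrite cc' c's in cs.
  by apply: disj; rewrite ?inE ?eqxx ?c's ?orbT//; exists x.
- by apply: h; rewrite inE eqxx.
apply: IH => // [c1 c2 c1s c2s|c1 c1s]; last by apply: h; rewrite inE c1s orbT.
by apply: disj; rewrite inE ?c1s ?c2s orbT.
Qed.

End Sums.

Lemma real_bounded_sum (I : choiceType) (D : set I) (g : I -> F) (m : F) :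
  (forall i, 0 <= g i) ->
  (forall B : {fset I}, [set` B] `<=` D -> \sum_(i <- B) g i <= m) ->
  exists s, forall eps : F, 0 < eps -> exists2 B0 : {fset I}, [set` B0] `<=` D &
    forall B : {fset I}, (B0 `<=` B)%fset -> [set` B] `<=` D ->
      `|s - \sum_(i <- B) g i| < eps.
Proof.
move=> g0 gm; pose S := [set r | exists2 B : {fset I}, [set` B] `<=` D & r = \sum_(i <- B) g i].
have supS : has_sup S.
  split; first by exists 0, fset0 => //; rewrite big_seq_fset0.
  by exists m => _ [B BD ->]; exact: gm.
exists (sup S) => eps e0.
have [_ [B0 B0D ->] ltB0] := sup_adherent e0 supS.
exists B0 => // B B0B BD.
have le1 : \sum_(i <- B) g i <= sup S by apply: sup_upper_bound => //; exists B.
have le2 : \sum_(i <- B0) g i <= \sum_(i <- B) g i.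
  rewrite (big_fsetID _ (mem B0) B) /=.
  rewrite (_ : [fset x in B | x \in B0]%fset = B0) ?lerDl ?sumr_ge0//.
  by apply/fsetP => i; rewrite !inE andb_idl// => /(fsubsetP B0B).
rewrite ger0_norm ?subr_ge0//; move: ltB0; lra.
Qed.

Let max0B (a : F) : Num.max a 0 - Num.max (- a) 0 = a.
Proof.
have [a0|/ltW a0] := leP 0 a; first by rewrite max_r ?oppr_le0// subr0.
by rewrite max_l ?oppr_ge0// sub0r opprK.
Qed.

Let quarter (x y u v r : F) : `|x - u| < r / 4 -> `|y - v| < r / 4 ->
  `|x - y - (u - v)| < r / 2.
Proof.
move=> xu yv; rewrite opprD addrACA -opprD; apply: le_lt_trans (ler_normB _ _) _.
by move: `|x - u| `|y - v| xu yv => z t; lra.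
Qed.

(** Positive and negative parts of the real and imaginary parts converge to
    suprema of their finite sums. *)
Lemma bounded_csummable (I : choiceType) (D : set I) (f : I -> C) (m : F) :
  (forall B : {fset I}, [set` B] `<=` D -> \sum_(i <- B) `|f i| <= m%:C%C) ->
  csummable D f.
Proof.
move=> fm.
have part (h : C -> F) : (forall z, 0 <= h z) -> (forall z, (h z)%:C%C <= `|z|) ->
    exists s, forall eps : F, 0 < eps -> exists2 B0 : {fset I}, [set` B0] `<=` D &
    forall B : {fset I}, (B0 `<=` B)%fset -> [set` B] `<=` D ->
      `|s - \sum_(i <- B) h (f i)| < eps.
  move=> h0 hle; apply: (real_bounded_sum (m := m)) => // B BD.
  rewrite -lecR (le_trans _ (fm B BD))// rmorph_sum; apply: ler_sum => i _.
  exact: hle.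
pose h1 (z : C) := Num.max (complex.Re z) 0; pose h2 (z : C) := Num.max (- complex.Re z) 0.
pose h3 (z : C) := Num.max (complex.Im z) 0; pose h4 (z : C) := Num.max (- complex.Im z) 0.
have absRe (z : C) : `|complex.Re z|%:C%C <= `|z| := normc_ge_Re z.
have absIm (z : C) : `|complex.Im z|%:C%C <= `|z|.
  by rewrite normc_def lecR -sqrtr_sqr ler_wsqrtr// lerDr sqr_ge0.
have maxle (a : F) (z : C) : `|a|%:C%C <= `|z| -> (Num.max a 0)%:C%C <= `|z|.
  by move=> az; apply: le_trans az; rewrite lecR ge_max normr_ge0 ler_norm.
have max0 (a : F) : 0 <= Num.max a 0 by rewrite le_max lexx orbT.
have [s1 s1P] := part h1 (fun=> max0 _) (fun z => maxle _ _ (absRe z)).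
have [s2 s2P] := part h2 (fun=> max0 _) (fun z => maxle (- complex.Re z) z
  (eq_ind_r (fun a => a%:C%C <= `|z|) (absRe z) (normrN _))).
have [s3 s3P] := part h3 (fun=> max0 _) (fun z => maxle _ _ (absIm z)).
have [s4 s4P] := part h4 (fun=> max0 _) (fun z => maxle (- complex.Im z) z
  (eq_ind_r (fun a => a%:C%C <= `|z|) (absIm z) (normrN _))).
apply: (@has_csum_cvg _ _ _ (Complex (s1 - s2) (s3 - s4))).
apply/has_csumP => eps; rewrite ltcE => /andP[/eqP /= eI eR].
have e4 : 0 < complex.Re eps / 4 by rewrite divr_gt0.
have [B1 B1D B1P] := s1P _ e4; have [B2 B2D B2P] := s2P _ e4.
have [B3 B3D B3P] := s3P _ e4; have [B4 B4D B4P] := s4P _ e4.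
exists (B1 `|` B2 `|` (B3 `|` B4))%fset => [i /=|B].
  by rewrite !inE => /orP[/orP[]|/orP[]] /=; [exact: B1D|exact: B2D|exact: B3D|exact: B4D].
rewrite !fsubUset => /andP[/andP[/B1P b1 /B2P b2] /andP[/B3P b3 /B4P b4]] BD.
have {}b1 := b1 BD; have {}b2 := b2 BD; have {}b3 := b3 BD; have {}b4 := b4 BD.
have fE i : f i = Complex (h1 (f i) - h2 (f i)) (h3 (f i) - h4 (f i)).
  by rewrite /h1 /h2 /h3 /h4 !max0B; case: (f i).
have -> : \sum_(i <- B) f i = Complex (\sum_(i <- B) h1 (f i) - \sum_(i <- B) h2 (f i))
    (\sum_(i <- B) h3 (f i) - \sum_(i <- B) h4 (f i)).
  rewrite -!sumrB (eq_bigr _ (fun i _ => fE i)).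
  by elim/big_rec3: _ => // i x y z _ ->.
have cle (a b : F) : `|Complex a b| <= (`|a| + `|b|)%:C%C.
  rewrite normc_def lecR /= -[leRHS]ger0_norm ?addr_ge0//.
  rewrite -sqrtr_sqr ler_wsqrtr//.
  rewrite -[a ^+ 2]real_normK ?num_real// -[b ^+ 2]real_normK ?num_real//.
  have := normr_ge0 a; have := normr_ge0 b; nra.
apply: le_lt_trans (cle _ _) _; rewrite ltcE /= eI eqxx /=.
move: (quarter b1 b2) (quarter b3 b4).
by move: `|_ - _| `|_ - _| (complex.Re eps) => u v r; lra.
Qed.

End UnorderedSums.

Section ComplexPowers.
Variable F : realType.
Local Notation C := F[i].
Implicit Types (s : C) (n m : nat).

Lemma cpowM n m s : (0 < n)%N -> (0 < m)%N ->
  cpow (n * m) s = cpow n s * cpow m s.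
Proof.
move=> n0 m0; rewrite /cpow natrM lnM ?posrE ?ltr0n// !mulrDr expRD cosD sinD.
have mulE (a b c d : F) : Complex a b * Complex c d =
  Complex (a * c - b * d) (a * d + b * c) by [].
by rewrite mulE; congr Complex; ring.
Qed.

Lemma cpow1 s : cpow 1 s = 1.
Proof. by rewrite /cpow ln1 !mulr0 expR0 cos0 sin0 mulr1 mulr0. Qed.

Lemma norm_cpow n s : `|cpow n s| = (expR (complex.Re s * ln (n%:R : F)))%:C%C.
Proof.
rewrite normc_def /cpow /= !exprMn -mulrDr cos2Dsin2 mulr1.
by rewrite sqrtr_sqr ger0_norm// expR_ge0.
Qed.

End ComplexPowers.

(** * Sums over supplements *)

Lemma ler_sum_fsubset (F : numDomainType) (I : choiceType) (B B' : {fset I}) (h : I -> F) :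
  (B `<=` B')%fset -> (forall x, x \in B' -> 0 <= h x) ->
  \sum_(x <- B) h x <= \sum_(x <- B') h x.
Proof.
move=> BB' h0; rewrite [leRHS](big_fsetID _ (mem B)) /=.
rewrite (_ : [fset x in B' | x \in B]%fset = B); last first.
  by apply/fsetP => i; rewrite !inE andb_idl// => /(fsubsetP BB').
rewrite lerDl big_seq; apply: sumr_ge0 => i.
by rewrite !inE => /andP[/h0].
Qed.

Lemma ler_sum_cover (F : numDomainType) (I : choiceType) (J : finType) (S : {fset I})
    (G : J -> {fset I}) (h : I -> F) : (forall x, 0 <= h x) ->
  (forall x, x \in S -> exists c, x \in G c) ->
  \sum_(x <- S) h x <= \sum_c \sum_(x <- G c) h x.
Proof.
move=> h0 SG.
apply: (@le_trans _ _ (\sum_c \sum_(x <- S | x \in G c) h x)).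
  rewrite (exchange_big_dep xpredT)//= big_seq [leRHS]big_seq.
  apply: ler_sum => x /SG[c xc].
  by rewrite (bigD1 c)//= lerDl sumr_ge0.
apply: ler_sum => c _; rewrite big_fset_condE; apply: ler_sum_fsubset => //.
by apply/fsubsetP => x; rewrite !inE => /andP[].
Qed.

Lemma prod_rank_succ (K : comPzRingType) (b : nat) (G : 'I_b -> nat -> K)
    (rho : 'I_b -> nat) i :
  \prod_j \prod_(l < rho j + (j == i)) G j l =
  G i (rho i) * \prod_j \prod_(l < rho j) G j l.
Proof.
rewrite (bigD1 i)//= [in RHS](bigD1 i)//= eqxx addn1 big_ord_recr /= mulrA.
rewrite [G i _ * _]mulrC; congr (_ * _); apply: eq_bigr => j /negPf ->.
by rewrite addn0.
Qed.

Section LocalSums.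
Variables (A : comPzRingType) (b : nat) (Rt : set A) (e w wi : 'I_b -> A).
Hypothesis sl : semilocal Rt e w wi.
Variable d : nat.
Local Notation V := 'rV[A]_d.
Implicit Types (N P T : set V).
Local Notation pi := (\prod_i w i).
Local Notation q i := (index Rt [set w i * t | t in Rt]).
Local Notation supp := (@supplements A Rt d).
Local Notation std := (@std_lattice A Rt d).

Let sub_gp N : submodule Rt N -> subgroup N.
Proof. exact: submodule_subgroup (sl_subring sl). Qed.

Let RpiX k : Rt (pi ^+ k).
Proof.
have [R1 _ RM] := sl_subring sl; elim: k => [|k IH]; rewrite ?expr0// exprS.
apply: (RM) => //; apply: (big_ind Rt) => [//|x y|i _]; first exact: RM.
exact: sl_unif sl i.
Qed.

Let pi_sub N : submodule Rt N -> scaled pi N `<=` N.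
Proof. by move=> sN; have := RpiX 1; rewrite expr1 => Rpi; exact: (scaled_sub Rpi sN). Qed.

Lemma simple_step_parametrization N P x i k : free_module Rt N ->
  simple_step Rt e w N P x i -> finite_index N P ->
  index N (rank_mod w i (adjoin Rt P x) N) = (q i ^ k)%N ->
  exists f : {ffun 'I_k -> 'I_(q i)} -> set V, injective f /\
    forall T, complements Rt N P x T <-> exists c, f c = T.
Proof.
move=> fN st fNP kE; have sN := free_submodule sl fN.
have [[sP PN _ Nx _] _] := st.
have sP1 := adjoin_submodule sl x sP.
have sR1 := rank_mod_submodule w i sP1 sN.
have P1N : adjoin Rt P x `<=` N by exact: (adjoin_sub sl).
have wR : scaled (w i) N `<=` rank_mod w i (adjoin Rt P x) N.
  by move=> y Sy; exact: (rank_mod_subr sP1 Sy).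
have RN : rank_mod w i (adjoin Rt P x) N `<=` N by exact: (rank_mod_sub sl).
have [|k' [v vb]] := residue_basis_exists sl sN sR1 wR RN.
  apply: (finite_index_subr (sub_gp sP) (sub_gp sR1)) fNP.
  move=> y Py; apply: (rank_mod_subl _ _ sN); exact: (sub_adjoin sl).
have [_] := residue_basis_index sl sN sR1 wR vb.
rewrite kE => /eqP; rewrite eqn_exp2l ?(residue_card_gt1 sl)// => /eqP kk'.
move: v vb; rewrite -kk' => v vb.
exact: (complements_param sl fN st vb).
Qed.

Section RealBound.
Variables (F : realFieldType) (a : nat -> F).
Hypotheses (a0 : forall n, 0 <= a n) (a1 : a 1 = 1)
  (aM : forall m n, (0 < m)%N -> (0 < n)%N -> a (m * n) = a m * a n)
  (aq : forall i j, (j < d)%N -> (q i)%:R ^+ j * a (q i) < 1).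

(** Convergence comes from the recursion itself: restricted to the finitely many
    submodules above a power of the radical, it becomes an inequality of finite
    sums, uniform in the truncation. *)
Section Truncation.
Variables (N : set V) (k : nat).
Hypothesis fN : free_module Rt N.
Let sN : submodule Rt N. Proof. exact: (free_submodule sl). Qed.
Let X := scaled (pi ^+ k) N.

Let trunc P : set (set V) := [set T | supp N P T /\ X `<=` T].

Let trunc_finite P : finite_set (trunc P).
Proof.
have sX : submodule Rt X by exact: scaled_submodule.
apply: sub_finite_set (finite_set_between (sub_gp sX) (finite_index_pi sl k fN)).
by move=> T [[sT TN _ _] XT]; split=> //; exact: sub_gp.
Qed.

Let S P := \sum_(T <- fset_set (trunc P)) a (index N T).

(** Each complement [T'] is the image of [N] under an automorphism that maps
    [P + Rt x] onto [P], and thus pulls the supplements of [P] in [T'] back to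
    supplements of [P + Rt x] in [N]. The truncation only gets coarser, because
    [pi ^+ k T'] lies in [pi ^+ k N]. *)
Lemma truncated_step P x i r : simple_step Rt e w N P x i -> finite_index N P ->
  index N (rank_mod w i (adjoin Rt P x) N) = (q i ^ r)%N ->
  (1 - (q i)%:R ^+ r * a (q i)) * S (adjoin Rt P x) <= S P.
Proof.
move=> st fNP rE; set P1 := adjoin Rt P x.
have [f [_ fP]] := simple_step_parametrization fN st fNP rE.
have /choice[g gP] c : exists g : V -> V, exists g', [/\ automorphism g g', g @` N = f c
    & g @` P1 = P].
  by apply: (complement_automorphism sl fN st); apply/fP; exists c.
pose U := fset_set (trunc P1).
have UP T : T \in U <-> trunc P1 T by rewrite in_fset_set//; split=> [/set_mem|/mem_set].
suff : S P1 <= S P + (q i)%:R ^+ r * a (q i) * S P1 by lra.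
have split1 : S P1 <= S P + \sum_(T <- [fset T in U | T \notin fset_set (trunc P)]%fset) a (index N T).
  rewrite /S -/U (big_fsetID _ (mem (fset_set (trunc P))) U) /= lerD2r.
  apply: ler_sum_fsubset => //; apply/fsubsetP => T; rewrite !inE => /andP[_].
  by rewrite in_fset_set.
apply: le_trans split1 _; rewrite lerD2l.
pose img c (T : set V) : set V := g c @` T.
have cover T : T \in [fset T in U | T \notin fset_set (trunc P)]%fset ->
    exists c, T \in [fset img c T0 | T0 in U]%fset.
  rewrite !inE => /andP[/UP[sT XT] /negP nT].
  have [nsT|[_ /fP[c <-] sT']] := supplement_step sl fN st sT.
    by case: nT; rewrite in_fset_set//; apply/mem_set.
  have [g' [ga gN gP1]] := gP c; exists c.
  have : supp (g c @` N) (g c @` P1) T by rewrite gN gP1.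
  rewrite (supplements_aut sl _ _ ga) => -[T0 sT0 T0E].
  apply/imfsetP; exists T0 => //=; apply/UP; split=> // y Xy.
  have [_ gK _] := ga; have Ty : T (g c y).
    apply: XT; have : X (g c y) -> X (g c y) by [].
    have [z Nz <-] := Xy; rewrite (autZ _ _ ga) => _.
    exists (g c z) => //; have [_ _ fN' _ _] := (fP (f c)).2 (ex_intro _ c erefl).
    by apply: fN'; rewrite -gN; exists z.
  by move: Ty; rewrite -T0E => -[z T0z /(aut_inj ga) <-].
apply: le_trans (ler_sum_cover (fun T => a0 (index N T)) cover) _.
have inner c : \sum_(T <- [fset img c T0 | T0 in U]%fset) a (index N T) =
    a (q i) * S P1.
  have [g' [ga gN gP1]] := gP c.
  rewrite big_imfset /=; last first.
    by move=> T T' _ _ e1; rewrite -(aut_imageK T ga) -/(img c T) e1 (aut_imageK T' ga).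
  rewrite /S mulr_sumr big_seq [RHS]big_seq; apply: eq_bigr => T /UP[sT XT].
  have [smT TN fNT _] := sT; have gT := sub_gp smT.
  have Cc : complements Rt N P x (f c) by apply/fP; exists c.
  have [fNc iNc] := complement_index sl fN st Cc.
  have [sc _ fcN _ _] := Cc.
  have [fgT igT] := aut_index ga gT fNT; rewrite gN in fgT igT.
  have sgT := aut_submodule ga smT.
  have [|_ ->] := index_mul (sub_gp sc) (sub_gp sgT) fcN _ (sub_gp sN) fNc fgT.
    by rewrite -gN; exact: image_subset.
  rewrite iNc igT aM//; first exact: ltnW (residue_card_gt1 sl i).
  by apply: (index_gt0 gT) => //; exact: subgroup0 (sub_gp sN).
rewrite (eq_bigr _ (fun c _ => inner c)) sumr_const card_ffun !card_ord.
by rewrite -[leLHS]mulr_natl natrX mulrA.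
Qed.

(** Descend by simple steps from [N] to its radical, whose only supplement is
    [N]. *)
Lemma truncated_bound :
  (\prod_i \prod_(j < d) (1 - (q i)%:R ^+ j * a (q i))) * S N <= 1.
Proof.
have sS := scaled_submodule pi sN.
have piN := pi_sub sN.
have fpi : finite_index N (scaled pi N) by exact: (finite_index_pi sl 1 fN).
rewrite [X in _ <= X](_ : 1 = S (scaled pi N)); last first.
  rewrite /S (_ : trunc (scaled pi N) = [set N]).
    by rewrite fset_set1 big_seq_fset1 (indexid (sub_gp sN)).2 a1.
  apply/seteqP; split=> T; rewrite /trunc /= (supplements_top sl fN); first by case.
  by move=> ->; split=> //; exact: (scaled_sub (RpiX k) sN).
pose Q P (rho : 'I_b -> nat) : Prop :=
  (\prod_i \prod_(j < rho i) (1 - (q i)%:R ^+ j * a (q i))) * S N <= S P.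
suff : Q (scaled pi N) (fun=> d) by [].
apply: (simple_step_ind sl (Q := Q) fN) => //; rewrite /Q.
- by rewrite big1 ?mul1r// => i _; rewrite big_ord0.
- move=> P x i rho st fNP rhoP IH.
  have [[sP PN _ _ _] _] := st.
  rewrite (prod_rank_succ (fun i j => 1 - (q i)%:R ^+ j * a (q i))) -mulrA.
  apply: le_trans (truncated_step st fNP (rhoP i)); apply: ler_wpM2l => //.
  rewrite subr_ge0 ltW// aq//.
  apply: (rank_le sl fN sP PN (i := i)).
  by rewrite (rank_step_index sl fN st fNP) rhoP -expnSr.
- move=> i; rewrite (rank_mod_pi sl i sN).
  by have [] := free_residue_index sl i fN.
Qed.

End Truncation.

Lemma supplements_bound N (B : {fset set V}) : free_module Rt N ->
  [set` B] `<=` supp N N ->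
  (\prod_i \prod_(j < d) (1 - (q i)%:R ^+ j * a (q i))) *
    (\sum_(T <- B) a (index N T)) <= 1.
Proof.
move=> fN BN; have sN := free_submodule sl fN.
pose k := (\max_(T <- B) index N T)%N.
apply: le_trans (truncated_bound k fN); apply: ler_wpM2l.
  apply: prodr_ge0 => i _; apply: prodr_ge0 => j _.
  by rewrite subr_ge0 ltW// aq.
apply: ler_sum_fsubset => //; apply/fsubsetP => T TB.
have sT := BN _ TB; have [smT TN fNT _] := sT.
rewrite in_fset_set.
  apply/mem_set; split=> // _ [x Nx <-].
  have le : (index N T <= k)%N by exact: leq_bigmax_seq.
  rewrite -(subnK le) exprD -scalerA.
  by case: (smT) => _ _; apply; [exact: RpiX|exact: (finite_index_absorb sl sN smT fNT Nx)].
have sX := scaled_submodule (pi ^+ k) sN.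
apply: sub_finite_set (finite_set_between (sub_gp sX) (finite_index_pi sl k fN)).
by move=> T' [[sT' T'N _ _] XT']; split=> //; exact: sub_gp.
Qed.

End RealBound.

Section ComplexSum.
Variables (F : realType) (alpha : nat -> F[i]) (zeta0 : F[i]).
Hypotheses (alpha1 : alpha 1 = 1)
  (alphaM : forall m n, (0 < m)%N -> (0 < n)%N -> alpha (m * n) = alpha m * alpha n).
Local Notation weight N := (fun T => alpha (index N T)).
Hypothesis sum_std : has_csum (supp std std)
  (weight std) zeta0.

(** Automorphisms multiply all indices in [N] by the same constant. *)
Lemma has_csum_aut N P M l g g' : submodule Rt N -> automorphism g g' ->
  g @` N = M -> has_csum (supp N P) (weight N) l ->
  has_csum (supp M (g @` P)) (weight M) l.
Proof.
move=> sN ga <-; rewrite (supplements_aut sl _ _ ga).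
apply: has_csum_image => [T T' _ _ e1|T [sT TN fNT _]].
  by rewrite -(aut_imageK T ga) e1 (aut_imageK T' ga).
by have [_ ->] := aut_index ga (sub_gp sT) fNT.
Qed.

Lemma has_csum_free N : free_module Rt N -> has_csum (supp N N) (weight N) zeta0.
Proof.
move=> [g [g' [ga NE]]]; rewrite {2}NE.
exact: (has_csum_aut (std_submodule sl d) ga (esym NE) sum_std).
Qed.

(** One simple step multiplies the sum by [1 - alpha (q i) * q i ^+ rho i]: the
    supplements lost are those inside one of the [q i ^ rho i] complements, and
    each complement contributes [alpha (q i)] times the sum before the step. *)
Lemma has_csum_supplements_elementary N P rho : free_module Rt N -> submodule Rt P ->
  P `<=` N -> scaled pi N `<=` P -> finite_index N P ->
  (forall j, index N (rank_mod w j P N) = (q j ^ rho j)%N) ->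
  has_csum (supp N P) (weight N)
    ((\prod_i qpoch (alpha (q i)) (q i)%:R (rho i)) * zeta0).
Proof.
move=> fN; have sN := free_submodule sl fN.
apply: (simple_step_ind sl (Q := fun P rho => has_csum (supp N P) (weight N)
    ((\prod_i qpoch (alpha (q i)) (q i)%:R (rho i)) * zeta0)) fN).
  rewrite big1 ?mul1r => [|i _]; last by rewrite /qpoch big_ord0.
  exact: has_csum_free.
move=> {}P x i {}rho st fNP rhoP; set P1 := adjoin Rt P x.
rewrite /qpoch (prod_rank_succ (fun i j => 1 - alpha (q i) * (q i)%:R ^+ j)).
set l1 := \prod_j _; rewrite -mulrA; set l := l1 * zeta0 => h1.
have [f [finj fP]] := simple_step_parametrization fN st fNP (rhoP i).
have Cf c : complements Rt N P x (f c) by apply/fP; exists c.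
have hc c : has_csum (supp (f c) P) (weight N) (alpha (q i) * l).
  have [g [g' [ga gN gP1]]] := complement_automorphism sl fN st (Cf c).
  have [fNc iNc] := complement_index sl fN st (Cf c).
  have [sc _ fcN _ _] := Cf c.
  have := has_csum_aut sN ga gN h1; rewrite gP1 => h2.
  have h3 := has_csumM (c := alpha (q i)) h2.
  apply: eq_has_csum h3 => T [sT Tf ffT _].
  have [_ ->] := index_mul (sub_gp sc) (sub_gp sT) fcN Tf (sub_gp sN) fNc ffT.
  rewrite iNc alphaM//; first exact: ltnW (residue_card_gt1 sl i).
  by apply: (index_gt0 (sub_gp sT)) => //; exact: subgroup0 (sub_gp sc).
have disj c c' : c \in enum {: {ffun 'I_(rho i) -> 'I_(q i)}} ->
    c' \in enum {: {ffun 'I_(rho i) -> 'I_(q i)}} ->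
    supp (f c) P `&` supp (f c') P !=set0 -> c = c'.
  move=> _ _ [T [sT sT']]; apply: finj.
  have [_ _ ->] := complement_supplements sl fN st (Cf c) sT.
  by have [_ _ <-] := complement_supplements sl fN st (Cf c') sT'.
have hU := has_csum_bigcup (enum_uniq _) disj (fun c _ => hc c).
set U := \bigcup_(c in _) _ in hU.
have PU : supp N P `&` U = set0.
  rewrite -subset0 => T [sT [c _ sTc]].
  by have [_ /(_ sT)] := complement_supplements sl fN st (Cf c) sTc.
have E : supp N P `|` U = supp N P1.
  apply/seteqP; split=> [T [|[c _ sT]]|T sT]; first exact: (supplements_sub sl).
    by have [] := complement_supplements sl fN st (Cf c) sT.
  have [?|[_ /fP[c <-] ?]] := supplement_step sl fN st sT; first by left.
  by right; exists c => //=; rewrite mem_enum.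
rewrite -E in h1; have := has_csum_diff PU h1 hU.
congr has_csum; rewrite big_enum /= sumr_const card_ffun !card_ord -[_ *+ (_ ^ _)]mulr_natl natrX.
by ring.
Qed.

Lemma has_csum_supplements N P rho : free_module Rt N -> submodule Rt P ->
  P `<=` N -> (forall j, index N (rank_mod w j P N) = (q j ^ rho j)%N) ->
  has_csum (supp N P) (weight N)
    ((\prod_i qpoch (alpha (q i)) (q i)%:R (rho i)) * zeta0).
Proof.
move=> fN sP PN rhoP; have sN := free_submodule sl fN.
have sS := scaled_submodule pi sN; have gS := sub_gp sS.
rewrite (supplements_pi sl sN sP PN); set P' := [set x + y | x in _ & y in _].
have fpi : finite_index N (scaled pi N) by exact: (finite_index_pi sl 1 fN).
have piN := pi_sub sN.
have sP' : submodule Rt P' by exact: submodule_add.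
have piP' : scaled pi N `<=` P'.
  by move=> y Sy; exists 0; [case: sP|exists y; rewrite ?add0r].
apply: has_csum_supplements_elementary => //.
- move=> _ [x Px [y Sy <-]]; apply: (subgroupD (sub_gp sN)); [exact: PN|exact: piN].
- exact: finite_index_subr gS (sub_gp sP') piP' fpi.
- by move=> j; rewrite (rank_mod_addpi sl j sN sP).
Qed.

(** The only supplement of [pi N] is [N]: this evaluates the zeta function. *)
Lemma zeta_euler_product :
  (\prod_i qpoch (alpha (q i)) (q i)%:R d) * zeta0 = 1.
Proof.
have fS : free_module Rt std.
  by exists id, id; rewrite image_id; split=> //; exact: aut_id.
have sS := std_submodule sl d; have sp := scaled_submodule pi sS.
have := @has_csum_supplements_elementary _ (scaled pi std) (fun=> d) fS sp.
rewrite (supplements_top sl fS) => h.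
have {}h : has_csum [set std] (weight std) 
   ((\prod_i qpoch (alpha (q i)) (q i)%:R d) * zeta0).
  apply: h => //; last by move=> j; rewrite (rank_mod_pi sl j sS);
    have [] := free_residue_index sl j fS.
    exact: pi_sub.
  exact: (finite_index_pi sl 1 fS).
rewrite (has_csum_uniq h (@has_csum1 F _ _ _)) (indexid (sub_gp sS)).2//.
Qed.

End ComplexSum.
End LocalSums.

(** * Lattices over an arithmetic local order *)

Section OrderLattices.
Variables (R : comNzRingType) (b : nat) (K : 'I_b -> fieldType).
Variable iota : forall i, {rmorphism R -> K i}.
Hypothesis alo : arithmetic_local_order iota.
Local Notation A := (total_ring K).
Local Notation R0 := (base_ring iota).
Local Notation Rt := (normalization iota).
Local Notation "c %:A" := (embed iota c) : ring_scope.

(** [norm_max] and [residue_card] are the ideals and indices attached to the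
    elements [w i] of the semilocal structure. *)
Lemma normalization_semilocal : exists e w wi : 'I_b -> A,
  [/\ semilocal Rt e w wi,
      forall i, norm_max iota i = [set w i * t | t in Rt]
    & forall i, index Rt [set w i * t | t in Rt] = residue_card iota i].
Proof.
have [_ _ [_ pE]] := regular_topologically_nilpotent alo.
pose p i : K i := s2val (cid2 (pE i)).
have p0 i : p i != 0 by rewrite /p; case: cid2.
have pP i : branch iota i (p i) /\ forall x, branch_max iota i x <->
    principal (branch iota i) (p i) x by rewrite /p; case: cid2.
have Op i : branch iota i (p i) by case: (pP i).
have mP i x : branch_max iota i x <-> principal (branch iota i) (p i) x.
  by case: (pP i).
pose e i : A := on_branch (1 : K i).
pose w i : A := (1 - e i) + on_branch (p i).
pose wi i : A := (1 - e i) + on_branch (p i)^-1.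
have eE i : e i i = 1 by exact: on_branchE.
have eN i j : j != i -> e i j = 0 by exact: on_branch_neq.
have wE i : w i i = p i by rewrite -[LHS]/(1 - e i i + on_branch (p i) i) eE subrr add0r on_branchE.
have wN i j : j != i -> w i j = 1.
  by move=> ji; rewrite -[LHS]/(1 - e i j + on_branch (p i) j) eN// on_branch_neq// subr0 addr0.
have wiE i : wi i i = (p i)^-1.
  by rewrite -[LHS]/(1 - e i i + on_branch (p i)^-1 i) eE subrr add0r on_branchE.
have wiN i j : j != i -> wi i j = 1.
  by move=> ji; rewrite -[LHS]/(1 - e i j + on_branch (p i)^-1 j) eN// on_branch_neq// subr0 addr0.
have O1 i : branch iota i 1 by case: (branch_subring iota i).
have O0 i : branch iota i 0 by have [_ /subgroup0] := branch_subring iota i.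
have OM i x y : branch iota i x -> branch iota i y -> branch iota i (x * y).
  by have [_ _] := branch_subring iota i; apply.
have OB i x y : branch iota i x -> branch iota i y -> branch iota i (x - y).
  by have [_ gO _] := branch_subring iota i; exact: subgroupB.
have nm i : norm_max iota i = [set w i * t | t in Rt].
  apply/seteqP; split=> [x [Rx /mP[y Oy yE]]|_ [t Rt' <-]].
    exists (fun j => wi i j * x j).
      move=> j; have [->|ji] := eqVneq j i; last by rewrite wiN// mul1r.
      by rewrite wiE -yE mulKf.
    apply: total_eqP => j; rewrite -[LHS]/(w i j * (wi i j * x j)).
    have [->|ji] := eqVneq j i; last by rewrite wN// wiN// !mul1r.
    by rewrite wE wiE mulVKf.
  split=> [j|]; last by apply/mP; exists (t i) => //; rewrite -[RHS]/(w i i * t i) wE.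
  rewrite -[X in branch iota j X]/(w i j * t j); apply: OM => //.
  by have [->|ji] := eqVneq j i; rewrite ?wE// wN.
have max1 i : ~ branch_max iota i 1.
  by move=> [_]; apply; rewrite invr1 oner_neq0.
have gmax i : subgroup (branch_max iota i).
  split; first by apply/mP; exists 0; rewrite ?mulr0.
  move=> x y /mP[s Os <-] /mP[t Ot <-]; apply/mP; exists (s - t); first exact: OB.
  exact: mulrBr.
have notmax i x : branch iota i x -> ~ branch_max iota i x ->
    x != 0 /\ branch iota i x^-1.
  by move=> Ox nx; apply: contrapT => h; apply: nx.
have card i : finite_index Rt [set w i * t | t in Rt] /\
    index Rt [set w i * t | t in Rt] = residue_card iota i.
  have fm : finite_index (branch iota i) (branch_max iota i).
    rewrite (_ : branch_max iota i = principal (branch iota i) (p i)).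
      exact: (finite_index_branch alo).
    by apply/seteqP; split=> x /mP.
  have [r [rO rP rI]] := finite_index_transversal (gmax i) fm.
  rewrite -[residue_card iota i]card_ord.
  apply: (@transversal_index _ _ _ _ (fun k => on_branch (r k) : A)).
    rewrite -nm; split.
      by split; [move=> j; exact: O0|exact: subgroup0].
    move=> x y [Rx xm] [Ry ym]; split; first by move=> j; exact: OB.
    exact: (subgroupB (gmax i) xm ym).
  rewrite -nm; split=> [k|x Rx|k k' [_]]; first exact: norm_on_branch.
    have [k xk] := rP _ (Rx i); exists k; split.
      by move=> j; apply: OB => //; exact: norm_on_branch.
    by rewrite -[X in branch_max iota i X]/(x i - on_branch (r k) i) on_branchE.
  rewrite -[X in branch_max iota i X]/(on_branch (r k) i - on_branch (r k') i).
  by rewrite !on_branchE; exact: rI.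
exists e, w, wi; split=> // [|i]; last by case: (card i).
split.
- exact: norm_subring.
- by move=> i; exact: norm_on_branch.
- by move=> i j; have [->|ji] := eqVneq j i; rewrite ?wE// wN.
- move=> i; apply: total_eqP => j; rewrite -[LHS]/(w i j * wi i j).
  by have [->|ji] := eqVneq j i; rewrite ?wE ?wiE ?mulfV// wN// wiN// mulr1.
- move=> i; apply: total_eqP => j; rewrite -[LHS]/(e i j * e i j).
  by have [->|ji] := eqVneq j i; rewrite ?eE ?mulr1// eN// mulr0.
- move=> i; apply: total_eqP => j; rewrite -[LHS]/(w i j * (1 - e i j)) -[RHS]/(1 - e i j).
  by have [->|ji] := eqVneq j i; rewrite ?eE ?subrr ?mulr0// wN// mul1r.
- move=> i j ji; apply: total_eqP => k; rewrite -[LHS]/(e i k * w j k).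
  have [->|ki] := eqVneq k i; last by rewrite eN// mul0r.
  by rewrite wN ?mulr1// eq_sym.
- move=> i a Ra; rewrite -nm => na; have [||ai0 Oai] := notmax i (a i) => //.
    by move=> am; apply: na.
  exists (on_branch (a i)^-1); first exact: norm_on_branch.
  apply: total_eqP => j; rewrite -[LHS]/(on_branch (a i)^-1 j * a j).
  have [->|ji] := eqVneq j i; first by rewrite on_branchE mulVf// eE.
  by rewrite on_branch_neq// mul0r eN.
- by move=> i; rewrite -nm => -[_ /max1].
- by move=> i; case: (card i).
- move=> a Ra.
  have piE j : (\prod_i w i) j = p j.
    rewrite (bigD1 j)//= -[LHS]/(w j j * (\prod_(i | i != j) w i) j) wE.
    suff -> : (\prod_(i | i != j) w i) j = 1 by rewrite mulr1.
    elim/big_ind: _ => [//|x y x1 y1|i ij]; last by rewrite wN// eq_sym.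
    by rewrite -[LHS]/(x j * y j) x1 y1 mulr1.
  have uP j : 1 - p j * a j != 0 /\ branch iota j (1 - p j * a j)^-1.
    apply: notmax => [|h]; first by apply: OB => //; exact: OM.
    have pm : branch_max iota j (p j * a j) by apply/mP; exists (a j).
    by apply: (@max1 j); rewrite -(subrK (p j * a j) 1);
      exact: (subgroupD (gmax j) h pm).
  exists (fun j => (1 - p j * a j)^-1); first by move=> j; case: (uP j).
  apply: total_eqP => j; rewrite -[LHS]/(_ * (1 - (\prod_i w i) j * a j)) piE.
  by rewrite mulVf//; case: (uP j).
Qed.

Variable d : nat.
Local Notation V := 'rV[A]_d.
Implicit Types (L M N T : set V).

(** The sets of scalars between the order and its normalization that serve as
    coefficients of lattices. *)
Definition lattice_coefficients (S : set A) :=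
  [/\ subring S, R0 `<=` S & forall c, regular iota c ->
      finite_index S [set c%:A * t | t in S]].

Lemma coefficients_base : lattice_coefficients R0.
Proof.
by split; [exact: base_subring|by []|exact: finite_index_base_regular].
Qed.

Lemma coefficients_norm : lattice_coefficients Rt.
Proof.
by split; [exact: norm_subring|exact: base_norm|exact: finite_index_norm_regular].
Qed.

(** Each generator is a combination of vectors of [N] with coefficients in the
    total ring, and finitely many such coefficients have a common denominator. *)
Lemma clear_denominators (S : set A) N n (v : 'I_n -> V) :
  lattice_coefficients S -> submodule S N -> lspan setT N = setT ->
  exists2 c, regular iota c & forall x, lspan S (range v) x -> N (c%:A *: x).
Proof.
move=> [sS RS _] sN spanN; have [_ gS SM] := sS; have gN := submodule_subgroup sS sN.
have [N0 ND NZ] := sN.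
have one x : exists2 c, regular iota c & N (c%:A *: x).
  have : lspan setT N x by rewrite spanN.
  move=> [k [a [y [_ Ny ->]]]]; have [c cP ca] := common_denominator alo a.
  exists c => //; rewrite scaler_sumr; elim/big_ind: _ => // j _.
  by rewrite scalerA; apply: NZ => //; exact: RS.
have [c cP cv] : exists2 c, regular iota c & forall k, N (c%:A *: v k).
  elim: n v => [|n IH] v; first by exists 1 => [i|[]//]; rewrite rmorph1 oner_neq0.
  have [c cP cv] := IH (fun k => v (lift ord0 k)); have [c' cP' cv'] := one (v ord0).
  exists (c * c') => [|k]; first exact: regularM.
  have [k' ->|->] := unliftP ord0 k.
    by rewrite mulrC embedM -scalerA; apply: NZ => //; apply: RS; exact: base_embed.
  by rewrite embedM -scalerA; apply: NZ => //; apply: RS; exact: base_embed.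
exists c => // x /lspan_rangeP -/(_ gS)[a Sa ->].
rewrite scaler_sumr; elim/big_ind: _ => // j _.
by rewrite scalerA mulrC -scalerA; exact: NZ.
Qed.

Lemma finite_index_scaled (S : set A) n (v : 'I_n -> V) c :
  lattice_coefficients S -> regular iota c ->
  finite_index (lspan S (range v)) (scaled c%:A (lspan S (range v))).
Proof.
move=> [sS RS fS] cP; have [S1 gS SM] := sS.
have gc : subgroup [set c%:A * t | t in S] by exact: principal_subgroup.
apply: (finite_index_span gS gc (fS _ cP)).
  by apply: (submodule_subgroup sS); apply: scaled_submodule; exact: lspan_submodule.
move=> _ j [t St <-]; exists (t *: v j); last by rewrite scalerA.
have [_ _ LZ] := lspan_submodule (range v) SM.
by apply: LZ => //; apply: sub_lspan => //; exists j.
Qed.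

(** A lattice has finite index in every finitely generated module above it. *)
Lemma lattice_finite_index (S : set A) M N : lattice_coefficients S ->
  submodule S M -> fin_gen S M -> submodule S N -> lspan setT N = setT ->
  N `<=` M -> finite_index M N.
Proof.
move=> cS sM [n [v ME]] sN spanN NM; have [sS _ _] := cS.
have [c cP cM] := @clear_denominators S N n v cS sN spanN.
have fc := finite_index_scaled v cS cP.
rewrite -ME in fc cM.
apply: (finite_index_subr _ (submodule_subgroup sS sN) _ fc).
  by apply: (submodule_subgroup sS); exact: scaled_submodule.
by move=> _ [x /cM Nx <-].
Qed.

Lemma span_setT_sub L N : L `<=` lspan setT N -> lspan setT L = setT ->
  lspan setT N = setT.
Proof.
move=> LN spanL; apply/seteqP; split=> // x _.
have : lspan setT L x by rewrite spanL.
by apply: lspan_sub => //; exact: lspan_submodule.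
Qed.

Lemma lattice_scaled_span c N : regular iota c -> lspan setT N = setT ->
  lspan setT (scaled c%:A N) = setT.
Proof.
move=> cP; apply: span_setT_sub => x Nx.
have [u uc _] := regular_unit cP.
rewrite -[x]scale1r -uc -scalerA.
have [_ _ LZ] := lspan_submodule (S := setT) (scaled c%:A N) (fun _ _ _ _ => I).
by apply: LZ => //; apply: sub_lspan => //; exists x.
Qed.

(** Finite-index [R]-submodules of a lattice are lattices: they absorb a power
    of a regular element of the maximal ideal. *)
Lemma finite_index_lattice M L : lattice R0 M -> submodule R0 L -> L `<=` M ->
  finite_index M L -> lattice R0 L.
Proof.
move=> [sM [n [v ME]] spanM] sL LM fL; have sR := base_subring iota.
have [R1 gR RM] := sR; have gL := submodule_subgroup sR sL.
have [c cP [cu _]] := regular_topologically_nilpotent alo.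
have [_ _ MZ] := sM; have [_ LD LZ] := sL.
pose C := (c ^+ index M L)%:A.
have CL x : M x -> L (C *: x).
  move=> Mx.
  have [|i [j [ij jk Lij]]] := finite_index_pigeonhole
      (u := fun k => (c ^+ k)%:A *: x) gL fL.
    by move=> k; apply: MZ => //; exact: base_embed.
  have [|y yE] := cu (j - i)%N; first by rewrite subn_gt0.
  have ik : (i <= index M L)%N by exact: ltnW (leq_trans ij jk).
  rewrite /C -(subnK ik) exprD embedM -scalerA; apply: (LZ); first exact: base_embed.
  have -> : (c ^+ i)%:A *: x = y%:A *: ((c ^+ i)%:A *: x - (c ^+ j)%:A *: x).
    rewrite -scalerBl scalerA -embedB -embedM; congr (_%:A *: _).
    have -> : c ^+ j = c ^+ i * c ^+ (j - i) by rewrite -exprD subnKC// ltnW.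
    rewrite -[X in _ * (X - _)]mulr1 -mulrBr.
    by rewrite mulrCA [y * _]mulrC yE mulr1.
  by apply: LZ => //; exact: base_embed.
have CP : regular iota (c ^+ index M L).
  by move=> i; rewrite rmorphXn expf_neq0//; exact: cP.
split=> //; last first.
  apply: (span_setT_sub _ (lattice_scaled_span CP spanM)) => _ [x Mx <-].
  by apply: sub_lspan => //; exact: CL.
have sCM : submodule R0 (scaled C M) by exact: scaled_submodule.
have gCM := submodule_subgroup sR sCM.
have fCM : finite_index L (scaled C M).
  apply: (finite_index_subl LM); rewrite ME; apply: finite_index_scaled => //.
  exact: coefficients_base.
have [r [rL rP _]] := finite_index_transversal gCM fCM.
pose v' (k : 'I_(n + index L (scaled C M))) :=
  match fintype.split k with inl j => C *: v j | inr j => r j end.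
exists (n + index L (scaled C M))%N, v'.
have Mv j : M (v j) by rewrite ME; apply: sub_lspan => //; exists j.
have sL' := lspan_submodule (range v') RM.
apply/seteqP; split; last first.
  apply: lspan_sub => // _ [k _ <-]; rewrite /v'.
  by case: fintype.split => j; [exact: CL|exact: rL].
move=> x /rP[k]; move=> h; apply: (subgroup_subl (submodule_subgroup sR sL') (y := r k)).
  move: h => [y]; rewrite {1}ME => /lspan_rangeP -/(_ gR)[a Ra ->] <-.
  rewrite scaler_sumr; have [S0 SD SZ] := sL'; elim/big_ind: _ => // j _.
  rewrite scalerA mulrC -scalerA; apply: SZ => //; apply: sub_lspan => //.
  by exists (lshift _ j) => //; rewrite /v' -[lshift _ _]/(unsplit (inl j)) unsplitK.
apply: sub_lspan => //; exists (rshift _ k) => //.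
by rewrite /v' -[rshift _ _]/(unsplit (inr k)) unsplitK.
Qed.

Lemma lattice_aut (S : set A) L g g' : automorphism g g' -> lattice S L ->
  lattice S (g @` L).
Proof.
move=> ga [sL [n [v LE]] spanL]; split; first exact: aut_submodule ga sL.
  exists n, (g \o v); rewrite LE -(aut_lspan _ _ ga); congr lspan.
  by rewrite image_comp.
rewrite (aut_lspan _ _ ga) spanL; apply/seteqP; split=> // x _.
by exists (g' x) => //; have [_ _ ->] := ga.
Qed.

Local Notation std := (@std_lattice A Rt d).

Lemma std_span : std = lspan Rt (range (fun j => delta_mx ord0 j : V)).
Proof.
have [R1 gR RM] := norm_subring iota.
apply/seteqP; split=> x.
  move=> Rx; apply/lspan_rangeP => //; exists (fun j => x ord0 j) => //.
  exact: row_sum_delta.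
move=> /lspan_rangeP -/(_ gR)[a Ra ->] j.
rewrite summxE; elim/big_ind: _ => [|x1 x2|k _]; first exact: subgroup0.
  exact: (subgroupD gR).
rewrite !mxE; apply: (RM) => //.
by case: (_ && _) => //; exact: subgroup0.
Qed.

Lemma std_full : lspan setT std = setT.
Proof.
apply/seteqP; split=> // x _; rewrite [x]row_sum_delta.
exists d, (fun j => x ord0 j), (fun j => delta_mx ord0 j); split=> // j k.
have [R1 gR _] := norm_subring iota; rewrite mxE.
by case: (_ && _) => //; exact: subgroup0.
Qed.

Section Free.
Variables (e w wi : 'I_b -> A).
Hypothesis sl : semilocal Rt e w wi.

(** A multiple of [N] has finite index in the standard lattice, and submodules of
    finite index in a free module are free. *)
Lemma commensurable_free N c : submodule Rt N -> lspan setT N = setT ->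
  regular iota c -> (forall x, N x -> std (c%:A *: x)) -> free_module Rt N.
Proof.
move=> sN spanN cP cN; have sS := std_submodule sl d.
have sC : submodule Rt (scaled c%:A N) by exact: scaled_submodule.
have Cs : scaled c%:A N `<=` std by move=> _ [x /cN ? <-].
have fC : finite_index std (scaled c%:A N).
  apply: (lattice_finite_index coefficients_norm) => //.
    by exists d, (fun j => delta_mx ord0 j); exact: std_span.
  exact: lattice_scaled_span.
have fs : free_module Rt std.
  by exists id, id; rewrite image_id; split=> //; exact: aut_id.
have [u uc cu] := regular_unit cP.
have fCN := free_finite_index sl fs sC Cs fC.
have -> : N = ( *:%R u) @` (scaled c%:A N).
  apply/seteqP; split=> [x Nx|_ [_ [x Nx <-] <-]].
    by exists (c%:A *: x); [exists x|rewrite scalerA uc scale1r].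
  by rewrite scalerA uc scale1r.
exact: (free_image (aut_scale V cu) fCN).
Qed.

Lemma span_lattice S L : lattice_coefficients S -> lattice S L -> S `<=` Rt ->
  [/\ submodule Rt (lspan Rt L), fin_gen Rt (lspan Rt L),
      lspan setT (lspan Rt L) = setT & free_module Rt (lspan Rt L)].
Proof.
move=> cS [sL [n [v LE]] spanL] SR; have [R1 gR RM] := norm_subring iota.
have sN : submodule Rt (lspan Rt L) by exact: lspan_submodule.
have [[S1 _ _] _ _] := cS.
have NE : lspan Rt L = lspan Rt (range v).
  apply/seteqP; split; apply: lspan_sub; try exact: lspan_submodule.
    rewrite LE => _ [k [a [y [Sa yv ->]]]]; exists k, a, y; split=> // j.
    exact: SR.
  by move=> _ [j _ <-]; apply: sub_lspan => //; rewrite LE; apply: sub_lspan => //; exists j.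
have span : lspan setT (lspan Rt L) = setT.
  by apply: (span_setT_sub _ spanL) => x Lx; apply: sub_lspan => //; exact: sub_lspan.
split=> //; first by exists n, v.
have [c cP cN] := @clear_denominators Rt std n v coefficients_norm
  (std_submodule sl d) std_full.
by apply: (commensurable_free sN span cP) => x; rewrite NE; exact: cN.
Qed.

Lemma free_sum T N : submodule Rt T -> fin_gen Rt T -> lspan setT T = setT ->
  submodule Rt N -> fin_gen Rt N ->
  let P := [set x + y | x in T & y in N] in
  [/\ submodule Rt P, free_module Rt P & finite_index P T].
Proof.
move=> sT [n [v TE]] spanT sN [k [u NE]] P.
have [R1 gR RM] := norm_subring iota.
have sP : submodule Rt P by exact: submodule_add.
have TP : T `<=` P by move=> x Tx; exists x => //; exists 0; [case: sN|rewrite addr0].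
have NP : N `<=` P by move=> x Nx; exists 0; [case: sT|exists x; rewrite ?add0r].
pose v' (j : 'I_(n + k)) := match fintype.split j with inl j => v j | inr j => u j end.
have PE : P = lspan Rt (range v').
  have sL := lspan_submodule (range v') RM.
  apply/seteqP; split.
    move=> _ [x Tx [y Ny <-]]; case: (sL) => _ LD _; apply: LD.
      move: x Tx; rewrite TE; apply: lspan_sub => // _ [j _ <-]; apply: sub_lspan => //.
      by exists (lshift _ j) => //; rewrite /v' -[lshift _ _]/(unsplit (inl j)) unsplitK.
    move: y Ny; rewrite NE; apply: lspan_sub => // _ [j _ <-]; apply: sub_lspan => //.
    by exists (rshift _ j) => //; rewrite /v' -[rshift _ _]/(unsplit (inr j)) unsplitK.
  apply: lspan_sub => // _ [j _ <-]; rewrite /v'; case: fintype.split => l.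
    by apply: TP; rewrite TE; apply: sub_lspan => //; exists l.
  by apply: NP; rewrite NE; apply: sub_lspan => //; exists l.
have spanP : lspan setT P = setT.
  by apply: (span_setT_sub _ spanT) => x /TP; apply: sub_lspan.
have fgP : fin_gen Rt P by exists (n + k)%N, v'.
split=> //.
  have [c cP cN] := @clear_denominators Rt std (n + k) v' coefficients_norm
    (std_submodule sl d) std_full.
  by apply: (commensurable_free sP spanP cP) => x; rewrite PE; exact: cN.
exact: (lattice_finite_index coefficients_norm).
Qed.

(** The rank predicate of the boundary strata is a residue basis modulo
    [Mu + w i N]. *)
Hypothesis max_gen : forall i, norm_max iota i = [set w i * t | t in Rt].

Lemma lspan_norm_max i N : submodule Rt N ->
  lspan (norm_max iota i) N = scaled (w i) N.
Proof.
move=> sN; have sS := scaled_submodule (w i) sN; have [N0 ND NZ] := sN.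
have [R1 gR RM] := norm_subring iota.
apply/seteqP; split=> [x [n [a [v [am Nv ->]]]]|_ [x Nx <-]].
  have [S0 SD SZ] := sS; elim/big_ind: _ => // j _.
  have := am j; rewrite max_gen => -[t Rt' <-]; rewrite -scalerA.
  by exists (t *: v j) => //; exact: NZ.
exists 1%N, (fun=> w i), (fun=> x); split=> // [_|]; last by rewrite big_ord1.
by rewrite max_gen; exists 1; rewrite ?mulr1.
Qed.

Lemma rank_atP N Mu i k : submodule Rt N ->
  rank_at iota N Mu i k <-> exists v : 'I_k -> V,
    residue_basis Rt w N (rank_mod w i Mu N) i v.
Proof.
move=> sN; rewrite /rank_at lspan_norm_max// max_gen.
by split=> -[v [Nv vgen vfree]]; exists v.
Qed.

End Free.
End OrderLattices.

(** * Dirichlet polynomials *)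

Section DirichletPolynomials.
Variable F : realType.
Local Notation C := F[i].
Implicit Types f g : C -> C.

Lemma dirichlet_polynomialP f : dirichlet_polynomial f <->
  exists2 l : seq (C * nat), all (fun p => 0 < p.2)%N l &
    forall s, f s = \sum_(p <- l) p.1 * cpow p.2 (- s).
Proof.
split=> [[N [a fE]]|[l l0 fE]].
  exists [seq (a n, n) | n <- index_iota 1 N].
    by apply/allP => _ /mapP[n + ->]; rewrite mem_index_iota => /andP[].
  by move=> s; rewrite fE big_map.
exists (\max_(p <- l) p.2).+1, (fun n => \sum_(p <- l | p.2 == n) p.1) => s.
rewrite fE; under [RHS]eq_bigr do rewrite mulr_suml.
rewrite (exchange_big_dep xpredT)//= big_seq [RHS]big_seq.
apply: eq_bigr => p pl.
have pN : (1 <= p.2 < (\max_(p <- l) p.2).+1)%N.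
  by rewrite (allP l0)// ltnS; exact: leq_bigmax_seq.
rewrite [RHS]big_mkcond (bigD1_seq p.2) ?iota_uniq ?mem_index_iota//= eqxx.
by rewrite big1 ?addr0// => n; rewrite eq_sym => /negPf ->.
Qed.

Lemma dirichlet_cst c : dirichlet_polynomial (fun _ : C => c).
Proof.
apply/dirichlet_polynomialP; exists [:: (c, 1%N)] => // s.
by rewrite big_seq1 cpow1 mulr1.
Qed.

Lemma dirichlet_cpow n : (0 < n)%N -> dirichlet_polynomial (fun s : C => cpow n (- s)).
Proof.
move=> n0; apply/dirichlet_polynomialP; exists [:: (1, n)] => [|s] /=; first by rewrite n0.
by rewrite big_seq1 mul1r.
Qed.

Lemma dirichletD f g : dirichlet_polynomial f -> dirichlet_polynomial g ->
  dirichlet_polynomial (fun s => f s + g s).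
Proof.
move=> /dirichlet_polynomialP[l l0 fE] /dirichlet_polynomialP[l' l0' gE].
apply/dirichlet_polynomialP; exists (l ++ l'); first by rewrite all_cat l0.
by move=> s; rewrite big_cat fE gE.
Qed.

Lemma dirichletM f g : dirichlet_polynomial f -> dirichlet_polynomial g ->
  dirichlet_polynomial (fun s => f s * g s).
Proof.
move=> /dirichlet_polynomialP[l l0 fE] /dirichlet_polynomialP[l' l0' gE].
apply/dirichlet_polynomialP.
exists [seq (p.1 * p'.1, (p.2 * p'.2)%N) | p <- l, p' <- l'].
  apply/allP => _ /allpairsP[[p p'] /= [pl pl' ->]] /=.
  by rewrite muln_gt0 (allP l0)// (allP l0').
move=> s; rewrite big_allpairs_dep fE gE mulr_suml big_seq [RHS]big_seq.
apply: eq_bigr => p pl; rewrite mulr_sumr big_seq [RHS]big_seq.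
apply: eq_bigr => p' pl'.
rewrite -[RHS]/(p.1 * p'.1 * cpow (p.2 * p'.2) (- s)).
by rewrite (cpowM _ (allP l0 _ pl) (allP l0' _ pl')) mulrACA.
Qed.

Lemma dirichlet_sum (I : eqType) (r : seq I) (Q : pred I) (f : I -> C -> C) :
  (forall i, i \in r -> Q i -> dirichlet_polynomial (f i)) ->
  dirichlet_polynomial (fun s => \sum_(i <- r | Q i) f i s).
Proof.
elim: r => [|i r IH] fP.
  rewrite (_ : (fun s => _) = fun=> 0); first exact: dirichlet_cst.
  by apply/funext => s; rewrite big_nil.
have {}IH := IH (fun j jr => fP j (mem_behead (s := i :: r) jr)).
have [Qi|Qi] := boolP (Q i); last first.
  rewrite (_ : (fun s => _) = fun s => \sum_(j <- r | Q j) f j s)//.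
  by apply/funext => s; rewrite big_cons (negPf Qi).
rewrite (_ : (fun s => _) = fun s => f i s + \sum_(j <- r | Q j) f j s).
  by apply: dirichletD => //; apply: fP => //; exact: mem_head.
by apply/funext => s; rewrite big_cons Qi.
Qed.

Lemma dirichlet_prod (I : Type) (r : seq I) (Q : pred I) (f : I -> C -> C) :
  (forall i, dirichlet_polynomial (f i)) ->
  dirichlet_polynomial (fun s => \prod_(i <- r | Q i) f i s).
Proof.
move=> fP; elim: r => [|i r IH].
  rewrite (_ : (fun s => _) = fun=> 1); first exact: dirichlet_cst.
  by apply/funext => s; rewrite big_nil.
have [Qi|Qi] := boolP (Q i); last first.
  rewrite (_ : (fun s => _) = fun s => \prod_(j <- r | Q j) f j s)//.
  by apply/funext => s; rewrite big_cons (negPf Qi).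
rewrite (_ : (fun s => _) = fun s => f i s * \prod_(j <- r | Q j) f j s).
  by apply: dirichletM.
by apply/funext => s; rewrite big_cons Qi.
Qed.

Lemma dirichlet_qpoch n q k : (0 < n)%N ->
  dirichlet_polynomial (fun s : C => qpoch (cpow n (- s)) q k).
Proof.
move=> n0; apply: dirichlet_prod => j.
rewrite (_ : (fun s => _) = fun s => 1 + (- q ^+ j) * cpow n (- s)).
  apply: dirichletD; first exact: dirichlet_cst.
  by apply: dirichletM; [exact: dirichlet_cst|exact: dirichlet_cpow].
by apply/funext => s; rewrite mulNr mulrC.
Qed.

End DirichletPolynomials.

(** * Boundary strata *)

Section BoundaryStrata.
Variables (R : comNzRingType) (b : nat) (K : 'I_b -> fieldType).
Variable iota : forall i, {rmorphism R -> K i}.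
Hypothesis alo : arithmetic_local_order iota.
Local Notation A := (total_ring K).
Local Notation R0 := (base_ring iota).
Local Notation Rt := (normalization iota).
Local Notation "c %:A" := (embed iota c) : ring_scope.
Variables (e w wi : 'I_b -> A).
Hypotheses (sl : semilocal Rt e w wi)
  (max_gen : forall i, norm_max iota i = [set w i * t | t in Rt])
  (card_gen : forall i, index Rt [set w i * t | t in Rt] = residue_card iota i).
Variables (d : nat) (M Mu : set 'rV[A]_d).
Local Notation V := 'rV[A]_d.
Implicit Types (L N T : set V).
Hypotheses (latM : lattice R0 M) (latMu : lattice Rt Mu) (MuM : Mu `<=` M).
Local Notation q i := (residue_card iota i).
Local Notation supp := (@supplements A Rt d).
Local Notation Rspan L := (lspan Rt L : set V).

Let sub_gpt N : submodule Rt N -> subgroup N.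
Proof. exact: submodule_subgroup (norm_subring iota). Qed.
Let sub_gp0 N : submodule R0 N -> subgroup N.
Proof. exact: submodule_subgroup (base_subring iota). Qed.
Let sub_base N : submodule Rt N -> submodule R0 N.
Proof. by case=> N0 ND NZ; split=> // a x /base_norm; exact: NZ. Qed.
Let sMu : submodule Rt Mu. Proof. by case: latMu. Qed.

Definition boundary : set (set V) :=
  [set L | [/\ lattice R0 L, L `<=` M & Mu `<=` Rspan L]].

(** A multiple of the conductor carries the [Rt]-span of [L] back into [L], with
    a constant that does not depend on [L]. *)
Lemma conductor_absorb : exists2 c, regular iota c & forall L, submodule R0 L ->
  forall x, Rspan L x -> L (c%:A *: x).
Proof.
have [c cP cR] := conductor alo; exists c => // L [L0 LD LZ] _ [n [a [v [Ra Lv ->]]]].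
rewrite scaler_sumr; elim/big_ind: _ => // j _.
by rewrite scalerA; apply: LZ => //; exact: cR.
Qed.

Lemma finite_index_base L N : lattice R0 L -> submodule R0 N ->
  lspan setT N = setT -> N `<=` L -> finite_index L N.
Proof.
move=> [sL fL _] sN spanN.
exact: (lattice_finite_index alo (coefficients_base alo)).
Qed.

(** All members lie between a fixed multiple of [Mu] and [M]. *)
Lemma boundary_finite : finite_set boundary.
Proof.
have [c cP cL] := conductor_absorb.
have [_ _ spanMu] := latMu.
have sX : submodule Rt (scaled c%:A Mu) by exact: scaled_submodule.
have XM : scaled c%:A Mu `<=` M.
  move=> x Xx; apply: MuM; apply: (scaled_sub _ sMu) Xx.
  by apply: base_norm; exact: base_embed.
have fX : finite_index M (scaled c%:A Mu).
  by apply: finite_index_base => //; [exact: sub_base|exact: lattice_scaled_span].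
apply: sub_finite_set (finite_set_between (sub_gpt sX) fX).
move=> L [[sL _ _] LM MuL]; split=> //; first exact: sub_gp0.
by move=> _ [x /MuL Lx <-]; exact: cL.
Qed.

Lemma boundary_finite_index L : boundary L -> finite_index M L.
Proof. by move=> [[sL _ spanL] LM _]; exact: finite_index_base. Qed.

Let span_free L : lattice R0 L -> [/\ submodule Rt (Rspan L), fin_gen Rt (Rspan L),
  lspan setT (Rspan L) = setT & free_module Rt (Rspan L)].
Proof.
move=> lL; apply: (span_lattice alo sl (coefficients_base alo) lL).
exact: base_norm.
Qed.

Let rank_mod_facts L i : boundary L ->
  [/\ submodule Rt (rank_mod w i Mu (Rspan L)),
      scaled (w i) (Rspan L) `<=` rank_mod w i Mu (Rspan L),
      rank_mod w i Mu (Rspan L) `<=` Rspan L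
    & finite_index (Rspan L) (rank_mod w i Mu (Rspan L))].
Proof.
move=> [lL LM MuL]; have [sN _ _ fN] := span_free lL.
have sY := rank_mod_submodule w i sMu sN.
have wY : scaled (w i) (Rspan L) `<=` rank_mod w i Mu (Rspan L).
  by move=> x wx; exact: (rank_mod_subr sMu wx).
split=> //; first exact: (rank_mod_sub sl).
have [fw _] := free_residue_index sl i fN.
exact: finite_index_subr (sub_gpt (scaled_submodule (w i) sN)) (sub_gpt sY) wY fw.
Qed.

Lemma boundary_rank L : boundary L -> exists rho : {ffun 'I_b -> 'I_d.+1},
  forall i, index (Rspan L) (rank_mod w i Mu (Rspan L)) = (q i ^ rho i)%N.
Proof.
move=> BL; have [lL LM MuL] := BL; have [sN _ _ fN] := span_free lL.
have /choice[k kP] i : exists k : 'I_d.+1,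
    index (Rspan L) (rank_mod w i Mu (Rspan L)) = (q i ^ k)%N.
  have [sY wY YN fY] := rank_mod_facts i BL.
  have [k [v vb]] := residue_basis_exists sl sN sY wY YN fY.
  have [_ kE] := residue_basis_index sl sN sY wY vb.
  have kd : (k < d.+1)%N by rewrite ltnS; exact: (rank_le sl fN sMu MuL kE).
  by exists (Ordinal kd); rewrite kE card_gen.
by exists [ffun i => k i] => i; rewrite ffunE.
Qed.

Lemma boundary_stratumP (r : 'I_b -> nat) L :
  boundary_stratum iota M Mu r L <-> boundary L /\
  forall i, index (Rspan L) (rank_mod w i Mu (Rspan L)) = (q i ^ r i)%N.
Proof.
have main : boundary L -> forall i k, rank_at iota (Rspan L) Mu i k <->
    index (Rspan L) (rank_mod w i Mu (Rspan L)) = (q i ^ k)%N.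
  move=> BL i k; have [lL _ _] := BL; have [sN _ _ fN] := span_free lL.
  have [sY wY YN fY] := rank_mod_facts i BL.
  rewrite (rank_atP max_gen)//; split=> [[v vb]|kE].
    by have [_ ->] := residue_basis_index sl sN sY wY vb; rewrite card_gen.
  have [k' [v vb]] := residue_basis_exists sl sN sY wY YN fY.
  have [_] := residue_basis_index sl sN sY wY vb.
  rewrite kE -card_gen => /eqP; rewrite eqn_exp2l ?(residue_card_gt1 sl)// => /eqP kk'.
  by rewrite kk'; exists v.
split=> [[lL LM MuL rk]|[[lL LM MuL] rk]].
  by split=> // i; apply/main.
by split=> // i; apply/main.
Qed.

(** Moving [L] by an automorphism congruent to the identity modulo [Mu] keeps
    it inside [M] and multiplies its index by that of its [Rt]-span; both
    indices are compared with that of a multiple of the span inside [L]. *)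
Lemma boundary_move L T g g' : boundary L -> supp (Rspan L) Mu T ->
  automorphism g g' -> g @` Rspan L = T ->
  (forall x, Rspan L x -> Mu (g x - x)) ->
  [/\ submodule R0 (g @` L), g @` L `<=` M, finite_index M (g @` L)
    & index M (g @` L) = (index M L * index (Rspan L) T)%N].
Proof.
move=> BL [sT TN fNT _] ga gT gMu; have [lL LM MuL] := BL.
have [sL _ _] := lL; have [sN _ spanN fN] := span_free lL.
have [sM _ _] := latM; have [R1 _ _] := norm_subring iota.
have [c cP cL] := conductor_absorb.
have sgL : submodule R0 (g @` L) by exact: (aut_submodule ga sL).
have gLM : g @` L `<=` M.
  move=> _ [x Lx <-]; apply: (subgroup_subl (sub_gp0 sM) (y := x)); last exact: LM.
  by apply: MuM; apply: gMu; exact: sub_lspan.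
pose X := scaled c%:A (Rspan L).
have sX : submodule Rt X by exact: scaled_submodule.
have XL : X `<=` L by move=> _ [x Nx <-]; exact: cL.
have fLX : finite_index L X.
  by apply: finite_index_base => //; [exact: sub_base|exact: lattice_scaled_span].
have fML := boundary_finite_index BL.
have gXE : g @` X = scaled c%:A T by rewrite (aut_scaled _ _ ga) gT.
have [u uc _] := regular_unit cP; have sc := aut_scale V uc.
have [fXT iXT] := aut_index sc (sub_gpt sT) fNT.
rewrite -/(scaled c%:A (Rspan L)) -/(scaled c%:A T) -gXE in fXT iXT.
have [fgLX igLX] := aut_index ga (sub_gpt sX) fLX.
have sgX : submodule Rt (g @` X) := aut_submodule ga sX.
have gXX : g @` X `<=` X by rewrite gXE => _ [x Tx <-]; exists x => //; exact: TN.
have gM := sub_gp0 sM; have gL := sub_gp0 sL.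
have [fMX iMX] := index_mul gL (sub_gpt sX) LM XL gM fML fLX.
have XM : X `<=` M by move=> x /XL/LM.
have [fMgX iMgX] := index_mul (sub_gpt sX) (sub_gpt sgX) XM gXX gM fMX fXT.
have gXL : g @` X `<=` g @` L by exact: image_subset.
have iM := index_mulr gM (sub_gp0 sgL) (sub_gpt sgX) gLM gXL fMgX.
split=> //.
  exact: finite_index_subr (sub_gpt sgX) (sub_gp0 sgL) gXL fMgX.
have p0 : (0 < index L X)%N.
  by apply: (index_gt0 (sub_gpt sX) _ fLX); exact: subgroup0 gL.
apply/eqP; rewrite -(eqn_pmul2r p0) -{1}igLX -iM iMgX iMX iXT; apply/eqP; ring.
Qed.

Section Fibers.
Variable gg : set V -> set V -> (V -> V) * (V -> V).
Hypothesis ggP : forall N T, free_module Rt N -> Mu `<=` N -> supp N Mu T ->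
  [/\ automorphism (gg N T).1 (gg N T).2, (gg N T).1 @` N = T
    & forall y, N y -> Mu ((gg N T).1 y - y)].

Let move L T : set V := (gg (Rspan L) T).1 @` L.

Lemma span_move L T : boundary L -> supp (Rspan L) Mu T -> Rspan (move L T) = T.
Proof.
move=> [lL LM MuL] sT; have [sN _ _ fN] := span_free lL.
have [ga gN _] := ggP fN MuL sT.
by rewrite /move (aut_lspan _ _ ga) gN.
Qed.

(** The span of [L] is recovered from that of its image, so the automorphism is
    too. *)
Lemma supplement_span N T : submodule Rt N -> Mu `<=` N -> supp N Mu T ->
  N = [set x + y | x in T & y in Mu].
Proof.
move=> sN MuN [sT TN _ NTP]; apply/seteqP; split=> [x /NTP[t Tt Mux]|_ [x Tx [y Muy <-]]].
  by exists t => //; exists (x - t); rewrite // addrC subrK.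
by apply: (subgroupD (sub_gpt sN)); [exact: TN|exact: MuN].
Qed.

Lemma move_inj L L' T T' : boundary L -> boundary L' -> supp (Rspan L) Mu T ->
  supp (Rspan L') Mu T' -> move L T = move L' T' -> L = L' /\ T = T'.
Proof.
move=> BL BL' sT sT' e1.
have TT' : T = T' by rewrite -(span_move BL sT) e1 (span_move BL' sT').
split=> //; have [lL LM MuL] := BL; have [lL' LM' MuL'] := BL'.
have [sN _ _ fN] := span_free lL; have [sN' _ _ fN'] := span_free lL'.
have NN' : Rspan L = Rspan L'.
  by rewrite (supplement_span sN MuL sT) (supplement_span sN' MuL' sT') TT'.
have [ga _ _] := ggP fN MuL sT.
rewrite -(aut_imageK L ga) -[X in _ @` X]/(move L T) e1 /move -NN' -TT'.
exact: (aut_imageK L' ga).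
Qed.

(** Every finite-index submodule [L'] of [M] lies over exactly one member of
    the boundary, found from the supplement [Rspan L'] of [Mu] in
    [Rspan L' + Mu]. *)
Lemma move_surj : fin_index_submodules R0 M =
  \bigcup_(L in boundary) (move L @` supp (Rspan L) Mu).
Proof.
apply/seteqP; split=> [L' [sL' L'M fL']|_ [L BL [T sT <-]]]; last first.
  have [lL LM MuL] := BL; have [sN _ _ fN] := span_free lL.
  have [ga gN gMu] := ggP fN MuL sT.
  by have [] := boundary_move BL sT ga gN gMu.
have lL' := finite_index_lattice alo latM sL' L'M fL'.
have [sT fgT spanT fT] := span_free lL'; set T := Rspan L' in sT fgT spanT fT.
have [_ fgMu _] := latMu.
have := free_sum alo sl sT fgT spanT sMu fgMu; set N := [set x + y | x in T & y in Mu].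
move=> [sN fN fNT].
have MuN : Mu `<=` N by move=> x Mux; exists 0; [case: sT|exists x; rewrite ?add0r].
have TN : T `<=` N by move=> x Tx; exists x => //; exists 0; [case: sMu|rewrite addr0].
have sTN : supp N Mu T.
  split=> // _ [x Tx [y Muy <-]]; exists x => //.
  by rewrite addrC addKr.
have [ga gN gMu] := ggP fN MuN sTN.
have ga' := aut_sym ga; set g := (gg N T).1 in ga gN gMu ga'.
set g' := (gg N T).2 in ga ga'.
have NE : Rspan (g' @` L') = N.
  by rewrite (aut_lspan _ _ ga') -/T -gN (aut_imageK _ ga).
have [sM _ _] := latM; have [R1 _ _] := norm_subring iota.
exists (g' @` L'); last first.
  by exists T; rewrite ?NE// /move NE; exact: (aut_imageK L' ga').
split; [exact: (lattice_aut ga' lL')| |by rewrite NE].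
move=> _ [y L'y <-]; have Ny : N (g' y).
  by rewrite -NE; apply: sub_lspan => //; exists y.
apply: (subgroup_subr (sub_gp0 sM) (MuM (gMu _ Ny))).
by have [_ _ ->] := ga; exact: L'M.
Qed.

End Fibers.

Section ZetaSum.
Variables (F : realType) (s : F[i]) (zeta0 : F[i]).
Local Notation weight N := (fun T => cpow (index N T) (- s)).
Hypothesis zetaP : has_csum (supp (@std_lattice A Rt d) (@std_lattice A Rt d))
  (weight (@std_lattice A Rt d)) zeta0.
Local Notation factor rho :=
  (\prod_i qpoch (cpow (q i) (- s)) (q i)%:R (rho i)).

Lemma boundary_sumE (rho : set V -> {ffun 'I_b -> 'I_d.+1}) :
  (forall L, boundary L -> forall i,
    index (Rspan L) (rank_mod w i Mu (Rspan L)) = (q i ^ rho L i)%N) ->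
  boundary_sum iota M Mu s =
    \sum_(L <- fset_set boundary) factor (fun i => rho L i) * cpow (index M L) (- s).
Proof.
move=> rhoP; rewrite /boundary_sum.
have stratE (r : {ffun 'I_b -> 'I_d.+1}) :
    boundary_stratum iota M Mu (fun i => r i) = [set L | boundary L /\ rho L = r].
  apply/seteqP; split=> L; rewrite boundary_stratumP => -[BL rk]; split=> //.
    apply/ffunP => i; apply: val_inj; apply/eqP => /=.
    have q1 := residue_card_gt1 sl i; rewrite card_gen in q1.
    by rewrite -(eqn_exp2l _ _ q1) -(rhoP _ BL) -rk.
  by move=> i; rewrite -rk; exact: rhoP.
rewrite (eq_bigr (fun r : {ffun 'I_b -> 'I_d.+1} =>
    \sum_(L <- fset_set boundary | rho L == r)
      factor (fun i => r i) * cpow (index M L) (- s))); last first.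
  move=> r _; rewrite -mulr_sumr; congr (_ * _); rewrite stratE.
  have fB : finite_set [set L | boundary L /\ rho L = r].
    by apply: sub_finite_set boundary_finite => L [].
  rewrite fsbig_finite//= [RHS]big_fset_condE.
  rewrite (_ : fset_set _ = [fset L in fset_set boundary | rho L == r]%fset)//.
  apply/fsetP => L; rewrite !inE in_fset_set// in_fset_set; last exact: boundary_finite.
  apply/idP/andP => [/set_mem[BL ->]|[/set_mem BL /eqP]]; first by split=> //; exact/mem_set.
  by move=> rE; apply/mem_set.
rewrite (exchange_big_dep xpredT)//=; apply: eq_bigr => L _.
by rewrite (big_pred1 (rho L)) => [//|r]; rewrite /= eq_sym.
Qed.

(** The family attached to [L] contributes its term times a sum over the
    supplements of [Mu] in [Rspan L], which is the Euler factor of the ranks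
    times the zeta function of the normalization. *)
Theorem has_csum_boundary :
  has_csum (fin_index_submodules R0 M) (weight M) (boundary_sum iota M Mu s * zeta0).
Proof.
have /choice[rho rhoP] L : exists rho : {ffun 'I_b -> 'I_d.+1}, boundary L -> forall i,
    index (Rspan L) (rank_mod w i Mu (Rspan L)) = (q i ^ rho i)%N.
  have [BL|nBL] := pselect (boundary L); last by exists [ffun=> ord0].
  by have [rho] := boundary_rank BL; exists rho.
have /choice[gg ggP] (p : set V * set V) : exists g : (V -> V) * (V -> V),
    free_module Rt p.1 -> Mu `<=` p.1 -> supp p.1 Mu p.2 ->
    [/\ automorphism g.1 g.2, g.1 @` p.1 = p.2 & forall y, p.1 y -> Mu (g.1 y - y)].
  have [[fN [MuN [sT TN fNT NTP]]]|no] := pselect (free_module Rt p.1 /\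
     Mu `<=` p.1 /\ supp p.1 Mu p.2).
    by have [g [g' ?]] := automorphism_mod sl fN sT sMu TN MuN fNT NTP; exists (g, g').
  by exists (id, id) => *; exfalso; apply: no.
pose ggc N T := gg (N, T).
have ggcP N T : free_module Rt N -> Mu `<=` N -> supp N Mu T ->
  [/\ automorphism (ggc N T).1 (ggc N T).2, (ggc N T).1 @` N = T
    & forall y, N y -> Mu ((ggc N T).1 y - y)] by exact: (ggP (N, T)).
rewrite (boundary_sumE rhoP) mulr_suml (move_surj ggcP).
have bE : boundary = [set` enum_fset (fset_set boundary)].
  apply/seteqP; split=> L; first by move=> BL /=; rewrite in_fset_set ?inE//; exact: boundary_finite.
  by rewrite /= in_fset_set; [move/set_mem|exact: boundary_finite].
rewrite [X in \bigcup_(L in X) _]bE.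
have inB L : L \in fset_set boundary -> boundary L.
  by rewrite in_fset_set; [move/set_mem|exact: boundary_finite].
apply: has_csum_bigcup => [|L L' /inB BL /inB BL' [_ [[T sT <-] [T' sT']]]|L /inB BL].
- exact: fset_uniq.
- by move=> e1; have [] := move_inj ggcP BL' BL sT' sT e1.
have [lL LM MuL] := BL; have [sN _ _ fN] := span_free lL.
have h : has_csum (supp (Rspan L) Mu) (weight (Rspan L)) (factor (fun i => rho L i) * zeta0).
  have -> : factor (fun i => rho L i) = \prod_i qpoch
      (cpow (index Rt [set w i * t | t in Rt]) (- s))
      (index Rt [set w i * t | t in Rt])%:R (rho L i).
    by apply: eq_bigr => i _; rewrite card_gen.
  apply: (has_csum_supplements sl (alpha := fun n => cpow n (- s))) => //.
  - by move=> m n m0 n0; exact: cpowM.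
  - by move=> j; rewrite card_gen; exact: rhoP.
have := has_csumM (c := cpow (index M L) (- s)) h.
rewrite mulrCA mulrA; apply: has_csum_image.
  by move=> T T' sT sT' e1; have [] := move_inj ggcP BL BL sT sT' e1.
move=> T sT; have [ga gN gMu] := ggcP _ _ fN MuL sT.
have [_ _ _ ->] := boundary_move BL sT ga gN gMu.
have fML := boundary_finite_index BL; have [sL _ _] := lL; have [sT' _ fNT _] := sT.
have [sM _ _] := latM.
apply: cpowM; first by apply: (index_gt0 (sub_gp0 sL) _ fML); exact: subgroup0 (sub_gp0 sM).
by apply: (index_gt0 (sub_gpt sT') _ fNT); exact: subgroup0 (sub_gpt sN).
Qed.

End ZetaSum.

Lemma residue_card_gt0 i : (0 < q i)%N.
Proof. by rewrite -card_gen; exact: ltnW (residue_card_gt1 sl i). Qed.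

Lemma boundary_sum_dirichlet (F : realType) :
  dirichlet_polynomial (@boundary_sum F R b K iota d M Mu).
Proof.
have [sM _ _] := latM.
apply: dirichlet_sum => r _ _; apply: dirichletM.
  by apply: dirichlet_prod => i; apply: dirichlet_qpoch; exact: residue_card_gt0.
have fB : finite_set (boundary_stratum iota M Mu (fun i => r i)).
  by apply: sub_finite_set boundary_finite => L /boundary_stratumP[].
rewrite (_ : (fun s => _) = fun s => \sum_(L <- fset_set
    (boundary_stratum iota M Mu (fun i => r i))) cpow (index M L) (- s)); last first.
  by apply/funext => s; rewrite fsbig_finite.
apply: dirichlet_sum => L; rewrite in_fset_set// => /set_mem/boundary_stratumP[BL _] _.
apply: dirichlet_cpow; have [[sL _ _] _ _] := BL.
apply: (index_gt0 (sub_gp0 sL) _ (boundary_finite_index BL)).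
exact: subgroup0 (sub_gp0 sM).
Qed.

(** To the right of the abscissa [d - 1] all factors of the Euler product are positive,
    and its inverse bounds the partial sums. *)
Lemma normalization_zeta_converges (F : realType) (s : F[i]) :
  d%:R - 1 < complex.Re s ->
  zeta_converges Rt (free_lattice iota d) s.
Proof.
move=> ds; pose a n : F := expR (complex.Re (- s) * ln (n%:R : F)).
have fS : free_module Rt (@std_lattice A Rt d).
  by exists id, id; rewrite image_id; split=> //; exact: aut_id.
have sS := std_submodule sl d.
have Res : complex.Re (- s) = - complex.Re s by case: (s).
pose D : F := \prod_i \prod_(j < d)
  (1 - (index Rt [set w i * t | t in Rt])%:R ^+ j * a (index Rt [set w i * t | t in Rt])).
have aq i j : (j < d)%N -> (index Rt [set w i * t | t in Rt])%:R ^+ j *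
    a (index Rt [set w i * t | t in Rt]) < 1.
  have q1 := residue_card_gt1 sl i; move: q1; set n := Defs.index _ _ => n1 jd.
  have n0 : (0 : F) < n%:R by rewrite ltr0n ltnW.
  have -> : (n%:R : F) ^+ j = expR (j%:R * ln n%:R).
    by rewrite expRM_natl lnK ?posrE.
  rewrite /a -expRD -mulrDl expR_lt1 Res.
  rewrite pmulr_llt0; last by rewrite ln_gt0// ltr1n.
  have : (j.+1%:R : F) <= d%:R by rewrite ler_nat.
  by rewrite -natr1; lra.
have D0 : 0 < D.
  by apply: prodr_gt0 => i _; apply: prodr_gt0 => j _; rewrite subr_gt0; exact: aq.
have SE : fin_index_submodules Rt (free_lattice iota d) =
    supp (@std_lattice A Rt d) (@std_lattice A Rt d).
  by rewrite (supplements_self sS).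
apply: (@bounded_csummable _ _ _ _ D^-1) => B BS.
have -> : \sum_(T <- B) `|cpow (index (free_lattice iota d) T) (- s)| =
    (\sum_(T <- B) a (index (@std_lattice A Rt d) T))%:C%C.
  by rewrite rmorph_sum; apply: eq_bigr => T _; rewrite norm_cpow.
rewrite lecR -[leRHS]mul1r ler_pdivlMr// mulrC.
apply: (supplements_bound sl (a := a)) => //.
- by move=> n; exact: expR_ge0.
- by rewrite /a ln1 mulr0 expR0.
- by move=> m n m0 n0; rewrite /a natrM lnM ?posrE ?ltr0n// mulrDr expRD.
- by rewrite -SE.
Qed.

End BoundaryStrata.

Theorem theorem5p11 (F : realType) (R : comNzRingType) (b : nat)
    (K : 'I_b -> fieldType) (iota : forall i, {rmorphism R -> K i})
    (d : nat) (M Mu : set 'rV[total_ring K]_d) :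
  arithmetic_local_order iota ->
  lattice (base_ring iota) M ->
  lattice (normalization iota) Mu ->
  Mu `<=` M ->
  [/\ forall r : 'I_b -> nat,
        finite_set (boundary_stratum iota M Mu r) /\
        forall L, boundary_stratum iota M Mu r L -> finite_index M L,
      forall s : F[i], d%:R - 1 < complex.Re s ->
        [/\ zeta_converges (base_ring iota) M s,
            zeta_converges (normalization iota) (free_lattice iota d) s,
            zeta (normalization iota) (free_lattice iota d) s != 0
          & normalized_zeta iota M s = boundary_sum iota M Mu s]
    & dirichlet_polynomial (@boundary_sum F R b K iota d M Mu)].
Proof.
move=> alo latM latMu MuM.
have [e [w [wi [sl max_gen card_gen]]]] := normalization_semilocal alo.
have stratP := boundary_stratumP alo sl max_gen card_gen M latMu.
split; [move=> r|move=> s ds|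
  exact: (boundary_sum_dirichlet alo sl max_gen card_gen latM latMu MuM)].
  split=> [|L /stratP[BL _]]; last exact: (boundary_finite_index alo latM BL).
  by apply: sub_finite_set (boundary_finite alo latM latMu MuM) => L /stratP[].
have conv := @normalization_zeta_converges _ _ _ _ _ _ _ sl d F s ds.
have zP : has_csum (supplements (normalization iota) (free_lattice iota d)
    (free_lattice iota d)) (fun T => cpow (index (free_lattice iota d) T) (- s))
    (zeta (normalization iota) (free_lattice iota d) s).
  rewrite (supplements_self (std_submodule sl d)).
  exact: (csummable_has_csum conv).
set z := zeta (normalization iota) (free_lattice iota d) s in zP *.
have z0 : z != 0.
  apply/eqP => z0; rewrite z0 in zP.
  have := zeta_euler_product sl (cpow1 (- s)) (fun m n m0 n0 => cpowM (- s) m0 n0) zP.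
  by move/eqP; rewrite mulr0 eq_sym oner_eq0.
have hM := @has_csum_boundary _ _ _ _ alo _ _ _ sl max_gen card_gen _ _ _
  latM latMu MuM _ _ _ zP.
split.
- exact: (@has_csum_cvg _ _ _ _ _ hM).
- exact: conv.
- exact: z0.
- by rewrite /normalized_zeta -/z /zeta (has_csum_lim hM) mulfK.
Qed.
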